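(* Let $\mathcal{C}\subset\mathbb{R}_+^{\mathcal{R}}$ be a capacity set, and consider the continuous-time Markov process $(X(t))_{t\ge 0}$ on $\mathbb{N}^{\mathcal{R}}$ (system with Markovian users routing under proportional fairness) whose nonzero transition rates are $$x\to x+e_r \text{ at rate } \overline{\nu}_r,\qquad x\to x-e_r+e_s \text{ at rate } \mu_r\lambda_r^{\mathrm{PF}}(x)p_{rs},\qquad x\to x-e_r \text{ at rate } \mu_r\lambda_r^{\mathrm{PF}}(x)\Big(1-\sum_{s\in\mathcal{R}}p_{rs}\Big),$$ where $r,s\in\mathcal{R}$, $\overline{\nu}_r\ge 0$, $\mu_r>0$, and $P=(p_{rs})_{r,s\in\mathcal{R}}$ is a substochastic matrix with spectral radius strictly less than $1$. Let $\nu=(\nu_r)_{r\in\mathcal{R}}$ be the unique solution of $\nu_r=\overline{\nu}_r+\sum_{s\in\mathcal{R}}p_{sr}\nu_s$, $r\in\mathcal{R}$, and let $\rho_r=\nu_r/\mu_r$, $\rho=(\rho_r)_{r\in\mathcal{R}}$. If $\rho$ belongs to the interior of $\mathcal{C}$, then the Markov process is ergodic.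
   Context: $\mathcal{R}$ is a finite nonempty set (of user types); $e_r$ is the $r$-th unit vector of $\mathbb{R}^{\mathcal{R}}$; $\mathbb{N}=\{0,1,2,\dots\}$. A capacity set is a set $\mathcal{C}\subset\mathbb{R}_+^{\mathcal{R}}$ that is compact, convex, nonincreasing (if $\lambda,\lambda'\in\mathbb{R}_+^{\mathcal{R}}$, $\lambda_r\le\lambda'_r$ for all $r$ and $\lambda'\in\mathcal{C}$, then $\lambda\in\mathcal{C}$), and contains a vector with all coordinates strictly positive. The interior of $\mathcal C$ is taken in $\mathbb{R}^{\mathcal{R}}$. For $x\in\mathbb{R}_+^{\mathcal{R}}$, the proportionally fair allocation $\lambda^{\mathrm{PF}}(x)\in\mathcal{C}$ is the maximizer of $\sum_{r} x_r\log\lambda_r$ over $\lambda\in\mathcal{C}$, with the convention that $\lambda_r^{\mathrm{PF}}(x)=0$ when $x_r=0$ (and $0\cdot\log 0=0$); the coordinates with $x_r>0$ are uniquely determined and strictly positive. Ergodic means irreducible and positive recurrent (so there is a unique stationary probability distribution). *)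

(* Defs.v *)
From HB Require Import structures.
From mathcomp Require Import all_boot all_order all_algebra.
From mathcomp Require Import all_classical all_reals all_analysis.
From mathcomp Require Import measurable_realfun.
From mathcomp Require Import complex.
Import Order.TTheory GRing.Theory Num.Theory.
Import numFieldNormedType.Exports.

Set Implicit Arguments.
Unset Strict Implicit.
Unset Printing Implicit Defensive.

Local Open Scope classical_set_scope.
Local Open Scope ring_scope.

Definition spectral_radius (R : realType) (n : nat) (A : 'M[R]_n) : R :=
  sup [set ComplexField.Normc.normc z | z in
    [set z : R[i] | eigenvalue (map_mx (real_complex R) A) z]].

Definition substochastic (R : realType) (n : nat) (p : 'M[R]_n) : Prop :=
  (forall r s, 0 <= p r s) /\ (forall r, \sum_s p r s <= 1).

Definition capacity_set (R : realType) (n : nat) (C : set 'rV[R]_n) : Prop :=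
  [/\ (forall l, C l -> forall r, 0 <= l ord0 r),
      compact C,
      convex_set (C : set (convex_lmodType 'rV[R]_n)),
      (forall l l' : 'rV[R]_n, (forall r, 0 <= l ord0 r) ->
         (forall r, l ord0 r <= l' ord0 r) -> C l' -> C l)
    & (exists2 l, C l & forall r, 0 < l ord0 r)].

(* [lne] takes the value -oo at 0, and 0 * -oo = 0 in \bar R, so that the
   convention 0 log 0 = 0 is built in. *)
Definition pf_objective (R : realType) (n : nat) (x l : 'rV[R]_n) : \bar R :=
  (\sum_r (x ord0 r)%:E * lne (l ord0 r)%:E)%E.

Definition is_pf_allocation (R : realType) (n : nat) (C : set 'rV[R]_n)
    (x l : 'rV[R]_n) : Prop :=
  [/\ C l,
      (forall l', C l' -> (pf_objective x l' <= pf_objective x l)%E)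
    & (forall r, x ord0 r = 0 -> l ord0 r = 0)].

(* A rate function q : S -> S -> R on a countable state space is read off the
   diagonal only.  [fine] is harmless when the off-diagonal rates out of x have
   a finite sum, which every use of [exit_rate] presupposes. *)
Definition exit_rate (R : realType) (S : countType) (q : S -> S -> R) (x : S) : R :=
  fine (\esum_(y in [set y | y != x]) (q x y)%:E).

(* An absorbing state (exit rate 0) jumps to itself, after an infinite holding
   time. *)
Definition jump_matrix (R : realType) (S : countType) (q : S -> S -> R) (x y : S) : R :=
  if y == x then (exit_rate q x == 0)%:R else q x y / exit_rate q x.

Definition jump_time (R : realType) (Omega : Type) (W : nat -> Omega -> \bar R)
    (n : nat) (w : Omega) : \bar R :=
  (\sum_(i < n) W i w)%E.

(* Y is a Markov chain started at x with transition matrix [jump_matrix q], and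
   given Y the holding times W i are independent, exponential with parameters
   [exit_rate q (Y i)]. *)
Definition jump_chain_holding_times (R : realType) (S : countType)
    (q : S -> S -> R) (x : S) (d : measure_display) (Omega : measurableType d)
    (P : probability Omega R)
    (Y : nat -> Omega -> S) (W : nat -> Omega -> \bar R) : Prop :=
  [/\ (forall n y, measurable [set w | Y n w = y]),
      (forall n, measurable_fun [set: Omega] (W n)),
      (forall n w, (0 < W n w)%E)
    & (forall (n : nat) (y : nat -> S) (t : nat -> R),
         (forall i, 0 <= t i) ->
         P [set w | forall i, (i <= n)%N -> Y i w = y i /\ ((t i)%:E < W i w)%E]
         = ((y 0%N == x)%:R
            * (\prod_(i < n) jump_matrix q (y i) (y i.+1))
            * (\prod_(i < n.+1) expR (- (exit_rate q (y i) * t i))))%:E)].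

(* X is a right-continuous continuous-time Markov process with transition
   rates q under P, started at x, in its minimal version: None is the cemetery
   entered at the explosion time (if any). Only times t >= 0 are constrained. *)
Definition markov_process_from (R : realType) (S : countType)
    (q : S -> S -> R) (x : S) (d : measure_display) (Omega : measurableType d)
    (P : probability Omega R) (X : R -> Omega -> option S) : Prop :=
  exists (Y : nat -> Omega -> S) (W : nat -> Omega -> \bar R),
    [/\ jump_chain_holding_times q x P Y W,
        (forall t w n, 0 <= t ->
           (jump_time W n w <= t%:E)%E -> (t%:E < jump_time W n.+1 w)%E ->
           X t w = Some (Y n w))
      & (forall t w, 0 <= t ->
           (forall n, (jump_time W n w <= t%:E)%E) -> X t w = None)].

(* P x is the law under which the process starts at x. *)
Definition markov_process (R : realType) (S : countType)
    (q : S -> S -> R) (d : measure_display) (Omega : measurableType d)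
    (P : S -> probability Omega R) (X : R -> Omega -> option S) : Prop :=
  forall x, markov_process_from q x (P x) X.

Definition first_jump_time (R : realType) (S : countType) (Omega : Type)
    (X : R -> Omega -> option S) (w : Omega) : \bar R :=
  ereal_inf [set t%:E | t in [set t : R | 0 <= t /\ X t w <> X 0 w]].

Definition return_time (R : realType) (S : countType) (Omega : Type)
    (X : R -> Omega -> option S) (x : S) (w : Omega) : \bar R :=
  ereal_inf [set t%:E | t in
    [set t : R | [/\ 0 <= t, (first_jump_time X w <= t%:E)%E & X t w = Some x]]].

Definition irreducible_process (R : realType) (S : countType)
    (d : measure_display) (Omega : measurableType d)
    (P : S -> probability Omega R) (X : R -> Omega -> option S) : Prop :=
  forall x y, exists2 t : R, 0 <= t & (0 < P x [set w | X t w = Some y])%E.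

(* Every state has a finite mean return time. *)
Definition positive_recurrent (R : realType) (S : countType)
    (d : measure_display) (Omega : measurableType d)
    (P : S -> probability Omega R) (X : R -> Omega -> option S) : Prop :=
  forall x, (\int[P x]_w return_time X x w < +oo)%E.

Definition ergodic (R : realType) (S : countType)
    (d : measure_display) (Omega : measurableType d)
    (P : S -> probability Omega R) (X : R -> Omega -> option S) : Prop :=
  irreducible_process P X /\ positive_recurrent P X.

Definition state (n : nat) : countType := {ffun 'I_n -> nat}.

Definition add_user (n : nat) (x : state n) (r : 'I_n) : state n :=
  [ffun i => (x i + (i == r))%N].

(* x - e_r; the subtraction truncates when x r = 0, but it then occurs in the
   rates below only with coefficient 0. *)
Definition del_user (n : nat) (x : state n) (r : 'I_n) : state n :=
  [ffun i => (x i - (i == r))%N].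

Definition state_vec (R : realType) (n : nat) (x : state n) : 'rV[R]_n :=
  \row_r (x r)%:R.

(* The terms r = s of the routing sum only contribute to the diagonal, which is
   not a transition. *)
Definition routing_rate (R : realType) (n : nat) (nubar mu : 'I_n -> R)
    (p : 'M[R]_n) (lam : 'rV[R]_n -> 'rV[R]_n) (x y : state n) : R :=
  \sum_r nubar r * (y == add_user x r)%:R
  + \sum_r \sum_s mu r * lam (state_vec R x) ord0 r * p r s
      * (y == add_user (del_user x r) s)%:R
  + \sum_r mu r * lam (state_vec R x) ord0 r * (1 - \sum_s p r s)
      * (y == del_user x r)%:R.

(* Main.v *)
(* The Lyapunov function is [L x = sum_r x_r ln (y_r x)], where
   [y_r x = lambda_r x / rho_r] is the service ratio; by proportional fairness it
   is the maximum over the capacity set, and it is coercive because [rho] is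
   interior. The gradient of [L] is [ln y], and the traffic equations turn the
   drift of the fluid limit, [sum_r ln y_r * flow_r (y)], into minus an entropy
   dissipation, which is bounded away from [0] as soon as some [y_r] exceeds
   [1 + k/2].

   The allocation is discontinuous where a coordinate vanishes, so the drift is
   estimated over windows of length proportional to the total population [N]. A
   window is good when every coordinate is either above [theta N] or below
   [theta' N] at both ends: the ratio of a large coordinate then hardly varies,
   and the small coordinates barely contribute. Varying the window length over
   many scales with disjoint intervals [(theta' N, theta N)] makes bad windows
   rare on average, so that for each large state some deterministic time
   decreases the expectation of [L] linearly. The state-dependent Foster
   criterion for the uniformized chain bounds its hitting times; these solve the
   hitting inequalities of the jump chain, whence finite mean return times. *)
Require Import Defs.
From mathcomp Require Import all_boot all_order all_algebra.
From mathcomp Require Import all_classical all_reals all_analysis.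
From mathcomp Require Import measurable_realfun complex zify ring lra.
Import Order.TTheory GRing.Theory Num.Theory.
Import numFieldNormedType.Exports.

Set Implicit Arguments.
Unset Strict Implicit.
Unset Printing Implicit Defensive.

Local Open Scope classical_set_scope.
Local Open Scope ring_scope.

(** * Law of the jump chain *)

(** The uniformized chain is never built as a random process: its expectations are nested finite
    sums over sequences of moves. Only a supersolution [H] of its hitting inequalities is carried to
    the given process, whose law is known on cylinders alone. The averaging over scales rests on an
    order of quantifiers. The decrease [c] per step and the weight [A] of the exceptional terms are
    fixed before [theta] and the window length, so the number of scales can be taken large against
    [A / c], and each gap is then chosen below the previous one. A coordinate lies in at most one
    gap, which bounds the exceptional terms by the number of types, whatever the number of scales.
    Two singularities of the logarithm have to be tamed. The averaged ratio of a small coordinate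
    may vanish; mixing it with the balanced load 1 keeps its logarithm bounded without changing the
    direction of the flow. The increments of [L] are unbounded, because losing a user of a badly
    served type can cost about [- ln y]; their second moments are bounded, because such a loss
    occurs at a rate proportional to [y]. *)

Section finite_unions.
Local Open Scope ereal_scope.
Context {d} {T : measurableType d} {R : realType} (mu : {measure set T -> \bar R}).
Context {I : eqType} (A : I -> set T).
Hypothesis mA : forall i, measurable (A i).

Lemma measurable_seq_union (s : seq I) : measurable [set w | exists2 i, i \in s & A i w].
Proof.
elim: s => [|i s IH].
  by rewrite (_ : mkset _ = set0) //; apply/seteqP; split=> w // [].
rewrite (_ : mkset _ = A i `|` [set w | exists2 j, j \in s & A j w]).
  exact: measurableU.
apply/seteqP; split=> w /=.
  by move=> [j]; rewrite inE => /orP[/eqP->|js]; [left|right; exists j].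
by case=> [Ai|[j js Aj]]; [exists i|exists j] => //; rewrite inE ?eqxx ?js ?orbT.
Qed.

Lemma measure_seq_union_le (s : seq I) :
  mu [set w | exists2 i, i \in s & A i w] <= \sum_(i <- s) mu (A i).
Proof.
elim: s => [|i s IH].
  rewrite big_nil (_ : mkset _ = set0) ?measure0 //.
  by apply/seteqP; split=> w // [].
rewrite big_cons (_ : mkset _ = A i `|` [set w | exists2 j, j \in s & A j w]).
  apply: le_trans (measureU2 _ _ _) _ => //; first exact: measurable_seq_union.
  exact: leeD2l.
apply/seteqP; split=> w /=.
  by move=> [j]; rewrite inE => /orP[/eqP->|js]; [left|right; exists j].
by case=> [Ai|[j js Aj]]; [exists i|exists j] => //; rewrite inE ?eqxx ?js ?orbT.
Qed.

Lemma measure_seq_union (s : seq I) : uniq s -> (forall i j w, A i w -> A j w -> i = j) ->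
  mu [set w | exists2 i, i \in s & A i w] = \sum_(i <- s) mu (A i).
Proof.
move=> + dis; elim: s => [_|i s IH /= /andP[is_ us]].
  rewrite big_nil (_ : mkset _ = set0) ?measure0 //.
  by apply/seteqP; split=> w // [].
rewrite big_cons (_ : mkset _ = A i `|` [set w | exists2 j, j \in s & A j w]).
  have mU := measurable_seq_union s.
  rewrite measureU //; first by congr (_ + _); exact: IH.
  apply/seteqP; split=> w //= -[Ai [j js Aj]].
  by move: is_; rewrite (dis _ _ _ Ai Aj) js.
apply/seteqP; split=> w /=.
  by move=> [j]; rewrite inE => /orP[/eqP->|js]; [left|right; exists j].
by case=> [Ai|[j js Aj]]; [exists i|exists j] => //; rewrite inE ?eqxx ?js ?orbT.
Qed.

End finite_unions.

Section ereal_series.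
Local Open Scope ereal_scope.
Context {R : realType}.

Lemma lee_all_nat (x : \bar R) (y : \bar R) :
  (forall m : nat, mine m%:R%:E x <= y) -> x <= y.
Proof.
move: x => [r| |] h; last by rewrite leNye.
  have [m rm] : exists m : nat, (r <= m%:R)%R.
    by exists (Num.bound r); rewrite ltW // unstable.ltr_bound.
  by have := h m; rewrite min_r ?lee_fin.
have {}h (m : nat) : m%:R%:E <= y by have := h m; rewrite min_l ?leey.
case: y h => [r| |] h //.
  by have := h (Num.bound r); rewrite lee_fin leNgt unstable.ltr_bound.
by have := h 0%N.
Qed.

(** Layer-cake bound at integer levels: the series counts the integers below [W]. It reduces mean
    holding times to the tail probabilities that the law provides. *)
Lemma nneseries_ltn_ge (W : \bar R) :
  W <= \sum_(0 <= l <oo) (if l%:R%:E < W then 1 else 0).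
Proof.
apply: lee_all_nat => m.
apply: (@le_trans _ _ (\sum_(0 <= l < m) (if l%:R%:E < W then 1 else 0))).
  elim: m => [|m IH]; first by rewrite big_nil ge_min lexx.
  rewrite big_nat_recr //=; case: ifPn => [mW|]; last first.
    rewrite -leNgt => Wm; rewrite adde0; apply: le_trans IH.
    by rewrite (min_r Wm) ge_min lexx orbT.
  move: IH; rewrite (min_l (ltW mW)) => IH.
  rewrite ge_min; apply/orP; left; rewrite -natr1 EFinD; exact: leeD.
by apply: nneseries_lim_ge => l _ _; case: ifP.
Qed.

Lemma nneseries_ge1_pinfty (u : nat -> \bar R) :
  (forall l, 1 <= u l) -> \sum_(0 <= l <oo) u l = +oo.
Proof.
move=> u1; apply/eqP; rewrite -leye_eq; apply: lee_all_nat => m.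
apply: (@le_trans _ _ (\sum_(0 <= l < m) u l)); last first.
  by apply: nneseries_lim_ge => l _ _; exact: le_trans (u1 l).
rewrite ge_min; apply/orP; left; elim: m => [|m IH]; first by rewrite big_nil.
by rewrite big_nat_recr //= -natr1 EFinD; exact: leeD.
Qed.

(** The integrand in view, [return_time], is an infimum over uncountably many times, whose
    measurability would call for a separate argument. The integral is a supremum over simple
    functions below, which gives monotonicity at once. *)
Lemma ge0_le_integralT {d} {T : measurableType d} (mu : {measure set T -> \bar R})
    (f g : T -> \bar R) :
  (forall x, 0 <= f x) -> (forall x, f x <= g x) ->
  \int[mu]_x f x <= \int[mu]_x g x.
Proof.
move=> f0 fg; have g0 x := le_trans (f0 x) (fg x).
rewrite ge0_integralTE // ge0_integralTE //.
apply: ge_ereal_sup => _ [h hf <-]; apply: ereal_sup_ubound.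
by exists h => // x; exact: le_trans (fg x).
Qed.

End ereal_series.

Section jump_chain.
Local Open Scope ereal_scope.
Context {R : realType} {S : countType} (q : S -> S -> R) (succ : S -> seq S) (a : R).
Hypothesis a_gt0 : (0 < a)%R.
Hypothesis exit_ge : forall x, (a <= exit_rate q x)%R.
Hypothesis succ_uniq : forall x, uniq (succ x).
Hypothesis jump_ge0 : forall x y, (0 <= jump_matrix q x y)%R.
Hypothesis jump_succ : forall x, (\sum_(y <- succ x) jump_matrix q x y = 1)%R.

Definition path_weight (y : nat -> S) (n : nat) : R :=
  (\prod_(i < n) jump_matrix q (y i) (y i.+1))%R.

(** Probability that the jump chain from [x] stays off [z] during its first [i] jumps; the starting
    point itself may be [z]. *)
Fixpoint avoid (z : S) (i : nat) (x : S) : R :=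
  if i is i'.+1
  then (\sum_(y <- succ x | y != z) jump_matrix q x y * avoid z i' y)%R
  else 1%R.

Lemma avoid_ge0 z i x : (0 <= avoid z i x)%R.
Proof.
elim: i x => [//|i IH] x /=; apply: sumr_ge0 => y _; exact: mulr_ge0.
Qed.

Definition extend (y : nat -> S) (k : nat) (s : S) (j : nat) : S :=
  if (j <= k)%N then y j else s.

Lemma path_weight_ge0 y n : (0 <= path_weight y n)%R.
Proof. exact: prodr_ge0. Qed.

Lemma path_weight_extend y k s :
  path_weight (extend y k s) k.+1 = (path_weight y k * jump_matrix q (y k) s)%R.
Proof.
rewrite /path_weight big_ord_recr /= /extend leqnn ltnn; congr (_ * _)%R.
by apply: eq_bigr => i _; rewrite ltn_ord ltnW.
Qed.

Section law.
Context (x : S) {d : measure_display} {Omega : measurableType d}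
  (P : probability Omega R) (Y : nat -> Omega -> S) (W : nat -> Omega -> \bar R).
Hypothesis law : jump_chain_holding_times q x P Y W.

Let mY n y : measurable [set w | Y n w = y]. Proof. by case: law. Qed.
Let W_gt0 n w : 0 < W n w. Proof. by case: law. Qed.

Let mYneq n y : measurable [set w | Y n w <> y].
Proof.
by rewrite (_ : mkset _ = ~` [set w | Y n w = y]) //; exact: measurableC.
Qed.

Let mW n (l : \bar R) : measurable [set w | l < W n w].
Proof.
case: law => _ mW _ _; rewrite -[X in measurable X]setTI.
exact: emeasurable_fun_o_infty.
Qed.

Lemma measurable_forall_nat (Q : nat -> bool) (A : nat -> set Omega) :
  (forall j, measurable (A j)) -> measurable [set w | forall j, Q j -> A j w].
Proof.
move=> mA; rewrite (_ : mkset _ = \bigcap_(j in [set j | Q j]) A j) //.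
exact: bigcap_measurableType.
Qed.

Lemma law_path_holding k y (l : R) : (0 <= l)%R ->
  P [set w | (forall j, (j <= k)%N -> Y j w = y j) /\ l%:E < W k w] =
  ((y 0%N == x)%:R * path_weight y k * expR (- (exit_rate q (y k) * l)))%:E.
Proof.
case: law => _ _ _ + l0.
move=> /(_ k y (fun i => if i == k then l else 0%R)) H.
rewrite (_ : [set w | _] = [set w | forall i, (i <= k)%N -> Y i w = y i /\
   (if i == k then l else 0%R)%:E < W i w]); last first.
  apply/seteqP; split=> w /=.
    move=> [Yw Ww] i ik; split; first exact: Yw.
    by case: eqP => [->|_].
  move=> h; split; first by move=> j /h[].
  by have := h k (leqnn k); rewrite eqxx => -[].
rewrite H; last by move=> i; case: ifP.
congr (_ * _)%:E; rewrite big_ord_recr /= eqxx big1 ?mul1r // => i _.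
by rewrite ltn_eqF // mulr0 oppr0 expR0.
Qed.

Lemma law_path k y : P [set w | forall j, (j <= k)%N -> Y j w = y j] =
  ((y 0%N == x)%:R * path_weight y k)%:E.
Proof.
have := @law_path_holding k y 0%R (lexx _).
rewrite mulr0 oppr0 expR0 mulr1 => <-; congr (P _).
by apply/seteqP; split=> w /=; [move=> h; split => //|case].
Qed.

Let mpath k y : measurable [set w | forall j, (j <= k)%N -> Y j w = y j].
Proof.
exact: (measurable_forall_nat (fun j => (j <= k)%N)
          (fun j => mY j (y j))).
Qed.

Let pathS k y s w :
  (forall j, (j <= k.+1)%N -> Y j w = extend y k s j) <->
  (forall j, (j <= k)%N -> Y j w = y j) /\ Y k.+1 w = s.
Proof.
split=> [h|[h hs] j jk].
  split=> [j jk|]; first by rewrite h 1?leqW // /extend jk.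
  by rewrite h // /extend ltnn.
rewrite /extend; case: ifPn => [/h//|]; rewrite -ltnNge => kj.
by have -> : j = k.+1 by apply/eqP; rewrite eqn_leq jk kj.
Qed.

(** The one-step extensions of the path to the listed successors already carry its whole mass. *)
Lemma law_succ k y : P [set w | (forall j, (j <= k)%N -> Y j w = y j) /\
  Y k.+1 w \notin succ (y k)] = 0.
Proof.
set N := [set w | _].
pose E s := [set w | forall j, (j <= k.+1)%N -> Y j w = extend y k s j].
have PU : P [set w | exists2 s, s \in succ (y k) & E s w] =
    ((y 0%N == x)%:R * path_weight y k)%:E.
  rewrite measure_seq_union //; last 2 first.
  - by move=> s; exact: mpath.
  - by move=> s s' w /pathS[_ <-] /pathS[_ <-].
  have PE s : P (E s) = ((y 0%N == x)%:R * path_weight y k *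
      jump_matrix q (y k) s)%:E.
    by rewrite law_path path_weight_extend mulrA.
  rewrite (eq_bigr _ (fun s _ => PE s)).
  by rewrite sumEFin -mulr_sumr jump_succ mulr1.
have mE : measurable [set w | exists2 s, s \in succ (y k) & E s w].
  by apply: measurable_seq_union => s; exact: mpath.
have mN : measurable N.
  rewrite (_ : N = [set w | forall j, (j <= k)%N -> Y j w = y j] `\`
     [set w | exists2 s, s \in succ (y k) & E s w]); first exact: measurableD.
  apply/seteqP; split=> w /=.
    move=> [h Yk]; split => // -[s sk] /pathS[_ e].
    by move: Yk; rewrite e sk.
  move=> [h nE]; split => //; apply/negP => Yk; apply: nE.
  by exists (Y k.+1 w) => //; apply/pathS.
have PUN : P ([set w | exists2 s, s \in succ (y k) & E s w] `|` N) =
    P [set w | exists2 s, s \in succ (y k) & E s w] + P N.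
  rewrite measureU //; apply/seteqP; split=> w //= -[[s sk /pathS[_ e]] [_]].
  by rewrite e sk.
have PNfin : P N \is a fin_num by exact: fin_num_measure.
have : P ([set w | exists2 s, s \in succ (y k) & E s w] `|` N) =
    ((y 0%N == x)%:R * path_weight y k)%:E.
  rewrite -law_path; congr (P _); apply/seteqP; split=> w /=.
    by case=> [[s _ /pathS[]]|[]].
  move=> h; have [ks|ks] := boolP (Y k.+1 w \in succ (y k)); last by right.
  by left; exists (Y k.+1 w) => //; apply/pathS.
rewrite PUN PU -(fineK PNfin) => -[h]; congr EFin; move: h; lra.
Qed.

(** The law is given on cylinders, so the Markov property takes the form of an induction that
    lengthens the prescribed prefix by one successor at a time, up to the null event of [law_succ].
    The exponential factor comes from the lower bound [a] on the exit rates. *)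
Lemma law_avoid_path z i k y (l : R) : (0 <= l)%R ->
  P [set w | [/\ forall j, (j <= k)%N -> Y j w = y j,
     forall j, (k < j <= k + i)%N -> Y j w <> z & l%:E < W (k + i) w]] <=
  ((y 0%N == x)%:R * path_weight y k * avoid z i (y k) * expR (- (a * l)))%:E.
Proof.
move=> l0; elim: i k y => [|i IH] k y.
  rewrite (_ : [set w | _] = [set w | (forall j, (j <= k)%N -> Y j w = y j) /\
     l%:E < W k w]); last first.
    apply/seteqP; split=> w /=; rewrite addn0; first by case.
    by move=> [h1 h2]; split => // j /andP[kj jk]; move: kj; rewrite ltnNge jk.
  rewrite law_path_holding // lee_fin /= mulr1 ler_wpM2l //.
    by rewrite mulr_ge0 // path_weight_ge0.
  by rewrite ler_expR lerN2 ler_wpM2r.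
pose F s := [set w | [/\ forall j, (j <= k.+1)%N -> Y j w = extend y k s j,
  forall j, (k.+1 < j <= k.+1 + i)%N -> Y j w <> z & l%:E < W (k.+1 + i) w]].
pose N := [set w | (forall j, (j <= k)%N -> Y j w = y j) /\
  Y k.+1 w \notin succ (y k)].
have mF s : measurable (F s).
  rewrite (_ : F s = [set w | forall j, (j <= k.+1)%N -> Y j w = extend y k s j] `&`
     ([set w | forall j, (k.+1 < j <= k.+1 + i)%N -> Y j w <> z] `&`
      [set w | l%:E < W (k.+1 + i) w])).
    apply: measurableI; first exact: mpath.
    apply: measurableI => //.
    exact: (measurable_forall_nat (fun j => (k.+1 < j <= k.+1 + i)%N)
              (fun j => mYneq j z)).
  by apply/seteqP; split=> w /= [h]; [move=> *|move=> [*]].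
have mN : measurable N.
  rewrite (_ : N = [set w | forall j, (j <= k)%N -> Y j w = y j] `&`
     ~` [set w | exists2 s, s \in succ (y k) & Y k.+1 w = s]).
    apply: measurableI; first exact: mpath.
    by apply: measurableC; exact: (measurable_seq_union (fun s => mY k.+1 s)).
  apply/seteqP; split=> w /= [h1 h2]; split => //.
    by move=> [s sk e]; move: h2; rewrite e sk.
  by apply/negP => ks; apply: h2; exists (Y k.+1 w).
pose U := [set w | exists2 s, s \in [seq s <- succ (y k) | s != z] & F s w].
have mU : measurable U by exact: (measurable_seq_union mF).
apply: (@le_trans _ _ (P (U `|` N))).
  apply: le_measure; rewrite ?inE //; last 2 first.
  - exact: measurableU.
  - move=> w [h1 h2 h3].
    have [ks|ks] := boolP (Y k.+1 w \in succ (y k)); last by right.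
    left; exists (Y k.+1 w).
      rewrite mem_filter ks andbT; apply/eqP; apply: h2.
      by rewrite ltnSn /= addnS ltnS leq_addr.
    split; first by apply/pathS.
      move=> j /andP[kj ji]; apply: h2; rewrite (ltn_trans _ kj) //=.
      by rewrite addnS -addSn.
    by rewrite addSn -addnS.
  rewrite (_ : mkset _ = [set w | forall j, (j <= k)%N -> Y j w = y j] `&`
     ([set w | forall j, (k < j <= k + i.+1)%N -> Y j w <> z] `&`
      [set w | l%:E < W (k + i.+1) w])).
    apply: measurableI; first exact: mpath.
    apply: measurableI => //.
    exact: (measurable_forall_nat (fun j => (k < j <= k + i.+1)%N)
              (fun j => mYneq j z)).
  by apply/seteqP; split=> w /= [h]; [move=> *|move=> [*]].
apply: le_trans (measureU2 _ _ _) _ => //.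
rewrite [X in _ + X](law_succ k y) adde0.
apply: le_trans (measure_seq_union_le P mF _) _.
apply: (@le_trans _ _ (\sum_(s <- [seq s <- succ (y k) | s != z])
   ((y 0%N == x)%:R * (path_weight y k * jump_matrix q (y k) s) *
     avoid z i s * expR (- (a * l)))%:E)).
  apply: lee_sum => s _; apply: le_trans (IH _ _) _.
  by rewrite path_weight_extend {1 2}/extend /= ltnn.
rewrite sumEFin lee_fin big_filter /= mulr_sumr mulr_suml le_eqVlt.
by apply/orP; left; apply/eqP; apply: eq_bigr => s _; ring.
Qed.

End law.
End jump_chain.

(** * Return times of the process *)

Section trajectories.
Local Open Scope ereal_scope.
Context {R : realType} {S : countType} {Omega : Type}
  (Y : nat -> Omega -> S) (W : nat -> Omega -> \bar R) (X : R -> Omega -> option S).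
Hypothesis W_gt0 : forall n w, 0 < W n w.
Hypothesis X_jump : forall (t : R) w n, (0 <= t)%R ->
  jump_time W n w <= t%:E -> t%:E < jump_time W n.+1 w -> X t w = Some (Y n w).
Hypothesis X_cemetery : forall (t : R) w, (0 <= t)%R ->
  (forall n, jump_time W n w <= t%:E) -> X t w = None.

Lemma jump_timeS n w : jump_time W n.+1 w = jump_time W n w + W n w.
Proof. by rewrite /jump_time big_ord_recr. Qed.

Lemma jump_time0 w : jump_time W 0 w = 0.
Proof. by rewrite /jump_time big_ord0. Qed.

Lemma jump_time_ge0 n w : 0 <= jump_time W n w.
Proof. by apply: sume_ge0 => i _; exact: ltW. Qed.

Lemma jump_time_mono m n w : (m <= n)%N -> jump_time W m w <= jump_time W n w.
Proof.
move=> /subnK <-; elim: (n - m)%N => [//|k IH].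
rewrite addSn jump_timeS; apply: le_trans IH _.
by rewrite leeDl // ltW.
Qed.

Lemma X_at_jump n w : jump_time W n w < +oo ->
  X (fine (jump_time W n w)) w = Some (Y n w).
Proof.
move=> fin; have Jfin : jump_time W n w \is a fin_num.
  by rewrite ge0_fin_numE // jump_time_ge0.
apply: X_jump; rewrite ?fineK //; first exact/fine_ge0/jump_time_ge0.
by rewrite jump_timeS lteDl.
Qed.

Lemma X_at0 w : X 0%R w = Some (Y 0%N w).
Proof. by have := @X_at_jump 0 w; rewrite jump_time0 => ->. Qed.

Lemma X_eqP t w y : (0 <= t)%R -> X t w = Some y <->
  exists n, [/\ Y n w = y, jump_time W n w <= t%:E & t%:E < jump_time W n.+1 w].
Proof.
move=> t0; split; last by move=> [n [<- h1 h2]]; exact: X_jump.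
have [h|] := pselect (exists n, t%:E < jump_time W n w); last first.
  move=> /forallNP h; rewrite X_cemetery // => n.
  by rewrite leNgt; apply/negP; exact: h.
have [n hn nmin] := ex_minnP h.
case: n hn nmin => [|n]; first by rewrite jump_time0 lte_fin ltNge t0.
move=> hn nmin; have nt : jump_time W n w <= t%:E.
  by rewrite leNgt; apply/negP => /nmin; rewrite ltnn.
by rewrite (X_jump t0 nt hn) => -[<-]; exists n.
Qed.

Lemma return_time_ge0 z w : 0 <= return_time X z w.
Proof. by apply: le_ereal_inf_tmp => _ [t [t0 _ _] <-]; rewrite lee_fin. Qed.

Lemma return_time_le n z w : (0 < n)%N -> Y 0%N w = z -> Y 1%N w <> z ->
  Y n w = z -> return_time X z w <= jump_time W n w.
Proof.
move=> n0 Y0 Y1 Yn; have [fin|] := ltP (jump_time W n w) +oo; last first.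
  by rewrite leye_eq => /eqP ->; rewrite leey.
have fin1 : jump_time W 1 w < +oo by exact: le_lt_trans (jump_time_mono w n0) fin.
have fin_fine m : jump_time W m w < +oo ->
    jump_time W m w = (fine (jump_time W m w))%:E.
  by move=> h; rewrite fineK // ge0_fin_numE // jump_time_ge0.
rewrite (fin_fine n) //; apply: ereal_inf_lbound; exists (fine (jump_time W n w)) => //.
split; first exact/fine_ge0/jump_time_ge0.
  rewrite -fin_fine //; apply: le_trans (jump_time_mono w n0).
  rewrite (fin_fine 1%N) //; apply: ereal_inf_lbound.
  exists (fine (jump_time W 1 w)) => //; split; first exact/fine_ge0/jump_time_ge0.
  by rewrite X_at_jump // X_at0 Y0 => -[].
by rewrite X_at_jump // Yn.
Qed.

(** Up to the first return of the jump chain, elapsed time is a sum of holding times, each at most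
    the number of integers below it. If the chain never returns, every [i] contributes at least its
    term [l = 0], because holding times are positive, and the series diverges. *)
Lemma return_time_le_series z w : Y 0%N w = z -> Y 1%N w <> z ->
  return_time X z w <= \sum_(0 <= i <oo) \sum_(0 <= l <oo)
    (if `[< (forall j, (0 < j <= i)%N -> Y j w <> z) /\ l%:R%:E < W i w >]
     then 1 else 0).
Proof.
move=> Y0 Y1.
pose u i l : \bar R :=
  if `[< (forall j, (0 < j <= i)%N -> Y j w <> z) /\ l%:R%:E < W i w >] then 1 else 0.
have u0 i : 0 <= \sum_(0 <= l <oo) u i l.
  by apply: nneseries_ge0 => l _ _; rewrite /u; case: ifP.
have uW i : (forall j, (0 < j <= i)%N -> Y j w <> z) ->
    W i w <= \sum_(0 <= l <oo) u i l.
  move=> hi; apply: le_trans (nneseries_ltn_ge _) _.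
  apply: lee_nneseries => [l _|l _]; first by case: ifP.
  have [lW|_] := boolP (l%:R%:E < W i w); last by rewrite /u; case: ifP.
  by rewrite /u asboolT.
have [h|/forallNP h] := pselect (exists n, (0 < n)%N && (Y n w == z)).
  have [n /andP[n0 /eqP Yn] nmin] := ex_minnP h.
  apply: le_trans (return_time_le n0 Y0 Y1 Yn) _.
  apply: (@le_trans _ _ (\sum_(0 <= i < n) \sum_(0 <= l <oo) u i l)).
    rewrite big_mkord; apply: lee_sum => i _; apply: uW.
    move=> j /andP[j0 ji] Yj; have := nmin j; rewrite j0 Yj eqxx => /(_ isT).
    by rewrite leqNgt (leq_ltn_trans ji).
  exact: nneseries_lim_ge.
rewrite [leRHS](_ : _ = +oo) ?leey //.
apply: nneseries_ge1_pinfty => i.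
have hi j : (0 < j <= i)%N -> Y j w <> z.
  by move=> /andP[j0 ji] Yj; apply: (h j); rewrite j0 Yj eqxx.
apply: (@le_trans _ _ (\sum_(0 <= l < 1) u i l)).
  by rewrite big_nat1 /u asboolT.
by apply: nneseries_lim_ge => l _ _; rewrite /u; case: ifP.
Qed.

End trajectories.

(** * From hitting inequalities of the jump chain to mean return times *)

Section process.
Local Open Scope ereal_scope.
Context {R : realType} {S : countType} (q : S -> S -> R) (succ : S -> seq S) (a : R).
Hypothesis a_gt0 : (0 < a)%R.
Hypothesis exit_ge : forall x, (a <= exit_rate q x)%R.
Hypothesis succ_uniq : forall x, uniq (succ x).
Hypothesis jump_ge0 : forall x y, (0 <= jump_matrix q x y)%R.
Hypothesis jump_succ : forall x, (\sum_(y <- succ x) jump_matrix q x y = 1)%R.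

Lemma nneseries_le (u : nat -> \bar R) (c : \bar R) :
  (forall i, 0 <= u i) -> (forall m, \sum_(0 <= i < m) u i <= c) ->
  \sum_(0 <= i <oo) u i <= c.
Proof.
move=> u0 uc; apply: lime_le; first by apply: is_cvg_nneseries.
exact: nearW.
Qed.

(** The sum is the mean number of jumps, truncated at [m], until [z] is entered after time 0. A
    nonnegative supersolution dominates it away from [z]; the first jump is split off because [x]
    may be [z], where [H] satisfies no inequality. *)
Lemma sum_avoid_le z (H : S -> R) m x : (forall y, 0 <= H y)%R ->
  (forall y, y != z -> 1 + \sum_(y' <- succ y) jump_matrix q y y' * H y' <= H y)%R ->
  (\sum_(i < m) avoid q succ z i x
    <= 1 + \sum_(y <- succ x) jump_matrix q x y * H y)%R.
Proof.
move=> H0 Hz.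
have stepm k y : (forall y', y' != z -> \sum_(i < k) avoid q succ z i y' <= H y')%R ->
    (\sum_(i < k.+1) avoid q succ z i y
      <= 1 + \sum_(y' <- succ y) jump_matrix q y y' * H y')%R.
  move=> IH; rewrite big_ord_recl /= lerD2l exchange_big /=.
  apply: (@le_trans _ _ (\sum_(y' <- succ y | y' != z) jump_matrix q y y' * H y')%R).
    apply: ler_sum => y' y'z; rewrite -mulr_sumr ler_wpM2l //; exact: IH.
  rewrite [leRHS](bigID (fun y' => y' != z)) /= lerDl.
  by apply: sumr_ge0 => y' _; rewrite mulr_ge0.
have IH k y : y != z -> (\sum_(i < k) avoid q succ z i y <= H y)%R.
  elim: k y => [|k IH] y yz; first by rewrite big_ord0.
  by apply: le_trans (Hz y yz); exact: stepm.
case: m => [|m]; last by apply: stepm => y; exact: IH.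
by rewrite big_ord0 addr_ge0 // sumr_ge0 // => y _; rewrite mulr_ge0.
Qed.

Lemma expR_geometric_le m :
  (\sum_(0 <= l < m) expR (- (a * l%:R)) <= (1 - expR (- a))^-1)%R.
Proof.
have e1 : (expR (- a) < 1)%R by rewrite expR_lt1 oppr_lt0.
have -> : (\sum_(0 <= l < m) expR (- (a * l%:R)) =
           \sum_(0 <= l < m) expR (- a) ^+ l)%R.
  by apply: eq_bigr => l _; rewrite -expRM_natl mulrN mulrC.
rewrite -[leRHS]mul1r ler_pdivlMr ?subr_gt0 // mulrBr mulr1 mulr_suml.
have -> : (\sum_(0 <= l < m) expR (- a) ^+ l * expR (- a) =
           \sum_(0 <= l < m) expR (- a) ^+ l.+1)%R.
  by apply: eq_bigr => l _; rewrite exprSr.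
rewrite -sumrB; under eq_bigr do rewrite -opprB.
by rewrite sumrN telescope_sumr // expr0 opprB lerBlDr lerDl exprn_ge0 // expR_ge0.
Qed.

Section mean_return.
Context (z : S) {d : measure_display} {Omega : measurableType d}
  (P : probability Omega R) (X : R -> Omega -> option S) (H : S -> R).
Hypothesis H_ge0 : forall y, (0 <= H y)%R.
Hypothesis H_drift : forall y, y != z ->
  (1 + \sum_(y' <- succ y) jump_matrix q y y' * H y' <= H y)%R.

Lemma mean_return_time_lty : markov_process_from q z P X ->
  \int[P]_w return_time X z w < +oo.
Proof.
move=> [Y [W [law X_jump X_cem]]].
have W_gt0 : forall n w, 0 < W n w by case: law.
have mY : forall n y, measurable [set w | Y n w = y] by case: law.
have mYneq n y : measurable [set w | Y n w <> y].
  by rewrite (_ : mkset _ = ~` [set w | Y n w = y]) //; exact: measurableC.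
have mWgt n (l : \bar R) : measurable [set w | l < W n w].
  case: law => _ mW _ _; rewrite -[X in measurable X]setTI.
  exact: emeasurable_fun_o_infty.
(* These trajectories form a null set: the chain starts at [z], and [jump_matrix q z z = 0] since
   the exit rate is positive. *)
pose N := [set w | Y 0%N w <> z] `|` ([set w | Y 0%N w = z] `&` [set w | Y 1%N w = z]).
have mN : measurable N by apply: measurableU => //; exact: measurableI.
have PN1 : P [set w | Y 0%N w <> z] = 0.
  rewrite (_ : mkset _ = ~` [set w | Y 0%N w = z]) // probability_setC //.
  rewrite [X in 1 - X](_ : _ = 1) ?subee //.
  have := law_path law 0 (fun=> z).
  rewrite eqxx /path_weight big_ord0 mulr1 => <-; congr (P _).
  apply/seteqP; split=> w /=; last by move=> /(_ 0%N); exact.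
  by move=> h j; rewrite leqn0 => /eqP ->.
have PN2 : P ([set w | Y 0%N w = z] `&` [set w | Y 1%N w = z]) = 0.
  have := law_path law 1 (fun=> z).
  rewrite /path_weight big_ord1 /jump_matrix eqxx gt_eqF; last first.
    exact: lt_le_trans (exit_ge z).
  rewrite !mulr0 => e; apply: etrans e; congr (P _).
  apply/seteqP; split=> w /=; last by move=> h; split; apply: h.
  by move=> [h0 h1] [|[|j]].
have PN : P N = 0 by apply: null_set_setU => //; exact: measurableI.
pose A i l := [set w | [/\ forall j, (j <= 0)%N -> Y j w = z,
   forall j, (0 < j <= 0 + i)%N -> Y j w <> z & l%:R%:E < W (0 + i)%N w]].
have mA i l : measurable (A i l).
  rewrite (_ : A i l = [set w | Y 0%N w = z] `&`
     ([set w | forall j, (0 < j <= i)%N -> Y j w <> z] `&` [set w | l%:R%:E < W i w])).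
    apply: measurableI => //; apply: measurableI => //.
    exact: (measurable_forall_nat (fun j => (0 < j <= i)%N) (fun j => mYneq j z)).
  apply/seteqP; split=> w /= [h1]; first by move=> h2 h3; split => //; exact: h1.
  by move=> [h2 h3]; split => // j; rewrite leqn0 => /eqP ->.
have PA i l : P (A i l `|` N) <= (avoid q succ z i z * expR (- (a * l%:R)))%:E.
  have := law_avoid_path exit_ge succ_uniq jump_ge0 jump_succ law z i 0 (fun=> z)
    (ler0n R l).
  by rewrite /= eqxx /path_weight big_ord0 !mul1r; rewrite measureU0.
pose M := ((1 - expR (- a))^-1)%R.
have M0 : (0 <= M)%R by rewrite invr_ge0 subr_ge0 -expR0 ler_expR oppr_le0 ltW.
pose C := (1 + \sum_(y <- succ z) jump_matrix q z y * H y)%R.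
apply: (@le_lt_trans _ _ (C * M)%:E); last exact: ltry.
(* Adding [N] to every [A i l] makes the dominating series infinite on [N]. The comparison then
   holds at every point, while the measures are unchanged. *)
apply: (@le_trans _ _ (\int[P]_w \sum_(0 <= i <oo) \sum_(0 <= l <oo)
   (\1_(A i l `|` N) w)%:E)).
  apply: ge0_le_integralT => w; first exact: return_time_ge0.
  have [Nw|Nw] := pselect (N w).
    rewrite (nneseries_ge1_pinfty (u := fun i => _)) ?leey // => i.
    rewrite (nneseries_ge1_pinfty (u := fun l => _)) ?leey // => l.
    by rewrite indicE mem_set //; right.
  have [Y0 Y1] : Y 0%N w = z /\ Y 1%N w <> z.
    have Y0 : Y 0%N w = z by apply: contrapT => ?; apply: Nw; left.
    by split => // Y1; apply: Nw; right.
  apply: le_trans (return_time_le_series W_gt0 X_jump Y0 Y1) _.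
  apply: lee_nneseries => [i _ _|i _]; first by apply: nneseries_ge0 => l _ _; case: ifP.
  apply: lee_nneseries => [l _|l _]; first by case: ifP.
  case: asboolP => [[h1 h2]|_]; last by rewrite lee_fin.
  rewrite indicE mem_set //; left; split => // j.
  by rewrite leqn0 => /eqP ->.
rewrite integral_nneseries //; last 2 first.
- move=> i; apply: ge0_emeasurable_sum => // l _.
  apply/measurable_EFinP/measurable_indic; exact: measurableU.
- by move=> i w _; apply: nneseries_ge0 => l _ _; rewrite lee_fin.
apply: (@le_trans _ _ (\sum_(0 <= i <oo) (avoid q succ z i z * M)%:E)).
  apply: lee_nneseries => [i _ _|i _].
    by apply: integral_ge0 => w _; apply: nneseries_ge0 => l _ _; rewrite lee_fin.
  rewrite integral_nneseries //; last first.
    move=> l; apply/measurable_EFinP/measurable_indic; exact: measurableU.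
  apply: nneseries_le => [l|m].
    by apply: integral_ge0 => w _; rewrite lee_fin.
  apply: (@le_trans _ _ (\sum_(0 <= l < m)
      (avoid q succ z i z * expR (- (a * l%:R)))%:E)).
    apply: lee_sum => l _; rewrite integral_indic //; last exact: measurableU.
    by rewrite setIT; exact: PA.
  rewrite sumEFin lee_fin -mulr_sumr ler_wpM2l ?expR_geometric_le //.
  exact: avoid_ge0.
apply: nneseries_le => [i|m].
  by rewrite lee_fin mulr_ge0 // avoid_ge0.
rewrite sumEFin lee_fin -mulr_suml ler_wpM2r // big_mkord.
exact: sum_avoid_le.
Qed.

End mean_return.
End process.

(** * Reaching a state at a fixed time with positive probability *)

Section irreducibility.
Local Open Scope ereal_scope.
Context {R : realType} {S : countType} (q : S -> S -> R) (a : R).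
Hypothesis a_gt0 : (0 < a)%R.
Hypothesis exit_ge : forall x, (a <= exit_rate q x)%R.
Context {d : measure_display} {Omega : measurableType d}.

(** If all these probabilities vanished, the process would almost surely avoid [p n] at every
    positive integer time. But with positive probability the chain follows [p] and then rests in
    [p n] for more than one unit of time, which covers a positive integer as soon as the earlier
    holding times are finite. *)
Lemma law_reach (P : probability Omega R) (X : R -> Omega -> option S)
    (n : nat) (p : nat -> S) :
  (0 < path_weight q p n)%R -> markov_process_from q (p 0%N) P X ->
  exists2 t : R, (0 <= t)%R & 0 < P [set w | X t w = Some (p n)].
Proof.
move=> p_gt0 [Y [W [law X_jump X_cem]]].
have W_gt0 : forall n w, 0 < W n w by case: law.
have mY : forall n y, measurable [set w | Y n w = y] by case: law.
have mW k (l : \bar R) : measurable [set w | l < W k w].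
  case: law => _ mW _ _; rewrite -[X in measurable X]setTI.
  exact: emeasurable_fun_o_infty.
have mJ k : measurable_fun setT (jump_time W k).
  by case: law => _ mW' _ _; apply: emeasurable_sum => i; exact: mW'.
have mpath k : measurable [set w | forall j, (j <= k)%N -> Y j w = p j].
  exact: (measurable_forall_nat (fun j => (j <= k)%N) (fun j => mY j (p j))).
have mX (t : R) : (0 <= t)%R -> measurable [set w | X t w = Some (p n)].
  move=> t0; rewrite (_ : mkset _ = \bigcup_k ([set w | Y k w = p n] `&`
      ([set w | jump_time W k w <= t%:E] `&` [set w | t%:E < jump_time W k.+1 w]))).
    apply: bigcupT_measurable => k; apply: measurableI => //; apply: measurableI.
      rewrite -[X in measurable X]setTI; exact: emeasurable_fun_infty_c.
    rewrite -[X in measurable X]setTI; exact: emeasurable_fun_o_infty.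
  apply/seteqP; split=> w /=.
    by move=> /(X_eqP X_jump X_cem w (p n) t0)[k [h1 h2 h3]]; exists k.
  move=> [k _ [h1 [h2 h3]]]; apply/(X_eqP X_jump X_cem w (p n) t0).
  by exists k.
apply: contrapT => no_t.
have X0 (t : R) : (0 <= t)%R -> P [set w | X t w = Some (p n)] = 0.
  move=> t0; apply/eqP; rewrite eq_le measure_ge0 andbT leNgt; apply/negP => ?.
  by apply: no_t; exists t.
(* Along the path the tail of [W k] at [l] is at most [expR (- (a * l))] times the path weight. With
   [expR y >= 1 + y] the Archimedean property concludes. *)
have infty k : P.-negligible ([set w | forall j, (j <= k)%N -> Y j w = p j] `&`
    [set w | W k w = +oo]).
  have mB : measurable ([set w | forall j, (j <= k)%N -> Y j w = p j] `&`
    [set w | W k w = +oo]).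
    apply: measurableI => //; case: law => _ mW' _ _.
    rewrite -[X in measurable X]setTI.
    exact: (mW' k measurableT [set +oo] (emeasurable_set1 +oo)).
  apply/negligibleP => //; set B := _ `&` _.
  have PBfin : P B \is a fin_num by exact: fin_num_measure.
  have PB0 : (0 <= fine (P B))%R by exact: fine_ge0.
  have PBle (l : nat) : (fine (P B) * (1 + a * l%:R) <= path_weight q p k)%R.
    have pw0 : (0 <= path_weight q p k)%R.
      have := law_path law k p; rewrite eqxx mul1r => e.
      by rewrite -lee_fin -e.
    have : P B <= (path_weight q p k * expR (- (a * l%:R)))%:E.
      have e := law_path_holding law k p (ler0n R l).
      rewrite eqxx mul1r in e.
      apply: (@le_trans _ _ (path_weight q p k *
          expR (- (exit_rate q (p k) * l%:R)))%:E).
        rewrite -e; apply: le_measure; rewrite ?inE //.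
          exact: (measurableI _ _ (mpath k) (mW k _)).
        by move=> w [h1 h2]; split => //; rewrite h2 ltry.
      by rewrite lee_fin ler_wpM2l // ler_expR lerN2 ler_wpM2r.
    move=> h; have : (fine (P B) <= path_weight q p k * expR (- (a * l%:R)))%R.
      by rewrite -lee_fin fineK.
    rewrite expRN ler_pdivlMr ?expR_gt0 //; apply: le_trans.
    by rewrite ler_wpM2l // expR_ge1Dx // mulr_ge0 // ltW.
  suff fPB : fine (P B) = 0%R by apply: etrans (esym (fineK PBfin)) _; rewrite fPB.
  apply/eqP; rewrite eq_le PB0 andbT leNgt; apply/negP => PBpos.
  pose y := (path_weight q p k / (fine (P B) * a))%R.
  have := PBle (Num.bound y); rewrite leNgt => /negP; apply.
  have yb : (y < (Num.bound y)%:R)%R by exact: unstable.ltr_bound.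
  have Pa : (0 < fine (P B) * a)%R by rewrite mulr_gt0.
  move: yb; rewrite ltr_pdivrMr // => yb.
  apply: (lt_le_trans yb); rewrite mulrDr mulr1 [leLHS]mulrC -mulrA.
  by rewrite lerDr.
pose E := [set w | (forall j, (j <= n)%N -> Y j w = p j) /\ 1%:E < W n w].
have PE : 0 < P E.
  have := law_path_holding law n p (@ler01 R); rewrite eqxx mul1r => ->.
  by rewrite lte_fin mulr_gt0 // expR_gt0.
have mE : measurable E by exact: (measurableI _ _ (mpath n) (mW n _)).
suff : P.-negligible E by move=> /negligibleP => /(_ mE) e; rewrite e ltxx in PE.
apply: (negligibleS (A := (\bigcup_k [set w | X k.+1%:R w = Some (p n)]) `|`
   (\bigcup_k ([set w | forall j, (j <= k)%N -> Y j w = p j] `&`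
    [set w | W k w = +oo])))); last first.
  apply: negligibleU; last exact: negligible_bigcup.
  apply: negligible_bigcup => k; apply/negligibleP; [exact: mX|exact: X0].
move=> w [Yp Wn].
have [[k [kn Wk]]|noinf] := pselect (exists k, (k < n)%N /\ W k w = +oo).
  right; exists k => //; split => // j jk; apply: Yp.
  by rewrite (leq_trans jk) // ltnW.
have Jfin : jump_time W n w < +oo.
  apply: lte_sum_pinfty => i _; rewrite ltey; apply/eqP => Wi.
  by apply: noinf; exists i.
have Jfin' : jump_time W n w \is a fin_num.
  by rewrite ge0_fin_numE // jump_time_ge0.
have J0 : (0 <= fine (jump_time W n w))%R by apply/fine_ge0/jump_time_ge0.
(* The first integer after the arrival time in [p n] exceeds it by at most one, hence falls before
   the next jump. *)
left; exists (Num.truncn (fine (jump_time W n w))) => //=.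
rewrite -(Yp n) //; apply: X_jump => //.
  by rewrite -(fineK Jfin') lee_fin ltW // truncnS_gt.
rewrite jump_timeS -(fineK Jfin').
apply: (@le_lt_trans _ _ ((fine (jump_time W n w))%:E + 1%:E)).
  by rewrite -EFinD lee_fin -natr1 lerD2r truncn_le.
by rewrite lteD2lE.
Qed.

End irreducibility.

(** * Foster's criterion with state-dependent times *)

Section controlled_chain.
Context {R : realType} {S : eqType} {A : finType}.
Variables (w : S -> A -> R) (mv : S -> A -> S).

Definition step_op (f : S -> R) (x : S) : R := \sum_a w x a * f (mv x a).

Definition run (x : S) (s : seq A) : S := foldl mv x s.

(** Expectation of a functional of the first [m] moves, as a nested finite sum. Sequences of moves
    determine the states, and they also carry costs that depend on the move. *)
Fixpoint path_exp (m : nat) (x : S) (Phi : seq A -> R) : R :=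
  if m is m'.+1
  then \sum_a w x a * path_exp m' (mv x a) (fun s => Phi (a :: s))
  else Phi [::].

Fixpoint path_cost (c : S -> A -> R) (x : S) (s : seq A) : R :=
  if s is a :: s' then c x a + path_cost c (mv x a) s' else 0.

(** Mean of the hitting time of [z] truncated at [m]; the truncation keeps it finite before anything
    is known about recurrence. *)
Fixpoint hit_time (z : S) (m : nat) (x : S) : R :=
  if m is m'.+1
  then if x == z then 0 else 1 + step_op (hit_time z m') x
  else 0.

Lemma path_cost_diff (f : S -> R) x s :
  path_cost (fun y a => f (mv y a) - f y) x s = f (run x s) - f x.
Proof.
elim: s x => [|a s IH] x /=; first by rewrite subrr.
by rewrite IH addrC subrKA.
Qed.

Lemma path_cost_le (c c' : S -> A -> R) x s :
  (forall y a, c y a <= c' y a) -> path_cost c x s <= path_cost c' x s.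
Proof. by move=> cc'; elim: s x => //= a s IH x; exact: lerD. Qed.

Lemma path_cost_lin (c c' : S -> A -> R) k k' x s :
  path_cost (fun y a => k * c y a + k' * c' y a) x s =
  k * path_cost c x s + k' * path_cost c' x s.
Proof.
elim: s x => [|a s IH] x /=; first by rewrite !mulr0 addr0.
by rewrite IH; ring.
Qed.

Lemma path_cost_state (g : S -> R) x s :
  path_cost (fun y _ => g y) x s = \sum_(j < size s) g (run x (take j s)).
Proof.
elim: s x => [|a s IH] x /=; first by rewrite big_ord0.
by rewrite big_ord_recl IH.
Qed.

Hypothesis w0 : forall x a, 0 <= w x a.
Hypothesis w1 : forall x, \sum_a w x a = 1.

Lemma path_exp_le m x (Phi Psi : seq A -> R) :
  (forall s, size s = m -> Phi s <= Psi s) -> path_exp m x Phi <= path_exp m x Psi.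
Proof.
elim: m x Phi Psi => [|m IH] x Phi Psi le_PhiPsi /=; first exact: le_PhiPsi.
apply: ler_sum => a _; apply: ler_wpM2l => //; apply: IH => s sm.
by apply: le_PhiPsi => /=; rewrite sm.
Qed.

Lemma path_exp_cst m x c : path_exp m x (fun=> c) = c.
Proof.
elim: m x => [//|m IH] x /=.
by under eq_bigr do rewrite IH; rewrite -mulr_suml w1 mul1r.
Qed.

Lemma path_expD m x (Phi Psi : seq A -> R) :
  path_exp m x (fun s => Phi s + Psi s) = path_exp m x Phi + path_exp m x Psi.
Proof.
elim: m x Phi Psi => [//|m IH] x Phi Psi /=; rewrite -big_split /=.
by apply: eq_bigr => a _; rewrite IH mulrDr.
Qed.

Lemma path_expZ m x c (Phi : seq A -> R) :
  path_exp m x (fun s => c * Phi s) = c * path_exp m x Phi.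
Proof.
elim: m x Phi => [//|m IH] x Phi /=; rewrite mulr_sumr.
by apply: eq_bigr => a _; rewrite IH mulrCA.
Qed.

Lemma path_exp_sum (I : finType) m x (Phi : I -> seq A -> R) :
  path_exp m x (fun s => \sum_i Phi i s) = \sum_i path_exp m x (Phi i).
Proof.
elim: m x Phi => [//|m IH] x Phi /=; rewrite exchange_big /=.
by apply: eq_bigr => a _; rewrite IH mulr_sumr.
Qed.

Lemma path_exp_run m x (f : S -> R) :
  path_exp m x (fun s => f (run x s)) = iter m step_op f x.
Proof.
elim: m x => [//|m IH] x /=.
by rewrite /step_op; apply: eq_bigr => a _; rewrite -IH.
Qed.

Lemma iter_step_le m x (f g : S -> R) :
  (forall s, size s = m -> f (run x s) <= g (run x s)) ->
  iter m step_op f x <= iter m step_op g x.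
Proof. by move=> fg; rewrite -!path_exp_run; exact: path_exp_le. Qed.

Lemma iter_stepD m x (f g : S -> R) :
  iter m step_op (fun y => f y + g y) x = iter m step_op f x + iter m step_op g x.
Proof. by rewrite -!path_exp_run -path_expD. Qed.

Lemma iter_stepZ m x c (f : S -> R) :
  iter m step_op (fun y => c * f y) x = c * iter m step_op f x.
Proof. by rewrite -!path_exp_run -path_expZ. Qed.

Lemma iter_step_cst m x c : iter m step_op (fun=> c) x = c.
Proof. by rewrite -path_exp_run path_exp_cst. Qed.

Lemma iter_step_sum (I : finType) m x (f : I -> S -> R) :
  iter m step_op (fun y => \sum_i f i y) x = \sum_i iter m step_op (f i) x.
Proof.
by rewrite -path_exp_run path_exp_sum; under eq_bigr do rewrite path_exp_run.
Qed.

Lemma path_exp_cost_le m x (c : S -> A -> R) k :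
  (forall y, \sum_a w y a * c y a <= k) ->
  path_exp m x (path_cost c x) <= m%:R * k.
Proof.
move=> ck; elim: m x => [|m IH] x /=; first by rewrite mul0r.
under eq_bigr => a _ do rewrite path_expD path_exp_cst mulrDr.
rewrite big_split /= -natr1 mulrDl mul1r addrC lerD //.
apply: le_trans (_ : \sum_a w x a * (m%:R * k) <= _).
  by apply: ler_sum => a _; apply: ler_wpM2l.
by rewrite -mulr_suml w1 mul1r.
Qed.

(* Martingale increments are orthogonal, so the second moment grows linearly. *)
Lemma path_exp_cost_sqr_le m x (c : S -> A -> R) D :
  (forall y, \sum_a w y a * c y a = 0) -> (forall y a, c y a ^+ 2 <= D) ->
  path_exp m x (fun s => path_cost c x s ^+ 2) <= m%:R * D.
Proof.
move=> c0 cD.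
suff gen b : path_exp m x (fun s => (b + path_cost c x s) ^+ 2) <= b ^+ 2 + m%:R * D.
  have := gen 0; rewrite expr0n /= add0r; apply: le_trans.
  by apply: path_exp_le => s _; rewrite add0r.
elim: m x b => [|m IH] x b /=; first by rewrite addr0 mul0r addr0.
apply: (@le_trans _ _ (\sum_a w x a * ((b + c x a) ^+ 2 + m%:R * D))).
  apply: ler_sum => a _; apply: ler_wpM2l => //.
  apply: le_trans (IH _ (b + c x a)).
  by apply: path_exp_le => s _; rewrite addrA.
have -> : \sum_a w x a * ((b + c x a) ^+ 2 + m%:R * D) =
   b ^+ 2 + m%:R * D + \sum_a w x a * c x a ^+ 2.
  under eq_bigr => a _.
    rewrite (_ : _ * _ = w x a * (b ^+ 2 + m%:R * D) + (w x a * c x a) * (b *+ 2) +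
                    w x a * c x a ^+ 2); last by ring.
    over.
  by rewrite !big_split /= -!mulr_suml w1 c0 mul0r addr0 mul1r.
rewrite -natr1 mulrDl mul1r addrA lerD2l.
apply: (@le_trans _ _ (\sum_a w x a * D)).
  by apply: ler_sum => a _; apply: ler_wpM2l.
by rewrite -mulr_suml w1 mul1r.
Qed.

Lemma step_op_le f g x : (forall y, f y <= g y) -> step_op f x <= step_op g x.
Proof. by move=> fg; apply: ler_sum => a _; apply: ler_wpM2l. Qed.

Lemma hit_time_ge0 z m x : 0 <= hit_time z m x.
Proof.
elim: m x => [//|m IH] x /=; case: ifP => // _.
by rewrite addr_ge0 // /step_op sumr_ge0 // => a _; rewrite mulr_ge0.
Qed.

Lemma hit_timeS z m x : hit_time z m x <= hit_time z m.+1 x.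
Proof.
elim: m x => [|m IH] x; first exact: (hit_time_ge0 _ 1).
rewrite /=; case: ifP => // _; rewrite lerD2l; exact: step_op_le.
Qed.

Lemma hit_time_mono z m1 m2 x : (m1 <= m2)%N -> hit_time z m1 x <= hit_time z m2 x.
Proof.
move=> /subnK <-; elim: (m2 - m1)%N => [//|k IH].
exact: le_trans IH (hit_timeS _ _ _).
Qed.

Lemma hit_time_le z m x : hit_time z m x <= m%:R.
Proof.
elim: m x => [//|m IH] x /=; case: ifP => // _.
rewrite -natr1 addrC lerD2r; apply: le_trans (step_op_le _ IH) _.
by rewrite /step_op -mulr_suml w1 mul1r.
Qed.

Lemma hit_time_iter z l m x :
  hit_time z (l + m) x <= l%:R + iter l step_op (hit_time z m) x.
Proof.
elim: l x => [|l IH] x /=; first by rewrite add0r.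
case: ifP => _.
  rewrite addr_ge0 // -iterS -path_exp_run -(path_exp_cst l.+1 x 0).
  by apply: path_exp_le => s _; exact: hit_time_ge0.
rewrite -natr1 -addrA addrC -addrA lerD2l addrC.
apply: le_trans (step_op_le _ IH) _.
rewrite /step_op; under eq_bigr do rewrite mulrDr.
by rewrite big_split /= -mulr_suml w1 mul1r.
Qed.

Section foster.
Variables (V : S -> R) (F : seq S) (z : S).
Hypothesis V0 : forall x, 0 <= V x.
Hypothesis drift : forall x, x \notin F -> exists2 t, (0 < t)%N &
  iter t step_op V x <= V x - t%:R.
Hypothesis reach : forall x, exists l, 0 < iter l step_op (fun y => (y == z)%:R) x.

Lemma hit_time_le_lyapunov B m x :
  (forall f, f \in F -> hit_time z m f <= B) -> 0 <= B ->
  hit_time z m x <= V x + B.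
Proof.
move=> hB B0; have [n mn] := ubnP m.
suff: forall m', (m' <= m)%N -> (m' < n)%N -> hit_time z m' x <= V x + B by exact.
elim: n x {mn} => [//|n IH] x m' m'm m'n.
have [xF|/drift[t t0 ht]] := boolP (x \in F).
  apply: le_trans (_ : B <= _); last by rewrite lerDr.
  exact: le_trans (hit_time_mono _ _ m'm) (hB _ xF).
have KV0 : 0 <= iter t step_op V x.
  rewrite -path_exp_run -(path_exp_cst t x 0).
  by apply: path_exp_le => s _; exact: V0.
have tV : t%:R <= V x by lra.
have [tm|mt] := leqP t m'; last first.
  apply: le_trans (hit_time_le _ _ _) _.
  by apply: le_trans (ler_wpDr B0 tV); rewrite ler_nat ltnW.
rewrite -(subnKC tm); apply: le_trans (hit_time_iter _ _ _ _) _.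
have : iter t step_op (hit_time z (m' - t)) x <= iter t step_op V x + B.
  rewrite -(iter_step_cst t x B) -iter_stepD; apply: iter_step_le => s _.
  apply: IH; first by rewrite (leq_trans (leq_subr _ _)).
  by rewrite ltn_subLR // (leq_trans m'n) // -{1}[n]add0n ltn_add2r.
lra.
Qed.

(** From a point of [F] the chain is at [z] at some time [l] with probability at least [b], so a
    bound [B] valid on [F] improves to [c + (1 - b) * B]. For the maximum over [F], finite by
    truncation, this yields the bound [c / b], independent of [m]. *)
Lemma hit_time_bounded : exists B, forall m x, hit_time z m x <= V x + B.
Proof.
have [b [c [b0 [b1 [c0 bc]]]]] : exists b c, 0 < b /\ b <= 1 /\ 0 <= c /\
  forall f, f \in F -> forall m B, 0 <= B ->
    (forall f, f \in F -> hit_time z m f <= B) ->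
    hit_time z m f <= c + (1 - b) * B.
  have key (f : S) : exists b c, 0 < b /\ b <= 1 /\ 0 <= c /\
     forall m B, 0 <= B -> (forall f, f \in F -> hit_time z m f <= B) ->
     hit_time z m f <= c + (1 - b) * B.
    have [l l0] := reach f.
    exists (iter l step_op (fun y => (y == z)%:R) f).
    exists (l%:R + iter l step_op V f); split => //; split.
      rewrite -[leRHS](iter_step_cst l f); apply: iter_step_le => s _.
      by case: (_ == _).
    split.
      rewrite addr_ge0 // -(iter_step_cst l f 0).
      by apply: iter_step_le => s _; exact: V0.
    move=> m B B0 hB.
    apply: le_trans (hit_time_mono _ _ (leq_addl l m)) _.
    apply: le_trans (hit_time_iter _ _ _ _) _.
    rewrite -addrA lerD2l.
    rewrite (_ : (1 - _) * B = B + (- B) * iter l step_op (fun y => (y == z)%:R) f);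
      last by ring.
    rewrite -(iter_step_cst l f B) -iter_stepZ -!iter_stepD iter_step_cst.
    apply: iter_step_le => s _.
    have [->|ne] := eqVneq (run f s) z.
      have -> : hit_time z m z = 0 by case: m {hB} => //= m; rewrite eqxx.
      by rewrite mulr1 subrr addr0.
    rewrite mulr0 addr0; exact: hit_time_le_lyapunov.
  have all_in (F' : seq S) : exists b c, 0 < b /\ b <= 1 /\ 0 <= c /\
    forall f, f \in F' -> forall m B, 0 <= B ->
    (forall f', f' \in F -> hit_time z m f' <= B) ->
    hit_time z m f <= c + (1 - b) * B.
    elim: F' => [|f F' [b [c [b0 [b1 [c0 bc]]]]]].
      by exists 1, 0; do !split => //.
    have [b' [c' [b'0 [b'1 [c'0 bc']]]]] := key f.
    exists (Num.min b b'), (Num.max c c').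
    split; first by rewrite lt_min b0.
    split; first by rewrite ge_min b1.
    split; first by rewrite le_max c0.
    move=> g; rewrite inE => /orP[/eqP->|gF] m B B0 hB.
      apply: le_trans (bc' m B B0 hB) _; apply: lerD; first by rewrite le_max lexx orbT.
      by rewrite ler_wpM2r // lerD2l lerN2 ge_min lexx orbT.
    apply: le_trans (bc g gF m B B0 hB) _; apply: lerD; first by rewrite le_max lexx.
    by rewrite ler_wpM2r // lerD2l lerN2 ge_min lexx.
  exact: all_in.
exists (c / b) => m x; apply: hit_time_le_lyapunov; last first.
  by rewrite divr_ge0 // ltW.
pose B := \big[Order.max/0]_(f <- F) hit_time z m f.
have B0 : 0 <= B by exact: bigmax_ge_id.
have hB f : f \in F -> hit_time z m f <= B by move=> fF; exact: le_bigmax_seq.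
have : B <= c + (1 - b) * B.
  rewrite {1}/B big_seq; apply: bigmax_le => [|f fF]; last exact: bc.
  by rewrite addr_ge0 // mulr_ge0 // subr_ge0.
move=> BB f fF; apply: le_trans (hB _ fF) _.
rewrite ler_pdivlMr //; lra.
Qed.

(* The expected hitting time of [z], as the limit of its truncations. *)
Lemma foster_lyapunov : exists H : S -> R, (forall x, 0 <= H x) /\
  forall x, x != z -> 1 + step_op H x <= H x.
Proof.
have [B hB] := hit_time_bounded.
have cvgh x : hit_time z ^~ x @ \oo --> sup (range (hit_time z ^~ x)).
  apply: nondecreasing_cvgn.
    by move=> m1 m2 m12; exact: hit_time_mono.
  by exists (V x + B) => _ [m _ <-].
have hH m x : hit_time z m x <= sup (range (hit_time z ^~ x)).
  apply: ub_le_sup; last by exists m.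
  by exists (V x + B) => _ [k _ <-].
exists (fun x => sup (range (hit_time z ^~ x))); split.
  by move=> x; apply: le_trans (hH 0%N x).
move=> x xz.
have cvgK : (fun m => 1 + step_op (hit_time z m) x) @ \oo -->
    1 + step_op (fun x => sup (range (hit_time z ^~ x))) x.
  apply: cvgD; first exact: cvg_cst.
  apply: cvg_big => [|a _]; first exact: add_continuous.
  by apply: cvgM; [exact: cvg_cst | exact: cvgh].
rewrite -(cvg_lim _ cvgK) //; apply: limr_le; first exact: cvgP cvgK.
apply: nearW => m; apply: le_trans (hH m.+1 x).
by rewrite /= (negbTE xz).
Qed.
End foster.
End controlled_chain.

(** * Proportionally fair allocations *)

Lemma ln_le_sub1 {R : realType} (t : R) : 0 < t -> ln t <= t - 1.
Proof.
move=> t0; have := @le_ln1Dx R (t - 1); rewrite [1 + _]addrC subrK; apply; lra.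
Qed.

Lemma ln_ge_sub1 {R : realType} (t : R) : 0 < t -> 1 - t^-1 <= ln t.
Proof.
move=> t0; have tV0 : 0 < t^-1 by rewrite invr_gt0.
have := ln_le_sub1 tV0; rewrite lnV ?posrE //; lra.
Qed.

Lemma ln_div2 {R : realType} (a b : R) : 0 < a -> 0 < b -> ln (a / b) = ln a - ln b.
Proof. by move=> a0 b0; rewrite ln_div ?posrE. Qed.

Section proportional_fairness.
Context {R : realType} {n : nat} (C : set 'rV[R]_n) (lamPF : 'rV[R]_n -> 'rV[R]_n)
  (rho : 'I_n -> R).
Hypothesis C_capacity : capacity_set C.
Hypothesis PF : forall x : 'rV[R]_n, (forall r, 0 <= x ord0 r) ->
  is_pf_allocation C x (lamPF x).
Hypothesis rho_int : interior C (\row_r rho r).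

Lemma capacity_ge0 l r : C l -> 0 <= l ord0 r.
Proof. by case: C_capacity => + _ _ _ _ => /[apply]. Qed.

Lemma capacity_convex (l l' : 'rV[R]_n) (t : R) : 0 <= t <= 1 -> C l -> C l' ->
  C ((1 - t) *: l + t *: l').
Proof.
move=> /andP[t0 t1] Cl Cl'; case: C_capacity => _ _ convC _ _.
have t0' : 0 <= 1 - t by lra.
have t1' : 1 - t <= 1 by lra.
have := convC l l' (Itv01 t0' t1'); rewrite !inE => /(_ Cl Cl').
rewrite /conv /= /unstable.onem.
by rewrite opprB addrCA subrr addr0.
Qed.

Lemma capacity_bounded : exists B, forall l r, C l -> l ord0 r <= B.
Proof.
case: C_capacity => _ Ccompact _ _ _.
have coordB r : exists B, forall l, C l -> l ord0 r <= B.
  have : compact ((fun l : 'rV[R]_n => l ord0 r) @` C).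
    apply: continuous_compact => //; apply: continuous_subspaceT => l.
    exact: coord_continuous.
  move=> /compact_bounded[M [_ hM]]; exists (M + 1) => l Cl.
  apply: le_trans (ler_norm _) _; apply: hM; first by rewrite ltrDl.
  by exists l.
have [B hB] := choice coordB.
exists (\sum_r `|B r|) => l r Cl; apply: le_trans (hB r l Cl) _.
apply: le_trans (ler_norm _) _.
by rewrite (bigD1 r) //= lerDl sumr_ge0.
Qed.

Lemma capacity_interior (e : 'I_n -> R) : exists2 t, 0 < t &
  C (\row_r (rho r + t * e r)).
Proof.
have /nbhs_ballP[eps /= eps0 heps] := rho_int.
pose E := 1 + \sum_r `|e r|.
have E0 : 0 < E by rewrite /E ltr_wpDr // sumr_ge0.
exists (eps / 2 / E); first by rewrite !divr_gt0.
apply: heps; split=> // i j; rewrite /ball /= !mxE opprD addrA subrr sub0r normrN normrM.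
rewrite (gtr0_norm (_ : 0 < eps / 2 / E)) ?divr_gt0 //.
have eE : `|e j| <= E.
  by rewrite /E (bigD1 j) //= addrCA lerDl addr_ge0 // sumr_ge0.
have e20 : 0 < eps / 2 by rewrite divr_gt0.
rewrite mulrAC ltr_pdivrMr //; apply: (@le_lt_trans _ _ (eps / 2 * E)).
  by rewrite ler_pM2l.
by rewrite ltr_pM2r //; lra.
Qed.

(** An interior point can be lowered a little inside [C], whose vectors are nonnegative. Through the
    traffic equations, this is what makes every type reachable from the outside. *)
Lemma rho_gt0 r : 0 < rho r.
Proof.
have [t t0] := capacity_interior (fun=> -1).
by move=> /capacity_ge0 => /(_ r); rewrite mxE; lra.
Qed.

Lemma capacity_slack : exists2 k, 0 < k & C (\row_r ((1 + k) * rho r)).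
Proof.
have [t t0 Ct] := capacity_interior rho; exists t => //.
by rewrite (_ : \row_r _ = \row_r (rho r + t * rho r)) //; apply/rowP => r;
  rewrite !mxE; ring.
Qed.

Lemma capacity_rho : C (\row_r rho r).
Proof. exact: interior_subset rho_int. Qed.

Implicit Types x l : 'rV[R]_n.

Lemma lamPF_C x : (forall r, 0 <= x ord0 r) -> C (lamPF x).
Proof. by move=> /PF[]. Qed.

Lemma pf_objectiveE x l : (forall r, 0 <= x ord0 r) ->
  (forall r, 0 < x ord0 r -> 0 < l ord0 r) ->
  pf_objective x l = (\sum_r x ord0 r * ln (l ord0 r))%:E.
Proof.
move=> x0 xl; rewrite /pf_objective -sumEFin; apply: eq_bigr => r _.
have := x0 r; rewrite le_eqVlt => /orP[/eqP <-|xr0]; first by rewrite mul0e mul0r.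
by rewrite lne_EFin // xl.
Qed.

Lemma lamPF_gt0 x r : (forall r, 0 <= x ord0 r) -> 0 < x ord0 r ->
  0 < lamPF x ord0 r.
Proof.
move=> x0 xr; have [Cl /(_ (\row_r rho r) capacity_rho) + _] := PF x0.
rewrite pf_objectiveE //; last by move=> s _; rewrite mxE rho_gt0.
have := capacity_ge0 r Cl; rewrite le_eqVlt => /orP[/eqP l0|//].
have -> : pf_objective x (lamPF x) = -oo%E.
  apply/esum_eqNyP; exists r; split=> //.
  by rewrite -l0 le0_lneNy // gt0_muleNy ?lte_fin.
by rewrite leeNy_eq.
Qed.

(* First-order optimality along the segment from the allocation to [l]. *)
Lemma lamPF_variational x l : (forall r, 0 <= x ord0 r) -> C l ->
  \sum_r x ord0 r * (l ord0 r / lamPF x ord0 r) <= \sum_r x ord0 r.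
Proof.
move=> x0 Cl; set lam := lamPF x.
have lam0 r : 0 < x ord0 r -> 0 < lam ord0 r by exact: lamPF_gt0.
pose u r := l ord0 r / lam ord0 r - 1.
rewrite -subr_le0 -sumrB.
have -> : \sum_r (x ord0 r * (l ord0 r / lam ord0 r) - x ord0 r) = \sum_r x ord0 r * u r.
  by apply: eq_bigr => r _; rewrite /u; ring.
rewrite leNgt; apply/negP; set S := \sum_r _ => S0.
pose Q := \sum_r x ord0 r * u r ^+ 2.
have Q0 : 0 <= Q by apply: sumr_ge0 => r _; rewrite mulr_ge0 // sqr_ge0.
(* Here [ln (1 + v) >= v - 2 * v ^+ 2] for [v >= - 1 / 2] replaces differentiation: a positive slope
   [S] would be at most [2 * t * Q] for all small [t]. *)
have key t : 0 < t <= 1 / 2 -> t * S <= 2 * t ^+ 2 * Q.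
  move=> /andP[t0 t12].
  have u1 r : 0 < x ord0 r -> - 1 <= u r.
    move=> xr; rewrite /u lerBrDr addrC subrr divr_ge0 //; first exact: capacity_ge0.
    by apply: ltW; exact: lam0.
  pose lt := (1 - t) *: lam + t *: l.
  have Clt : C lt.
    by apply: capacity_convex; [apply/andP; split; lra|exact: lamPF_C|].
  have ltE r : 0 < x ord0 r -> lt ord0 r = lam ord0 r * (1 + t * u r).
    move=> xr; rewrite !mxE /u; field; rewrite gt_eqF //; exact: lam0.
  have tu1 r : 0 < x ord0 r -> 1 / 2 <= 1 + t * u r.
    by move=> /u1 u1r; have : t * (-1) <= t * u r by [rewrite ler_wpM2l // ltW]; lra.
  have lt0 r : 0 < x ord0 r -> 0 < lt ord0 r.
    move=> xr; rewrite ltE // mulr_gt0 //; first exact: lam0.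
    by have := tu1 r xr; lra.
  have [_ /(_ lt Clt) + _] := PF x0.
  rewrite !pf_objectiveE // lee_fin => obj.
  have : \sum_r x ord0 r * (t * u r - 2 * t ^+ 2 * u r ^+ 2) <=
      \sum_r (x ord0 r * ln (lt ord0 r) - x ord0 r * ln (lam ord0 r)).
    apply: ler_sum => r _; rewrite -mulrBr.
    have := x0 r; rewrite le_eqVlt => /orP[/eqP <-|xr]; first by rewrite !mul0r.
    rewrite ler_pM2l //.
    rewrite -ln_div2 ?lt0 ?lam0 //.
    have -> : lt ord0 r / lam ord0 r = 1 + t * u r.
      by rewrite ltE // mulrAC divff ?mul1r // gt_eqF // lam0.
    have a0 : 0 < 1 + t * u r by have := tu1 r xr; lra.
    apply: le_trans (ln_ge_sub1 a0).
    rewrite -subr_ge0.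
    have -> : 1 - (1 + t * u r)^-1 - (t * u r - 2 * t ^+ 2 * u r ^+ 2) =
      (t * u r) ^+ 2 * (1 + 2 * (t * u r)) / (1 + t * u r).
      by field; rewrite gt_eqF.
    apply: divr_ge0; last exact: ltW.
    rewrite mulr_ge0 ?sqr_ge0 //.
    by have := tu1 r xr; lra.
  have -> : \sum_r x ord0 r * (t * u r - 2 * t ^+ 2 * u r ^+ 2) =
      t * S - 2 * t ^+ 2 * Q.
    rewrite /S /Q !mulr_sumr -sumrB; apply: eq_bigr => r _; ring.
  rewrite sumrB; lra.
pose t := Num.min (1 / 2) (S / (4 * (Q + 1))).
have t0 : 0 < t by rewrite lt_min divr_gt0 //= ?divr_gt0 // mulr_gt0 //; lra.
have t2 : t <= 1 / 2 by rewrite ge_min lexx.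
have tS : t * (4 * (Q + 1)) <= S.
  by rewrite -ler_pdivlMr ?ge_min ?lexx ?orbT // mulr_gt0 //; lra.
have := key t; rewrite t0 t2 => /(_ isT).
have -> : 2 * t ^+ 2 * Q = t * (2 * t * Q) by ring.
rewrite ler_pM2l // => SQ.
have : 0 <= t * Q by rewrite mulr_ge0 // ltW.
move: tS SQ t0; rewrite mulrDr mulr1; lra.
Qed.

Definition pf_ratio x r : R := lamPF x ord0 r / rho r.

Definition pf_potential x : R := \sum_r x ord0 r * ln (pf_ratio x r).

Lemma pf_ratio_ge0 x r : (forall r, 0 <= x ord0 r) -> 0 <= pf_ratio x r.
Proof.
move=> x0; apply: divr_ge0; last by rewrite ltW ?rho_gt0.
by apply: capacity_ge0; exact: lamPF_C.
Qed.

Lemma pf_ratio_gt0 x r : (forall r, 0 <= x ord0 r) -> 0 < x ord0 r ->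
  0 < pf_ratio x r.
Proof. by move=> x0 xr; rewrite divr_gt0 ?rho_gt0 ?lamPF_gt0. Qed.

Lemma pf_ratio_eq0 x r : (forall r, 0 <= x ord0 r) -> x ord0 r = 0 ->
  pf_ratio x r = 0.
Proof. by move=> /PF[_ _ h] /h; rewrite /pf_ratio => ->; rewrite mul0r. Qed.

Lemma pf_ratio_bounded : exists2 B, 1 <= B & forall x r,
  (forall r, 0 <= x ord0 r) -> pf_ratio x r <= B.
Proof.
have [B hB] := capacity_bounded.
exists (1 + \sum_r `|B| / rho r).
  rewrite lerDl sumr_ge0 // => r _; rewrite divr_ge0 // ltW ?rho_gt0 //.
move=> x r x0; apply: (@le_trans _ _ (`|B| / rho r)).
  rewrite ler_pM2r ?invr_gt0 ?rho_gt0 //; apply: le_trans (ler_norm B).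
  by apply: hB; exact: lamPF_C.
rewrite (bigD1 r) //= addrCA lerDl addr_ge0 // sumr_ge0 // => s _.
by rewrite divr_ge0 // ltW ?rho_gt0.
Qed.

Lemma pf_ratio_test x l : (forall r, 0 <= x ord0 r) -> C l ->
  \sum_r x ord0 r * (l ord0 r / rho r / pf_ratio x r) <= \sum_r x ord0 r.
Proof.
move=> x0 Cl; apply: le_trans (lamPF_variational x0 Cl).
rewrite le_eqVlt; apply/orP; left; apply/eqP; apply: eq_bigr => r _.
have := x0 r; rewrite le_eqVlt => /orP[/eqP <-|xr]; first by rewrite !mul0r.
rewrite /pf_ratio; field.
by rewrite !gt_eqF ?rho_gt0 ?lamPF_gt0.
Qed.

Lemma pf_ratio_variational x x' : (forall r, 0 <= x ord0 r) ->
  (forall r, 0 <= x' ord0 r) ->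
  \sum_r x ord0 r * (pf_ratio x' r / pf_ratio x r) <= \sum_r x ord0 r.
Proof. by move=> x0 x'0; apply: pf_ratio_test => //; exact: lamPF_C. Qed.

(** Optimality tested against [rho] bounds the sum of [x_s / y_s] by the population, and a single
    term suffices. The ratio of a type is thus at least its share of the population. *)
Lemma pf_ratio_ge x r : (forall r, 0 <= x ord0 r) ->
  x ord0 r <= pf_ratio x r * \sum_s x ord0 s.
Proof.
move=> x0; have := x0 r; rewrite le_eqVlt => /orP[/eqP <-|xr].
  by rewrite mulr_ge0 ?pf_ratio_ge0 // sumr_ge0.
rewrite -ler_pdivrMl ?pf_ratio_gt0 //.
have := pf_ratio_test x0 capacity_rho; apply: le_trans.
have term s : x ord0 s * ((\row_r rho r : 'rV[R]_n) ord0 s / rho s / pf_ratio x s) =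
    x ord0 s / pf_ratio x s.
  by rewrite mxE divff ?div1r // gt_eqF ?rho_gt0.
rewrite (bigD1 r) //= term mulrC lerDl sumr_ge0 // => s _.
by rewrite term divr_ge0 ?pf_ratio_ge0.
Qed.

Lemma pf_potential_test x l : (forall r, 0 <= x ord0 r) -> C l ->
  (forall r, 0 < x ord0 r -> 0 < l ord0 r) ->
  \sum_r x ord0 r * ln (l ord0 r / rho r) <= pf_potential x.
Proof.
move=> x0 Cl l0; rewrite -subr_le0 /pf_potential -sumrB.
apply: (@le_trans _ _ (\sum_r (x ord0 r * (l ord0 r / rho r / pf_ratio x r) - x ord0 r))).
  apply: ler_sum => r _.
  have := x0 r; rewrite le_eqVlt => /orP[/eqP <-|xr]; first by rewrite !mul0r.
  have lr0 : 0 < l ord0 r / rho r by rewrite divr_gt0 ?rho_gt0 ?l0.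
  rewrite -mulrBr -[X in _ <= _ - X]mulr1 -mulrBr ler_pM2l //.
  rewrite -ln_div2 ?pf_ratio_gt0 //; apply: ln_le_sub1.
  by rewrite divr_gt0 ?pf_ratio_gt0.
by rewrite sumrB subr_le0; exact: pf_ratio_test.
Qed.

(** The potential is a maximum of linear functions, so the allocation at [x'] gives a subgradient
    there. That allocation is a legitimate test point for [x] when it is positive wherever [x] is,
    whence the condition on supports. *)
Lemma pf_potential_sub_le x x' : (forall r, 0 <= x ord0 r) ->
  (forall r, 0 <= x' ord0 r) -> (forall r, 0 < x ord0 r -> 0 < x' ord0 r) ->
  pf_potential x' - pf_potential x <=
  \sum_r (x' ord0 r - x ord0 r) * ln (pf_ratio x' r).
Proof.
move=> x0 x'0 xx'; have := pf_potential_test x0 (lamPF_C x'0).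
have lam0 r : 0 < x ord0 r -> 0 < lamPF x' ord0 r by move=> /xx'; exact: lamPF_gt0.
move=> /(_ lam0); under [X in _ -> _ <= X]eq_bigr do rewrite mulrBl.
rewrite sumrB -/(pf_potential x') /pf_ratio; lra.
Qed.

(** When a coordinate may drop to zero, the ratios at [x'] have no usable logarithm. Those at [x]
    are used instead, at the price of one unit per removed user. *)
Lemma pf_potential_remove x x' : (forall r, 0 <= x ord0 r) ->
  (forall r, 0 <= x' ord0 r <= x ord0 r) ->
  pf_potential x' - pf_potential x <=
  \sum_r (x ord0 r - x' ord0 r) * (1 - ln (pf_ratio x r)).
Proof.
move=> x0 x'x; have x'0 r : 0 <= x' ord0 r by have /andP[] := x'x r.
have : pf_potential x' <= \sum_r x' ord0 r *
    (ln (pf_ratio x r) + (pf_ratio x' r / pf_ratio x r - 1)).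
  apply: ler_sum => r _; have := x'0 r.
  rewrite le_eqVlt => /orP[/eqP <-|x'r]; first by rewrite !mul0r.
  have xr : 0 < x ord0 r by have /andP[_] := x'x r; exact: lt_le_trans.
  rewrite ler_pM2l // -lerBlDl -ln_div2 ?pf_ratio_gt0 //; apply: ln_le_sub1.
  by rewrite divr_gt0 ?pf_ratio_gt0.
have : \sum_r x' ord0 r * (pf_ratio x' r / pf_ratio x r) <= \sum_r x ord0 r.
  apply: le_trans (pf_ratio_variational x0 x'0); apply: ler_sum => r _.
  by have /andP[_ ?] := x'x r; rewrite ler_wpM2r // divr_ge0 ?pf_ratio_ge0.
have -> : \sum_r x' ord0 r * (ln (pf_ratio x r) + (pf_ratio x' r / pf_ratio x r - 1)) =
    \sum_r x' ord0 r * (pf_ratio x' r / pf_ratio x r) +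
    \sum_r x' ord0 r * (ln (pf_ratio x r) - 1).
  by rewrite -big_split /=; apply: eq_bigr => r _; ring.
have -> : \sum_r (x ord0 r - x' ord0 r) * (1 - ln (pf_ratio x r)) =
    \sum_r x ord0 r - pf_potential x + \sum_r x' ord0 r * (ln (pf_ratio x r) - 1).
  by rewrite /pf_potential -sumrB -big_split /=; apply: eq_bigr => r _; ring.
lra.
Qed.

Lemma pf_potential_ge : exists2 k, 0 < k & forall x, (forall r, 0 <= x ord0 r) ->
  ln (1 + k) * \sum_r x ord0 r <= pf_potential x.
Proof.
have [k k0 Ck] := capacity_slack; exists k => // x x0.
have l0 r : 0 < x ord0 r -> 0 < (\row_r ((1 + k) * rho r) : 'rV[R]_n) ord0 r.
  by move=> _; rewrite mxE mulr_gt0 ?rho_gt0 //; lra.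
apply: le_trans (pf_potential_test x0 Ck l0); rewrite mulr_sumr.
apply: ler_sum => r _; rewrite mxE mulfK ?gt_eqF ?rho_gt0 //.
by rewrite mulrC.
Qed.

End proportional_fairness.

(** * Substochastic routing and entropy dissipation *)

Section substochastic_matrices.
Context {R : realType} {n : nat} (p : 'M[R]_n).
Hypothesis p_sub : substochastic p.

Let p0 r s : 0 <= p r s. Proof. by case: p_sub. Qed.
Let p1 r : \sum_s p r s <= 1. Proof. by case: p_sub. Qed.

(** The moduli must be bounded for their [sup] to dominate them. A substochastic matrix does not
    increase the l1 norm of a row vector, in particular of a left eigenvector. *)
Lemma eigenvalue_normc_le1 (z : R[i]) :
  eigenvalue (map_mx (real_complex R) p) z -> ComplexField.Normc.normc z <= 1.
Proof.
move=> /eigenvalueP[v vp v0].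
pose N := \sum_j ComplexField.Normc.normc (v ord0 j).
have normc0 (x : R[i]) : 0 <= ComplexField.Normc.normc x.
  by case: x => a b /=; exact: sqrtr_ge0.
have normcD (x y : R[i]) : ComplexField.Normc.normc (x + y) <=
    ComplexField.Normc.normc x + ComplexField.Normc.normc y.
  by have := ler_normD x y; rewrite /Num.norm /= -rmorphD lecR.
have normc_sum (I : finType) (f : I -> R[i]) :
    ComplexField.Normc.normc (\sum_i f i) <= \sum_i ComplexField.Normc.normc (f i).
  elim/big_ind2 : _ => //; first by rewrite ComplexField.Normc.normc0.
  by move=> x x' y y' ? ?; apply: le_trans (normcD _ _) _; exact: lerD.
have N0 : 0 < N.
  have [j vj] : exists j, v ord0 j != 0.
    by have /rV0Pn := v0.
  rewrite /N (bigD1 j) //= ltr_wpDr ?sumr_ge0 // lt_neqAle normc0 andbT eq_sym.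
  by apply: contra vj => /eqP/ComplexField.Normc.eq0_normc ->.
rewrite -(ler_pM2r N0) mul1r {1}/N mulr_sumr.
have -> : \sum_j ComplexField.Normc.normc z * ComplexField.Normc.normc (v ord0 j) =
    \sum_j ComplexField.Normc.normc (\sum_i v ord0 i * (p i j)%:C%C).
  apply: eq_bigr => j _; rewrite -ComplexField.Normc.normcM; congr ComplexField.Normc.normc.
  have := congr1 (fun u : 'rV_n => u ord0 j) vp; rewrite !mxE => <-.
  by apply: eq_bigr => i _; rewrite !mxE.
apply: (@le_trans _ _ (\sum_j \sum_i ComplexField.Normc.normc (v ord0 i) * p i j)).
  apply: ler_sum => j _; apply: le_trans (normc_sum _ _) _; apply: ler_sum => i _.
  rewrite ComplexField.Normc.normcM ler_wpM2l //=.
  by rewrite expr0n /= addr0 sqrtr_sqr ger0_norm.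
rewrite exchange_big /=; apply: ler_sum => i _.
by rewrite -mulr_sumr -[leRHS]mulr1 ler_wpM2l.
Qed.

(** An eigenvalue 1 would make the spectral radius at least 1, so [1 - p] is invertible. Here [h r]
    is the mean number of services of a user that starts with type [r]; transience of the routing is
    used through [h] from now on. *)
Lemma spectral_radius_potential : spectral_radius p < 1 ->
  exists h : 'I_n -> R, forall r, h r = 1 + \sum_s p r s * h s.
Proof.
move=> p_lt1; have unit1p : 1%:M - p \in unitmx.
  rewrite -row_free_unit -kermx_eq0; apply/negPn/negP => /rowV0Pn[v vker v0].
  have vp : v *m p = v.
    move: vker => /sub_kermxP; rewrite mulmxBr mulmx1 => /eqP.
    by rewrite subr_eq0 => /eqP.
  suff : 1 <= spectral_radius p by rewrite leNgt p_lt1.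
  apply: ub_le_sup.
    by exists 1 => _ [z /eigenvalue_normc_le1 ? <-].
  exists 1 => /=; last by rewrite expr1n expr0n /= addr0 sqrtr1.
  apply/eigenvalueP; exists (map_mx (real_complex R) v).
    by rewrite -map_mxM /= vp scale1r.
  by rewrite map_mx_eq0.
exists (fun r => (invmx (1%:M - p) *m const_mx 1 : 'cV[R]_n) r ord0) => r.
set h := invmx _ *m _.
have : (1%:M - p) *m h = const_mx 1 by rewrite mulKVmx.
move=> /(congr1 (fun u : 'cV[R]_n => u r ord0)).
rewrite mulmxBl mul1mx !mxE => e.
by apply/eqP; rewrite -subr_eq; apply/eqP.
Qed.

Context (h : 'I_n -> R).
Hypothesis hE : forall r, h r = 1 + \sum_s p r s * h s.

(** Minimum principle: a negative value at a minimizer [s] would give [h s >= 1 + h s]. *)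
Lemma potential_ge1 r : 1 <= h r.
Proof.
have [s _ smin] : exists2 s : 'I_n, true & forall t, h s <= h t.
  by case: (@arg_minP _ _ _ r predT h isT) => s _ smin; exists s => // t; exact: smin.
have s0 : 0 <= h s.
  rewrite leNgt; apply/negP => hs.
  have : h s * 1 <= \sum_t p s t * h t.
    apply: (@le_trans _ _ (h s * \sum_t p s t)); first by rewrite ler_nM2l.
    rewrite mulr_sumr; apply: ler_sum => t _; rewrite mulrC ler_wpM2l //; exact: smin.
  by have := hE s; lra.
rewrite hE lerDl sumr_ge0 // => t _; rewrite mulr_ge0 //; exact: le_trans (smin t).
Qed.

(* The expected number of visits decreases along some edge until the exit. *)
Lemma routing_ind (B : 'I_n -> Prop) :
  (forall r, 0 < 1 - \sum_s p r s -> B r) ->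
  (forall r s, 0 < p r s -> B s -> B r) -> forall r, B r.
Proof.
move=> Bexit Bstep r; apply: contrapT => nBr.
pose bad := [pred r | `[< ~ B r >]].
have rbad : bad r by apply/asboolP.
have [s /asboolP nBs smin] := @arg_minP _ _ _ r bad h rbad.
have leak : 1 - \sum_t p s t <= 0.
  by rewrite leNgt; apply/negP => /Bexit.
have : \sum_t p s t * h s <= \sum_t p s t * h t.
  apply: ler_sum => t _; have := p0 s t; rewrite le_eqVlt => /orP[/eqP <-|pst].
    by rewrite !mul0r.
  by rewrite ler_wpM2l //; apply: smin; apply/asboolP => /(Bstep _ _ pst).
rewrite -mulr_suml; have -> : \sum_t p s t = 1 by apply/eqP; rewrite eq_le p1; lra.
by have := hE s; lra.
Qed.

Context (nubar nu : 'I_n -> R).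
Hypothesis nubar_ge0 : forall r, 0 <= nubar r.
Hypothesis nu_gt0 : forall r, 0 < nu r.
Hypothesis traffic : forall r, nu r = nubar r + \sum_s p s r * nu s.

(** The types where [B] fails receive neither arrivals nor users from the other types. Their traffic
    equations, weighted by [h] and summed, force their total traffic to be at most zero, against
    [nu > 0]. *)
Lemma arrival_ind (B : 'I_n -> Prop) :
  (forall r, 0 < nubar r -> B r) ->
  (forall r s, 0 < p s r -> B s -> B r) -> forall r, B r.
Proof.
move=> Barr Bstep.
pose bad := [pred r | `[< ~ B r >]].
have badE r : bad r -> nu r = \sum_(s | bad s) p s r * nu s.
  move=> /asboolP nBr; rewrite traffic.
  have -> : nubar r = 0.
    by apply/eqP; rewrite eq_le nubar_ge0 andbT leNgt; apply/negP => /Barr.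
  rewrite add0r (bigID bad) /= [X in _ + X]big1 ?addr0 // => s /asboolP/contrapT Bs.
  have -> : p s r = 0; last by rewrite mul0r.
  apply/eqP; rewrite eq_le p0 andbT leNgt; apply/negP => psr.
  exact: nBr (Bstep _ _ psr Bs).
have le : \sum_(r | bad r) nu r * h r <= \sum_(s | bad s) nu s * (h s - 1).
  have -> : \sum_(r | bad r) nu r * h r =
      \sum_(r | bad r) \sum_(s | bad s) nu s * (p s r * h r).
    apply: eq_bigr => r br; rewrite {1}badE // mulr_suml.
    by apply: eq_bigr => s _; ring.
  rewrite exchange_big /=; apply: ler_sum => s _; rewrite -mulr_sumr.
  apply: ler_wpM2l; first exact: ltW.
  rewrite hE addrC addKr [leRHS](bigID bad) /= lerDl sumr_ge0 // => r _.
  by rewrite mulr_ge0 // (le_trans ler01) // potential_ge1.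
have le0 : \sum_(r | bad r) nu r <= 0.
  have : \sum_(s | bad s) nu s * (h s - 1) =
      \sum_(s | bad s) nu s * h s - \sum_(s | bad s) nu s.
    by rewrite -sumrB; apply: eq_bigr => s _; rewrite mulrBr mulr1.
  move: le; lra.
move=> r; apply: contrapT => nBr; have br : bad r by apply/asboolP.
move: le0; rewrite (bigD1 r) //= leNgt => /negP; apply.
by rewrite ltr_wpDr // sumr_ge0 // => s _; rewrite ltW.
Qed.

End substochastic_matrices.

Lemma fin_min_gt0 {R : realType} {I : finType} (c : I -> R) :
  (forall i, 0 < c i) -> exists2 m, 0 < m & forall i, m <= c i.
Proof.
move=> c0; exists (\big[Order.min/1]_i c i); last by move=> i; exact: bigmin_le.
by elim/big_ind : _ => // a b a0 b0; rewrite lt_min a0.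
Qed.

Section entropy.
Context {R : realType} {n : nat} (p : 'M[R]_n) (nubar nu : 'I_n -> R).
Hypothesis p_sub : substochastic p.
Hypothesis nubar_ge0 : forall r, 0 <= nubar r.
Hypothesis nu_gt0 : forall r, 0 < nu r.
Hypothesis traffic : forall r, nu r = nubar r + \sum_s p s r * nu s.

Let p0 r s : 0 <= p r s. Proof. by case: p_sub. Qed.
Let p1 r : 0 <= 1 - \sum_s p r s. Proof. by rewrite subr_ge0; case: p_sub. Qed.
Let nu0 r : 0 <= nu r. Proof. exact: ltW. Qed.

Definition net_flow (y : 'I_n -> R) (r : 'I_n) : R :=
  nubar r + \sum_s nu s * y s * p s r - nu r * y r.

(* The load vector [y = 1] is balanced, so mixing with it only rescales. *)
Lemma net_flow_mix eta y r :
  net_flow (fun s => (1 - eta) * y s + eta) r = (1 - eta) * net_flow y r.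
Proof.
rewrite /net_flow.
have -> : \sum_s nu s * ((1 - eta) * y s + eta) * p s r =
    (1 - eta) * \sum_s nu s * y s * p s r + eta * \sum_s p s r * nu s.
  by rewrite !mulr_sumr -big_split /=; apply: eq_bigr => s _; ring.
have -> : \sum_s p s r * nu s = nu r - nubar r by rewrite [nu r]traffic; ring.
by ring.
Qed.

(** Dirichlet form of the square root of [y] on the routing graph, in which the outside world is a
    vertex with [y = 1]. *)
Definition dissipation (y : 'I_n -> R) : R :=
  \sum_r nubar r * (Num.sqrt (y r) - 1) ^+ 2 +
  \sum_s \sum_r nu s * p s r * (Num.sqrt (y r) - Num.sqrt (y s)) ^+ 2 +
  \sum_s nu s * (1 - \sum_r p s r) * (1 - Num.sqrt (y s)) ^+ 2.

Let arrivals_ge0 y : 0 <= \sum_r nubar r * (Num.sqrt (y r) - 1) ^+ 2.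
Proof. by apply: sumr_ge0 => r _; rewrite mulr_ge0 ?sqr_ge0. Qed.

Let edge_ge0 (y : 'I_n -> R) s r :
  0 <= nu s * p s r * (Num.sqrt (y r) - Num.sqrt (y s)) ^+ 2.
Proof. by rewrite mulr_ge0 ?sqr_ge0 // mulr_ge0. Qed.

Let edges_ge0 (y : 'I_n -> R) s :
  0 <= \sum_r nu s * p s r * (Num.sqrt (y r) - Num.sqrt (y s)) ^+ 2.
Proof. by apply: sumr_ge0 => r _; exact: edge_ge0. Qed.

Let exit_ge0 (y : 'I_n -> R) s :
  0 <= nu s * (1 - \sum_r p s r) * (1 - Num.sqrt (y s)) ^+ 2.
Proof. by rewrite mulr_ge0 ?sqr_ge0 // mulr_ge0. Qed.

Let exits_ge0 (y : 'I_n -> R) :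
  0 <= \sum_s nu s * (1 - \sum_r p s r) * (1 - Num.sqrt (y s)) ^+ 2.
Proof. by apply: sumr_ge0 => s _; exact: exit_ge0. Qed.

Lemma dissipation_ge0 y : 0 <= dissipation y.
Proof.
by rewrite addr_ge0 ?exits_ge0 // addr_ge0 ?arrivals_ge0 // sumr_ge0.
Qed.

(** Applying [ln v <= v - 1] to the quotient of the square roots, rather than to [b / a], leaves the
    square as a gain. *)
Lemma entropy_term (a b : R) : 0 < a -> 0 < b ->
  a * (ln b - ln a) <= b - a - (Num.sqrt b - Num.sqrt a) ^+ 2.
Proof.
move=> a0 b0; have sa : 0 < Num.sqrt a by rewrite sqrtr_gt0.
have sb : 0 < Num.sqrt b by rewrite sqrtr_gt0.
have aE : Num.sqrt a ^+ 2 = a by rewrite sqr_sqrtr // ltW.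
have bE : Num.sqrt b ^+ 2 = b by rewrite sqr_sqrtr // ltW.
move: (Num.sqrt a) (Num.sqrt b) sa sb aE bE => u v u0 v0 <- <-.
rewrite !lnXn // -mulrnBl -ln_div2 //.
have hu := ln_le_sub1 (divr_gt0 v0 u0).
apply: (@le_trans _ _ (u ^+ 2 * ((v / u - 1) *+ 2))).
  by rewrite ler_pM2l ?exprn_gt0 // lerMn2r.
rewrite le_eqVlt; apply/orP; left; apply/eqP.
by field; rewrite gt_eqF.
Qed.

(** Summation by parts turns the left side into a sum over routes of the flux times the change of
    [ln y], with [y = 1] outside. After [entropy_term] the linear terms cancel by the traffic
    equations. *)
Lemma entropy_production y : (forall r, 0 < y r) ->
  \sum_r ln (y r) * net_flow y r <= - dissipation y.
Proof.
move=> y0.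
have -> : \sum_r ln (y r) * net_flow y r =
  \sum_r nubar r * (1 * (ln (y r) - ln 1)) +
  \sum_s \sum_r nu s * p s r * (y s * (ln (y r) - ln (y s))) +
  \sum_s nu s * (1 - \sum_r p s r) * (y s * (ln 1 - ln (y s))).
  rewrite ln1.
  have -> : \sum_s \sum_r nu s * p s r * (y s * (ln (y r) - ln (y s))) =
     \sum_r \sum_s nu s * y s * p s r * ln (y r) -
     \sum_s nu s * y s * ln (y s) * \sum_r p s r.
    rewrite exchange_big /=; under [X in _ - X]eq_bigr do rewrite mulr_sumr.
    rewrite [X in _ - X]exchange_big /= -sumrB; apply: eq_bigr => r _.
    by rewrite -sumrB; apply: eq_bigr => s _; ring.
  rewrite -[X in _ = _ + X + _]sumrB -!big_split /=; apply: eq_bigr => r _.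
  by rewrite /net_flow -mulr_suml; ring.
rewrite /dissipation.
apply: (@le_trans _ _ (
  \sum_r nubar r * (y r - 1 - (Num.sqrt (y r) - Num.sqrt 1) ^+ 2) +
  \sum_s \sum_r nu s * p s r * (y r - y s - (Num.sqrt (y r) - Num.sqrt (y s)) ^+ 2) +
  \sum_s nu s * (1 - \sum_r p s r) * (1 - y s - (Num.sqrt 1 - Num.sqrt (y s)) ^+ 2))).
  rewrite !lerD //; apply: ler_sum => r _.
  - by rewrite ler_wpM2l // entropy_term.
  - by apply: ler_sum => s _; rewrite ler_wpM2l ?mulr_ge0 // entropy_term.
  - by rewrite ler_wpM2l ?mulr_ge0 // entropy_term.
rewrite sqrtr1 le_eqVlt; apply/orP; left; apply/eqP/eqP; rewrite -subr_eq0; apply/eqP.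
transitivity (\sum_r nubar r * (y r - 1) +
  (\sum_r y r * \sum_s p s r * nu s - \sum_s nu s * y s * \sum_r p s r) +
  \sum_s nu s * (1 - \sum_r p s r) * (1 - y s)).
  have -> : \sum_r y r * \sum_s p s r * nu s - \sum_s nu s * y s * \sum_r p s r =
      \sum_s \sum_r nu s * p s r * (y r - y s).
    under eq_bigr do rewrite mulr_sumr.
    under [X in _ - X]eq_bigr do rewrite mulr_sumr.
    rewrite exchange_big /= -sumrB; apply: eq_bigr => s _.
    by rewrite -sumrB; apply: eq_bigr => r _; ring.
  have dist (I : finType) (F G : I -> R) (H : I -> R) :
      \sum_i H i * (F i - G i) = \sum_i H i * F i - \sum_i H i * G i.
    by rewrite -sumrB; apply: eq_bigr => i _; ring.
  rewrite [X in X + _ + _ - _]dist [X in _ + X - _]dist.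
  under [X in _ + X + _ - _]eq_bigr do rewrite dist.
  by rewrite sumrB; ring.
have tot : \sum_r nubar r = \sum_s nu s * (1 - \sum_r p s r).
  transitivity (\sum_r (nu r - \sum_s p s r * nu s)).
    by apply: eq_bigr => r _; rewrite {1}traffic; ring.
  rewrite sumrB exchange_big /= -sumrB; apply: eq_bigr => s _.
  by rewrite -mulr_suml; ring.
have -> : \sum_r y r * \sum_s p s r * nu s = \sum_r y r * (nu r - nubar r).
  by apply: eq_bigr => r _; congr (_ * _); rewrite traffic; ring.
transitivity (\sum_s nu s * (1 - \sum_r p s r) - \sum_r nubar r).
  by rewrite -!(sumrB, big_split) /=; apply: eq_bigr => r _; ring.
by rewrite tot subrr.
Qed.

Context (h : 'I_n -> R).
Hypothesis hE : forall r, h r = 1 + \sum_s p r s * h s.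

(** The value 1 of the outside world is carried back along a route to an exit by
    [(u + v) ^+ 2 <= 2 * u ^+ 2 + 2 * v ^+ 2]. The constants compose like resistances in series, up
    to the factor 2. *)
Lemma dissipation_coercive_sqrt : exists2 c, 0 < c & forall (y : 'I_n -> R) r,
  c * (Num.sqrt (y r) - 1) ^+ 2 <= dissipation y.
Proof.
suff H r : exists2 c, 0 < c & forall (y : 'I_n -> R),
    c * (Num.sqrt (y r) - 1) ^+ 2 <= dissipation y.
  have /choice[c hc] : forall r, exists c, 0 < c /\ forall (y : 'I_n -> R),
      c * (Num.sqrt (y r) - 1) ^+ 2 <= dissipation y.
    by move=> r; have [c c0 hc] := H r; exists c.
  have [m m0 hm] := fin_min_gt0 (fun r => proj1 (hc r)).
  exists m => // y r; apply: le_trans (proj2 (hc r) y).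
  by rewrite ler_wpM2r ?sqr_ge0.
have sq_sum0 (I : finType) (F : I -> R) i : (forall j, 0 <= F j) -> F i <= \sum_j F j.
  by move=> F0; rewrite (bigD1 i) //= lerDl sumr_ge0.
have edge_le y s t :
    nu s * p s t * (Num.sqrt (y t) - Num.sqrt (y s)) ^+ 2 <= dissipation y.
  apply: le_trans (sq_sum0 _ (fun r => nu s * p s r *
    (Num.sqrt (y r) - Num.sqrt (y s)) ^+ 2) t (edge_ge0 y s)) _.
  apply: le_trans (sq_sum0 _ (fun s => \sum_r nu s * p s r *
    (Num.sqrt (y r) - Num.sqrt (y s)) ^+ 2) s (edges_ge0 y)) _.
  by rewrite /dissipation addrAC lerDr addr_ge0 ?arrivals_ge0 ?exits_ge0.
move: r; apply: (@routing_ind _ _ _ p_sub _ hE (fun r => exists2 c, 0 < c &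
  forall y, c * (Num.sqrt (y r) - 1) ^+ 2 <= dissipation y)) => r.
  move=> pr; exists (nu r * (1 - \sum_s p r s)); first by rewrite mulr_gt0.
  move=> y; rewrite -sqrrN opprB.
  apply: le_trans (sq_sum0 _ (fun s => nu s * (1 - \sum_r p s r) *
    (1 - Num.sqrt (y s)) ^+ 2) r (exit_ge0 y)) _.
  by rewrite /dissipation lerDr addr_ge0 ?arrivals_ge0 // sumr_ge0.
move=> s prs [c c0 hc].
have e0 : 0 < nu r * p r s by rewrite mulr_gt0.
exists ((2 * (c^-1 + (nu r * p r s)^-1))^-1).
  by rewrite invr_gt0 mulr_gt0 // addr_gt0 ?invr_gt0.
move=> y; rewrite mulrC ler_pdivrMr; last first.
  by rewrite mulr_gt0 // addr_gt0 ?invr_gt0.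
have h1 : (Num.sqrt (y s) - 1) ^+ 2 <= dissipation y / c.
  by rewrite ler_pdivlMr // mulrC.
have h2 : (Num.sqrt (y s) - Num.sqrt (y r)) ^+ 2 <= dissipation y / (nu r * p r s).
  by rewrite ler_pdivlMr // mulrC.
have : (Num.sqrt (y r) - 1) ^+ 2 <= 2 * (Num.sqrt (y s) - 1) ^+ 2 +
    2 * (Num.sqrt (y s) - Num.sqrt (y r)) ^+ 2.
  rewrite -subr_ge0.
  rewrite (_ : _ - _ = (2 * Num.sqrt (y s) - Num.sqrt (y r) - 1) ^+ 2) ?sqr_ge0 //.
  by ring.
rewrite mulrCA mulrDr; move: h1 h2; lra.
Qed.

Lemma dissipation_coercive K : 1 < K -> exists2 eps, 0 < eps &
  forall (y : 'I_n -> R) r, K <= y r -> eps <= dissipation y.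
Proof.
move=> K1; have [c c0 hc] := dissipation_coercive_sqrt.
have sK : 1 < Num.sqrt K by rewrite -sqrtr1 ltr_sqrt //; lra.
exists (c * (Num.sqrt K - 1) ^+ 2).
  by rewrite mulr_gt0 // exprn_gt0 // subr_gt0.
move=> y r Ky; apply: le_trans (hc y r); rewrite ler_pM2l //.
have : Num.sqrt K <= Num.sqrt (y r) by rewrite ler_wsqrtr.
by move=> ?; apply: lerXn2r; rewrite ?nnegrE; lra.
Qed.

End entropy.

(** * Drift over a window *)

Lemma ratio_close {R : realType} (s t : R) : 0 <= s <= 1 / 2 -> 0 < t ->
  (t - 1) ^+ 2 <= s ^+ 2 * t -> 1 - 2 * s <= t <= 1 + 2 * s.
Proof.
move=> /andP[s0 s12] t0 h; set u := t - 1.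
have tE : t = 1 + u by rewrite /u; ring.
have hu : u ^+ 2 <= s ^+ 2 + s ^+ 2 * u by move: h; rewrite -/u tE mulrDr mulr1.
suff : - (2 * s) <= u <= 2 * s by rewrite tE => /andP[? ?]; apply/andP; split; lra.
have ss : s ^+ 2 <= s / 2 by rewrite expr2; nra.
apply/andP; split; rewrite leNgt; apply/negP => bad; nra.
Qed.

Lemma ln_close {R : realType} (s u v : R) : 0 <= s <= 1 / 12 -> 0 < u -> 0 < v ->
  1 - 3 * s <= u / v <= 1 + 3 * s -> `|ln v - ln u| <= 6 * s.
Proof.
move=> /andP[s0 s12] u0 v0 /andP[lo hi].
have r0 : 0 < u / v by rewrite divr_gt0.
rewrite distrC -ln_div2 // ler_norml; apply/andP; split; last first.
  by apply: le_trans (ln_le_sub1 r0) _; lra.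
apply: le_trans (ln_ge_sub1 r0).
have : (u / v)^-1 <= 1 + 6 * s; last by lra.
rewrite -div1r ler_pdivrMr //; nra.
Qed.

Section window.
Context {R : realType} {n : nat} (C : set 'rV[R]_n) (lamPF : 'rV[R]_n -> 'rV[R]_n)
  (rho : 'I_n -> R).
Hypothesis C_capacity : capacity_set C.
Hypothesis PF : forall x : 'rV[R]_n, (forall r, 0 <= x ord0 r) ->
  is_pf_allocation C x (lamPF x).
Hypothesis rho_int : interior C (\row_r rho r).

Local Notation Y := (pf_ratio lamPF rho).
Local Notation L := (pf_potential lamPF rho).

Let Y_ge0 := pf_ratio_ge0 C_capacity PF rho_int.
Let Y_gt0 := pf_ratio_gt0 C_capacity PF rho_int.

(** Testing each of [x] and [x'] against the allocation of the other and adding controls the sum of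
    [y' / y + y / y' - 2], which equals [(y / y' - 1) ^+ 2 / (y / y')]. The discrepancy of the
    weights and the small coordinates of [x] form the error. *)
Lemma pf_ratio_close (Lam : pred 'I_n) (x x' : 'rV[R]_n) (m s : R) r :
  (forall r, 0 <= x ord0 r) -> (forall r, 0 <= x' ord0 r) ->
  (forall r, ~~ Lam r -> x' ord0 r = 0) ->
  (forall r, Lam r -> m <= x ord0 r) -> (forall r, Lam r -> m <= x' ord0 r) ->
  0 < m -> 0 <= s <= 1 / 2 ->
  \sum_(r | ~~ Lam r) x ord0 r + \sum_(r | Lam r) `|x ord0 r - x' ord0 r|
    <= s ^+ 2 * m ->
  Lam r -> 1 - 2 * s <= Y x r / Y x' r <= 1 + 2 * s.
Proof.
move=> x0 x'0 x'L xm x'm m0 s01 small Lr.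
have xp t : Lam t -> 0 < x ord0 t by move=> /xm; exact: lt_le_trans.
have x'p t : Lam t -> 0 < x' ord0 t by move=> /x'm; exact: lt_le_trans.
have Yp t : Lam t -> 0 < Y x t by move=> /xp; exact: Y_gt0.
have Y'p t : Lam t -> 0 < Y x' t by move=> /x'p; exact: Y_gt0.
pose T t := Y x' t / Y x t + Y x t / Y x' t - 2.
have TE t : Lam t -> T t = (Y x t / Y x' t - 1) ^+ 2 / (Y x t / Y x' t).
  by move=> Lt; rewrite /T; field; rewrite !gt_eqF ?Yp ?Y'p.
have T0 t : Lam t -> 0 <= T t.
  by move=> Lt; rewrite TE // divr_ge0 ?sqr_ge0 // divr_ge0 ?ltW ?Yp ?Y'p.
have V1 : \sum_(t | Lam t) x ord0 t * (Y x' t / Y x t) <= \sum_t x ord0 t.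
  have := pf_ratio_variational C_capacity PF rho_int x0 x'0; apply: le_trans.
  rewrite [leRHS](bigID Lam) /= lerDl sumr_ge0 // => t _.
  by rewrite mulr_ge0 // divr_ge0 // Y_ge0.
have V2 : \sum_(t | Lam t) x' ord0 t * (Y x t / Y x' t) <= \sum_(t | Lam t) x' ord0 t.
  have := pf_ratio_variational C_capacity PF rho_int x'0 x0.
  rewrite (bigID Lam) /= [leRHS](bigID Lam) /= [X in _ + X <= _]big1; last first.
    by move=> t /x'L ->; rewrite mul0r.
  by rewrite addr0 [X in _ <= _ + X]big1 ?addr0 // => t /x'L ->.
have sumT : \sum_(t | Lam t) m * T t <= s ^+ 2 * m.
  apply: le_trans small.
  have : \sum_(t | Lam t) m * T t <= \sum_(t | Lam t) (x ord0 t * (Y x' t / Y x t) +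
      x' ord0 t * (Y x t / Y x' t) - x ord0 t - x' ord0 t + `|x ord0 t - x' ord0 t|).
    apply: ler_sum => t Lt.
    have a0 : 0 < Y x' t / Y x t by rewrite divr_gt0 ?Yp ?Y'p.
    have b0 : 0 < Y x t / Y x' t by rewrite divr_gt0 ?Yp ?Y'p.
    have := T0 t Lt; rewrite /T; move: (xm t Lt) (x'm t Lt) a0 b0.
    move: (x ord0 t) (x' ord0 t) (Y x' t / Y x t) (Y x t / Y x' t) => u v a b um vm a0 b0 ab.
    have [uv|vu] := leP 0 (u - v).
      rewrite (ger0_norm uv).
      have : m * (a + b - 2) <= v * (a + b - 2) by rewrite ler_wpM2r.
      have : v * a <= u * a by rewrite ler_wpM2r ?(ltW a0) //; lra.
      lra.
    rewrite (ltr0_norm vu).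
    have : m * (a + b - 2) <= u * (a + b - 2) by rewrite ler_wpM2r.
    have : u * b <= v * b by rewrite ler_wpM2r ?(ltW b0) //; lra.
    lra.
  move=> /le_trans; apply.
  rewrite !big_split /= !sumrN.
  have : \sum_t x ord0 t = \sum_(t | Lam t) x ord0 t + \sum_(t | ~~ Lam t) x ord0 t.
    by rewrite (bigID Lam).
  move: V1 V2; lra.
have Tr : T r <= s ^+ 2.
  rewrite -(ler_pM2l m0) mulrC [leRHS]mulrC; apply: le_trans sumT.
  rewrite (bigD1 r) //= mulrC lerDl sumr_ge0 // => t /andP[Lt _].
  by rewrite mulr_ge0 ?T0 // ltW.
have q0 : 0 < Y x r / Y x' r by rewrite divr_gt0 ?Yp ?Y'p.
by apply: ratio_close => //; rewrite -ler_pdivrMr // -TE.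
Qed.

Context (p : 'M[R]_n) (nubar nu : 'I_n -> R).
Hypothesis p_sub : substochastic p.
Hypothesis nubar_ge0 : forall r, 0 <= nubar r.
Hypothesis nu_gt0 : forall r, 0 < nu r.
Hypothesis traffic : forall r, nu r = nubar r + \sum_s p s r * nu s.

Context (k B eps : R).
Hypothesis k_gt0 : 0 < k.
Hypothesis potential_lb : forall x : 'rV[R]_n, (forall r, 0 <= x ord0 r) ->
  ln (1 + k) * \sum_r x ord0 r <= L x.
Hypothesis B_ge1 : 1 <= B.
Hypothesis ratio_ub : forall (x : 'rV[R]_n) r, (forall r, 0 <= x ord0 r) -> Y x r <= B.
Hypothesis eps_coercive : forall (y : 'I_n -> R) r,
  1 + k / 2 <= y r -> eps <= dissipation p nubar nu y.

Let lnB_ge0 : 0 <= ln B. Proof. exact: ln_ge0. Qed.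

Definition restrict_vec (Lam : pred 'I_n) (x : 'rV[R]_n) : 'rV[R]_n :=
  \row_r if Lam r then x ord0 r else 0.

Lemma restrict_vec_ge0 Lam (x : 'rV[R]_n) r : (forall r, 0 <= x ord0 r) ->
  0 <= restrict_vec Lam x ord0 r.
Proof. by move=> x0; rewrite mxE; case: ifP. Qed.

Lemma potential_sub_restrict (Lam : pred 'I_n) (x : 'rV[R]_n) e : (forall r, 0 <= x ord0 r) ->
  (forall r, ~~ Lam r -> x ord0 r <= e) -> 0 <= e ->
  L x - L (restrict_vec Lam x) <= n%:R * (e * ln B).
Proof.
move=> x0 xe e0.
apply: le_trans (pf_potential_sub_le C_capacity PF rho_int _ x0 _) _.
- by move=> r; exact: restrict_vec_ge0.
- by move=> r; rewrite mxE; case: ifP => // _; rewrite ltxx.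
apply: (@le_trans _ _ (\sum_(r < n) e * ln B)); last first.
  by rewrite sumr_const card_ord mulr_natl.
apply: ler_sum => r _; rewrite mxE; case: ifPn => Lr.
  by rewrite subrr mul0r mulr_ge0.
rewrite subr0; have := x0 r; rewrite le_eqVlt => /orP[/eqP <-|xr].
  by rewrite mul0r mulr_ge0.
apply: (@le_trans _ _ (x ord0 r * ln B)); last by rewrite ler_wpM2r // xe.
rewrite ler_pM2l // ler_ln ?posrE ?ratio_ub ?Y_gt0 //.
exact: lt_le_trans B_ge1.
Qed.

(** Removing [x_r] users costs [x_r * (1 - ln y_r)], where [y_r] may be tiny. Since
    [y_r >= x_r / S], this is an entropy term, which [ln u <= u / K - 1 + ln K] splits: a large [K]
    handles the part in [S], and then a small [e] the other. *)
Lemma potential_restrict_sub (Lam : pred 'I_n) (x : 'rV[R]_n) e S K : (forall r, 0 <= x ord0 r) ->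
  (forall r, ~~ Lam r -> x ord0 r <= e) -> 0 <= e -> \sum_r x ord0 r <= S -> 1 <= K ->
  L (restrict_vec Lam x) - L x <= n%:R * (S / K + e * ln K).
Proof.
move=> x0 xe e0 xS K1.
have K0 : 0 < K by exact: lt_le_trans K1.
have S0 : 0 <= S by apply: le_trans xS; rewrite sumr_ge0.
have SK0 : 0 <= S / K + e * ln K.
  by rewrite addr_ge0 ?mulr_ge0 ?invr_ge0 ?ln_ge0 // ltW.
apply: le_trans (pf_potential_remove C_capacity PF rho_int x0 _) _.
  by move=> r; rewrite mxE; case: ifP => _; rewrite ?x0 ?lexx.
apply: (@le_trans _ _ (\sum_(r < n) (S / K + e * ln K))); last first.
  by rewrite sumr_const card_ord mulr_natl.
apply: ler_sum => r _; rewrite mxE; case: ifPn => Lr.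
  by rewrite subrr mul0r.
rewrite subr0; have := x0 r; rewrite le_eqVlt => /orP[/eqP <-|xr].
  by rewrite mul0r.
have Yr : 0 < Y x r by exact: Y_gt0.
have xYS : x ord0 r <= Y x r * S.
  apply: le_trans (pf_ratio_ge C_capacity PF rho_int r x0) _.
  by rewrite ler_pM2l.
have S1 : 0 < S by rewrite -(pmulr_rgt0 _ Yr); exact: lt_le_trans xYS.
have : 1 - ln (Y x r) <= S / (x ord0 r * K) + ln K.
  have lnY : - ln (Y x r) <= ln (S / x ord0 r).
    have YV0 : 0 < (Y x r)^-1 by rewrite invr_gt0.
    have Sx0 : 0 < S / x ord0 r by rewrite divr_gt0.
    rewrite -lnV ?posrE // ler_ln ?posrE //.
    by rewrite -div1r ler_pdivrMr // mulrAC ler_pdivlMr // mul1r mulrC.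
  have : ln (S / x ord0 r) <= S / (x ord0 r * K) - 1 + ln K.
    have -> : S / x ord0 r = S / (x ord0 r * K) * K by field; rewrite !gt_eqF.
    rewrite lnM ?posrE ?divr_gt0 ?mulr_gt0 // lerD2r.
    by apply: ln_le_sub1; rewrite divr_gt0 ?mulr_gt0.
  lra.
move=> h; apply: (@le_trans _ _ (x ord0 r * (S / (x ord0 r * K) + ln K))).
  by rewrite ler_pM2l.
rewrite mulrDr lerD //; last by rewrite ler_wpM2r ?ln_ge0 // xe.
by rewrite le_eqVlt; apply/orP; left; apply/eqP; field; rewrite !gt_eqF.
Qed.

Lemma ln_bound_abs (eta y : R) : 0 < eta <= 1 -> eta <= y <= B ->
  `|ln y| <= ln B - ln eta.
Proof.
move=> /andP[eta0 eta1] /andP[ey yB]; have y0 : 0 < y by exact: lt_le_trans ey.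
have B0 : 0 < B by exact: lt_le_trans B_ge1.
have l1 : ln eta <= ln y by rewrite ler_ln ?posrE.
have l2 : ln y <= ln B by rewrite ler_ln ?posrE.
have l3 : ln eta <= 0 by exact: ln_le0.
by move: lnB_ge0; rewrite ler_norml => ?; apply/andP; split; lra.
Qed.

(* [lra] inspects the whole context, which is large in the proofs below. *)
Ltac forget := clear - C_capacity PF rho_int Y_ge0 Y_gt0 p_sub nubar_ge0
  nu_gt0 traffic k_gt0 potential_lb B_ge1 ratio_ub eps_coercive lnB_ge0.

(* The time-averaged ratio stands for the instantaneous one: on the large
   coordinates it is close to the optimal ratio at the end of the window, and on
   the small ones the increments are negligible. *)
Lemma pf_window (tau : nat) (w : 'I_tau -> 'rV[R]_n) (a b : 'rV[R]_n)
    (m : 'I_n -> R) (Lam : pred 'I_n) (N theta theta' s K gamma : R) :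
  (0 < tau)%N -> 0 <= gamma ->
  0 < s <= 1 / 12 -> 6 * s * (1 + k) <= k -> 0 < theta <= 1 -> 0 <= theta' -> 1 <= K ->
  (forall r, 0 <= a ord0 r) -> (forall r, 0 <= b ord0 r) ->
  (forall j r, 0 <= w j ord0 r) ->
  (forall r, Lam r -> theta * N <= a ord0 r /\ theta * N <= b ord0 r) ->
  (forall r, ~~ Lam r -> a ord0 r <= theta' * N /\ b ord0 r <= theta' * N) ->
  (forall r, `|b ord0 r - a ord0 r| <= tau%:R) ->
  (forall j r, `|w j ord0 r - b ord0 r| <= tau%:R) ->
  0 < N -> N / 2 <= \sum_r b ord0 r <= 2 * N -> \sum_r a ord0 r <= 2 * N ->
  n%:R * theta' < 1 / 2 -> tau%:R <= theta * N / 2 ->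
  n%:R * (theta' * N + tau%:R) <= s ^+ 2 * (theta * N / 2) ->
  (forall r, b ord0 r - a ord0 r =
     tau%:R * gamma * net_flow p nubar nu (fun q => (\sum_j Y (w j) q) / tau%:R) r + m r) ->
  L b - L a <=
    n%:R * N * (theta' * (ln B + ln K + (ln B - ln (s * theta / 2))) + 2 / K)
    + 6 * s * n%:R * tau%:R - tau%:R * gamma * eps
    + (ln B - ln (s * theta / 2)) * \sum_r `|m r|.
Proof.
move=> tau0 gamma0 /andP[s0 s12] sk /andP[th0 th1] th'0 K1 a0 b0 w0 hL hS ba wb N0.
move=> /andP[bN bN2] aN nth' tauN small flow.
have tau1 : 0 < tau%:R :> R by rewrite ltr0n.
have thN : 0 < theta * N by rewrite mulr_gt0.
(* The mixing weight keeps the logarithms bounded by [G]. It is small against the reference ratios,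
   which are at least [theta / 2], so that mixing moves the quotient [yeta / z] by at most about
   [s]. *)
set eta := s * theta / 2.
have eta0 : 0 < eta by rewrite divr_gt0 ?mulr_gt0.
have eta1 : eta <= 1 by rewrite /eta; nra.
set G := ln B - ln eta.
have G0 : 0 <= G by rewrite subr_ge0; apply: le_trans lnB_ge0; exact: ln_le0.
pose ybar q := (\sum_j Y (w j) q) / tau%:R.
pose yeta q := (1 - eta) * ybar q + eta.
have ybar_ge0 q : 0 <= ybar q.
  by apply: divr_ge0; [apply: sumr_ge0 => j _; exact: Y_ge0|exact: ltW].
have ybarB q : ybar q <= B.
  rewrite ler_pdivrMr //; apply: (@le_trans _ _ (\sum_(j < tau) B)).
    by apply: ler_sum => j _; exact: ratio_ub.
  by rewrite sumr_const card_ord mulr_natr.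
have yeta_ge q : eta <= yeta q by rewrite lerDr mulr_ge0 // subr_ge0.
have yetaB q : yeta q <= B.
  have : (1 - eta) * ybar q <= (1 - eta) * B by rewrite ler_wpM2l // subr_ge0.
  have : eta * 1 <= eta * B by rewrite ler_pM2l.
  rewrite /yeta; lra.
have yeta_gt0 q : 0 < yeta q by exact: lt_le_trans (yeta_ge q).
have lnyeta q : `|ln (yeta q)| <= G.
  by apply: ln_bound_abs; rewrite ?eta0 ?eta1 ?yeta_ge ?yetaB.
pose bL := restrict_vec Lam b.
pose aL := restrict_vec Lam a.
have bL0 r : 0 <= bL ord0 r by exact: restrict_vec_ge0.
have aL0 r : 0 <= aL ord0 r by exact: restrict_vec_ge0.
have bLE r : Lam r -> bL ord0 r = b ord0 r by rewrite mxE => ->.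
pose z := Y bL.
have z0 r : Lam r -> 0 < z r.
  by move=> Lr; apply: Y_gt0 => //; rewrite bLE //; apply: lt_le_trans (hL r Lr).2.
(* All states of the window are compared with a single reference, the end state cut to its large
   coordinates; the quotients can then be averaged over the window. *)
have close j r : Lam r -> 1 - 2 * s <= Y (w j) r / z r <= 1 + 2 * s.
  apply: (@pf_ratio_close Lam (w j) bL (theta * N / 2)) => //.
  - by move=> t Lt; rewrite mxE (negbTE Lt).
  - move=> t Lt; have [_ bt] := hL t Lt; have := wb j t; rewrite ler_norml => /andP[wt _].
    move: bt wt tauN; forget; lra.
  - by move=> t Lt; rewrite bLE //; have [_ bt] := hL t Lt; move: bt thN; forget; lra.
  - by rewrite divr_gt0.
  - by move: s0 s12; forget => s0 s12; apply/andP; split; lra.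
  - apply: le_trans small.
    have -> : n%:R * (theta' * N + tau%:R) = \sum_(r < n) (theta' * N + tau%:R).
      by rewrite sumr_const card_ord mulr_natl.
    rewrite [leRHS](bigID Lam) /= [leLHS]addrC lerD //; apply: ler_sum => t Lt.
      by rewrite bLE //; apply: le_trans (wb j t) _; rewrite lerDr mulr_ge0 // ltW.
    have [_ bt] := hS t Lt; have := wb j t; rewrite ler_norml => /andP[_ wt].
    by move: bt wt; forget; lra.
have zlow r : Lam r -> theta / 2 <= z r.
  move=> Lr; have sb : \sum_t bL ord0 t <= 2 * N.
    by apply: le_trans bN2; apply: ler_sum => t _; rewrite mxE; case: ifP.
  have := pf_ratio_ge C_capacity PF rho_int r bL0; rewrite -/(z r) bLE // => bz.
  have [_ bt] := hL r Lr.
  have zN : z r * (\sum_t bL ord0 t) <= z r * (2 * N) by rewrite ler_pM2l // z0.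
  rewrite -(ler_pM2r N0); move: bz zN bt; forget; lra.
have yz r : Lam r -> 1 - 3 * s <= yeta r / z r <= 1 + 3 * s.
  move=> Lr; have zr := z0 r Lr.
  have ybz : ybar r / z r = (\sum_j (Y (w j) r / z r)) / tau%:R.
    by rewrite /ybar -mulr_suml; ring.
  have lo : 1 - 2 * s <= ybar r / z r.
    rewrite ybz ler_pdivlMr // mulr_natr -[X in _ *+ X]card_ord -sumr_const.
    by apply: ler_sum => j _; have /andP[] := close j r Lr.
  have hi : ybar r / z r <= 1 + 2 * s.
    rewrite ybz ler_pdivrMr // mulr_natr -[X in _ *+ X]card_ord -sumr_const.
    by apply: ler_sum => j _; have /andP[] := close j r Lr.
  have ez : eta / z r <= s.
    rewrite ler_pdivrMr // /eta -mulrA ler_pM2l //; exact: zlow.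
  have ez0 : 0 <= eta / z r by rewrite divr_ge0 // ltW.
  have etas : eta <= s by rewrite /eta; move: th0 th1 s0; forget; nra.
  have -> : yeta r / z r = (1 - eta) * (ybar r / z r) + eta / z r.
    by rewrite /yeta; ring.
  move: lo hi ez ez0; move: (ybar r / z r) (eta / z r) => u v lo hi ez ez0.
  by move: lo hi ez ez0 etas eta0 s0 s12 eta1; forget => lo hi ez ez0 etas eta0 s0 s12 eta1; apply/andP; split; nra.
have lnz r : Lam r -> `|ln (z r) - ln (yeta r)| <= 6 * s.
  move=> Lr; apply: ln_close; [by rewrite ltW|exact: yeta_gt0|exact: z0|exact: yz].
(* Otherwise every logarithm in [L bL] would lie below [ln (1 + k)], against the coercivity of [L].
   The condition [6 * s * (1 + k) <= k] then leaves [yeta r0 >= 1 + k / 2]. *)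
have [r0 Lr0 zr0] : exists2 r, Lam r & 1 + k <= z r.
  apply: contrapT => nz.
  have zk r : Lam r -> z r < 1 + k.
    by move=> Lr; rewrite ltNge; apply/negP => ?; apply: nz; exists r.
  have sumb : 0 < \sum_r bL ord0 r.
    rewrite lt_neqAle sumr_ge0 // andbT; apply/eqP => e.
    have bsm r : b ord0 r <= theta' * N.
      have [Lr|Lr] := boolP (Lam r); last by have [] := hS r Lr.
      have : bL ord0 r = 0.
        move/esym: e => /psumr_eq0P; apply => //.
      have [_] := hL r Lr; rewrite bLE // => h1 h2; move: h1; rewrite h2; move: thN; forget; lra.
    have : \sum_r b ord0 r <= n%:R * (theta' * N).
      rewrite mulr_natl -[X in _ *+ X]card_ord -sumr_const; exact: ler_sum.
    have : n%:R * (theta' * N) < 1 / 2 * N by rewrite mulrA ltr_pM2r.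
    move: bN; forget; lra.
  have := potential_lb bL0; rewrite leNgt => /negP; apply.
  rewrite mulr_sumr /pf_potential.
  have [r rb] : exists r, 0 < bL ord0 r.
    apply: contrapT => nb; move: sumb; rewrite big1 ?ltxx // => r _.
    apply/eqP; rewrite eq_le bL0 andbT leNgt; apply/negP => ?; apply: nb.
    by exists r.
  have LbL t : 0 < bL ord0 t -> Lam t.
    by rewrite mxE; case: ifP => //; rewrite ltxx.
  have lnlt t : 0 < bL ord0 t -> ln (Y bL t) < ln (1 + k).
    move=> bt; rewrite ltr_ln ?posrE ?zk ?LbL ?addr_gt0 //.
    by apply: z0; exact: LbL.
  rewrite [ltLHS](bigD1 r) //= [ltRHS](bigD1 r) //= ltr_leD //.
    by rewrite mulrC ltr_pM2r // lnlt.
  apply: ler_sum => t _; have := bL0 t; rewrite le_eqVlt => /orP[/eqP <-|bt].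
    by rewrite mul0r mulr0.
  by rewrite mulrC ler_pM2r // ltW // lnlt.
have diss : eps <= dissipation p nubar nu yeta.
  apply: (@eps_coercive _ r0); have /andP[+ _] := yz r0 Lr0.
  rewrite ler_pdivlMr ?z0 // => h; apply: le_trans h.
  have : (1 - 3 * s) * (1 + k) <= (1 - 3 * s) * z r0 by rewrite ler_wpM2l //; move: s12; forget; lra.
  move: sk; forget; lra.
(* Mixing multiplied the flow by [1 - eta]; dividing by this factor, which is at most 1, only
   strengthens a negative bound. *)
have ent : \sum_r ln (yeta r) * net_flow p nubar nu ybar r <= - eps.
  have := entropy_production p_sub nubar_ge0 nu_gt0 traffic yeta_gt0.
  have -> : \sum_r ln (yeta r) * net_flow p nubar nu yeta r =
      (1 - eta) * \sum_r ln (yeta r) * net_flow p nubar nu ybar r.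
    rewrite mulr_sumr; apply: eq_bigr => r _.
    by rewrite /yeta (net_flow_mix traffic); ring.
  have d0 : 0 <= dissipation p nubar nu yeta by exact: dissipation_ge0.
  set E := \sum_r _ => hE; rewrite leNgt; apply/negP => bad.
  have : (1 - eta) * (- dissipation p nubar nu yeta) < (1 - eta) * E.
    rewrite ltr_pM2l; first by move: bad diss; forget; lra.
    by rewrite /eta; move: th0 th1 s0 s12; forget; nra.
  have : eta * dissipation p nubar nu yeta >= 0 by rewrite mulr_ge0 // ltW.
  move: hE; forget; lra.
(* The difference [L b - L a] is split at the two restricted states. Between them the subgradient at
   [bL] applies; its logarithms are exchanged for those of [yeta], and the small coordinates are put
   back so that the full entropy sum appears. *)
have partA : L b - L bL <= n%:R * (theta' * N * ln B).
  by apply: potential_sub_restrict => // [r /hS[]|]; rewrite // mulr_ge0 // ltW.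
have partC : L aL - L a <= n%:R * (2 * N / K + theta' * N * ln K).
  by apply: potential_restrict_sub => // [r /hS[]|]; rewrite // mulr_ge0 // ltW.
have partB : L bL - L aL <= \sum_(r | Lam r) (b ord0 r - a ord0 r) * ln (z r).
  apply: le_trans (pf_potential_sub_le C_capacity PF rho_int aL0 bL0 _) _.
    move=> r; rewrite !mxE; case: ifPn => // Lr _.
    by apply: lt_le_trans (hL r Lr).2.
  rewrite (bigID Lam) /= [X in _ + X]big1 ?addr0.
    by apply: ler_sum => r Lr; rewrite !mxE Lr.
  by move=> r Lr; rewrite !mxE (negbTE Lr) subrr mul0r.
have partD : \sum_(r | Lam r) (b ord0 r - a ord0 r) * ln (z r) <=
    \sum_r (b ord0 r - a ord0 r) * ln (yeta r) +
    n%:R * (6 * s * tau%:R + theta' * N * G).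
  rewrite mulr_natl -[X in _ *+ X]card_ord -sumr_const -big_split /=.
  rewrite [leRHS](bigID Lam) /= ler_wpDr //.
    apply: sumr_ge0 => r Lr; have [ar br] := hS r Lr.
    have dab : `|b ord0 r - a ord0 r| <= theta' * N.
      have ar0 := a0 r; have br0 := b0 r.
      by rewrite ler_norml; move: ar0 br0 ar br; forget => ar0 br0 ar br; apply/andP; split; lra.
    have : `|(b ord0 r - a ord0 r) * ln (yeta r)| <= theta' * N * G.
      by rewrite normrM ler_pM.
    rewrite ler_norml => /andP[lo _].
    have : 0 <= 6 * s * tau%:R by rewrite !mulr_ge0 // ltW.
    move: lo; forget; lra.
  apply: ler_sum => r Lr.
  have : `|(b ord0 r - a ord0 r) * (ln (z r) - ln (yeta r))| <= tau%:R * (6 * s).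
    by rewrite normrM ler_pM // lnz.
  rewrite mulrBr ler_norml => /andP[_ up].
  have : 0 <= theta' * N * G by rewrite !mulr_ge0 // ltW.
  move: up; forget; lra.
have partE : \sum_r (b ord0 r - a ord0 r) * ln (yeta r) <=
    - (tau%:R * gamma * eps) + G * \sum_r `|m r|.
  have -> : \sum_r (b ord0 r - a ord0 r) * ln (yeta r) =
      tau%:R * gamma * (\sum_r ln (yeta r) * net_flow p nubar nu ybar r) +
      \sum_r m r * ln (yeta r).
    rewrite mulr_sumr -big_split /=; apply: eq_bigr => r _.
    by rewrite flow -/ybar; ring.
  apply: lerD.
    by rewrite -mulrN ler_wpM2l // mulr_ge0 // ltW.
  rewrite mulr_sumr; apply: ler_sum => r _; apply: le_trans (ler_norm _) _.
  by rewrite normrM mulrC ler_wpM2r.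
have -> : n%:R * N * (theta' * (ln B + ln K + G) + 2 / K) =
  n%:R * (theta' * N * ln B) + n%:R * (2 * N / K + theta' * N * ln K) +
  n%:R * (theta' * N * G) by ring.
move: partA partB partC partD partE; rewrite mulrDr; forget; lra.
Qed.

End window.

(** * Moves of the network and its uniformized chain *)

Lemma big_option {V : nmodType} {T : finType} (F : option T -> V) :
  \sum_o F o = F None + \sum_t F (Some t).
Proof.
rewrite (bigD1 None) //=; congr (_ + _).
rewrite (reindex_omap Some id) //=; last by case.
by apply: eq_bigl => t; rewrite eqxx.
Qed.

(** With [q = B / y], the logarithm [ln q] is twice that of the square root of [q], whence
    [1 + ln q] is at most twice this root. *)
Lemma sqr_ln_bound {R : realType} (B y : R) : 0 < y <= B ->
  y * (1 + ln B - ln y) ^+ 2 <= 4 * B.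
Proof.
move=> /andP[y0 yB]; have B0 : 0 < B by exact: lt_le_trans yB.
have q1 : 1 <= B / y by rewrite ler_pdivlMr // mul1r.
have q0 : 0 < B / y by exact: lt_le_trans q1.
rewrite -addrA -ln_div2 //.
have lnq0 : 0 <= ln (B / y) by exact: ln_ge0.
have sq0 : 0 < Num.sqrt (B / y) by rewrite sqrtr_gt0.
have -> : 4 * B = y * (2 * Num.sqrt (B / y)) ^+ 2.
  by rewrite exprMn sqr_sqrtr ?ltW //; field; rewrite gt_eqF.
rewrite ler_pM2l //; apply: lerXn2r.
- by rewrite nnegrE addr_ge0.
- by rewrite nnegrE mulr_ge0 // ltW.
have : ln (B / y) = 2 * ln (Num.sqrt (B / y)).
  by rewrite -[in LHS](sqr_sqrtr (ltW q0)) lnXn // mulr_natl.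
have := ln_le_sub1 sq0; lra.
Qed.

Section moves.
Context {n : nat}.

Definition move : finType := (option 'I_n * option 'I_n)%type.

(* [(Some r, Some s)] is a routed user, [None] stands for the outside world, and
   [(None, None)] is the idle move of the uniformized chain. *)
Definition move_user (x : state n) (a : move) : state n :=
  let x' := if a.1 is Some r then del_user x r else x in
  if a.2 is Some s then add_user x' s else x'.

Definition users (x : state n) : nat := (\sum_r x r)%N.

Implicit Types (x : state n) (a : move) (r : 'I_n) (s : seq move).

Lemma move_user_near x a r :
  ((x r <= (move_user x a r).+1) && (move_user x a r <= (x r).+1))%N.
Proof.
case: a => -[i|] [j|] /=; rewrite /move_user /= ?ffunE ?ffunE;
  do ?[case: eqP => _ /=]; lia.
Qed.

Lemma sum_indic (r : 'I_n) : (\sum_i (i == r) = 1)%N.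
Proof.
by rewrite (bigD1 r) //= eqxx big1 ?addn0 // => i /negbTE ->.
Qed.

Lemma users_add x r : users (add_user x r) = (users x).+1.
Proof.
rewrite /users; under eq_bigr do rewrite ffunE.
by rewrite big_split /= sum_indic addn1.
Qed.

Lemma users_del x r : (users (del_user x r) <= users x <= (users (del_user x r)).+1)%N.
Proof.
apply/andP; split.
  by apply: leq_sum => i _; rewrite ffunE leq_subr.
rewrite -(users_add _ r); apply: leq_sum => i _; rewrite !ffunE; lia.
Qed.

Lemma users_move x a :
  ((users x <= (users (move_user x a)).+1) && (users (move_user x a) <= (users x).+1))%N.
Proof.
case: a => -[i|] [j|] /=; rewrite /move_user /= ?users_add ?leqnn ?leqnSn //.
- by have := users_del x i; lia.
- by have := users_del x i; lia.
- by rewrite leqW.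
Qed.

Lemma run_near x s r :
  ((x r <= run move_user x s r + size s) && (run move_user x s r <= x r + size s))%N.
Proof.
elim: s x => [|a s IH] x /=; first by rewrite addn0 leqnn.
rewrite -/(run move_user (move_user x a) s).
have /andP[h1 h2] := IH (move_user x a); have /andP[h3 h4] := move_user_near x a r.
apply/andP; split.
  by apply: leq_trans h3 _; rewrite addnS ltnS; exact: h1.
by apply: leq_trans h2 _; rewrite addnS -addSn leq_add2r; exact: h4.
Qed.

Lemma users_run x s :
  ((users x <= users (run move_user x s) + size s) &&
   (users (run move_user x s) <= users x + size s))%N.
Proof.
elim: s x => [|a s IH] x /=; first by rewrite addn0 leqnn.
rewrite -/(run move_user (move_user x a) s).
have /andP[h1 h2] := IH (move_user x a); have /andP[h3 h4] := users_move x a.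
apply/andP; split.
  by apply: leq_trans h3 _; rewrite addnS ltnS; exact: h1.
by apply: leq_trans h2 _; rewrite addnS -addSn leq_add2r; exact: h4.
Qed.

Lemma run_take_near x s j r :
  ((run move_user x (take j s) r <= run move_user x s r + size s) &&
   (run move_user x s r <= run move_user x (take j s) r + size s))%N.
Proof.
have -> : run move_user x s = run move_user (run move_user x (take j s)) (drop j s).
  by rewrite /run -foldl_cat cat_take_drop.
have /andP[h1 h2] := run_near (run move_user x (take j s)) (drop j s) r.
have h3 : (size (drop j s) <= size s)%N by rewrite size_drop leq_subr.
apply/andP; split.
  by apply: leq_trans h1 _; rewrite leq_add2l.
by apply: leq_trans h2 _; rewrite leq_add2l.
Qed.

Lemma big_move {V : nmodType} (F : move -> V) :
  \sum_a F a = F (None, None) + \sum_r F (None, Some r) +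
    (\sum_r F (Some r, None) + \sum_r \sum_s F (Some r, Some s)).
Proof.
rewrite (eq_bigr (fun a => F (a.1, a.2))); last by case.
rewrite -(pair_bigA _ (fun i j => F (i, j))) /= big_option big_option.
by congr (_ + _); rewrite -big_split /=; apply: eq_bigr => r _; rewrite big_option.
Qed.

Lemma state_vec_ge0 {R : realType} (x : state n) r : 0 <= state_vec R x ord0 r.
Proof. by rewrite mxE. Qed.

Lemma sum_state_vec {R : realType} (x : state n) :
  \sum_r state_vec R x ord0 r = (users x)%:R.
Proof. by rewrite /users natr_sum; apply: eq_bigr => r _; rewrite mxE. Qed.

End moves.

Arguments move n : clear implicits.

Section network.
Context {R : realType} {n : nat} (C : set 'rV[R]_n) (lamPF : 'rV[R]_n -> 'rV[R]_n)
  (rho : 'I_n -> R).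
Hypothesis C_capacity : capacity_set C.
Hypothesis PF : forall x : 'rV[R]_n, (forall r, 0 <= x ord0 r) ->
  is_pf_allocation C x (lamPF x).
Hypothesis rho_int : interior C (\row_r rho r).
Context (p : 'M[R]_n) (nubar nu : 'I_n -> R).
Hypothesis p_sub : substochastic p.
Hypothesis nubar_ge0 : forall r, 0 <= nubar r.
Hypothesis nu_gt0 : forall r, 0 < nu r.

Let p0 r s : 0 <= p r s. Proof. by case: p_sub. Qed.
Let p1 r : 0 <= 1 - \sum_s p r s. Proof. by rewrite subr_ge0; case: p_sub. Qed.
Let nu0 r : 0 <= nu r. Proof. exact: ltW. Qed.

Implicit Types (x : state n) (a : move n).

Definition ratio x r : R := pf_ratio lamPF rho (state_vec R x) r.

Definition potential x : R := pf_potential lamPF rho (state_vec R x).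

(** For [rho r = nu r / mu r], the product [nu r * ratio x r] is the service rate [mu r] times the
    allocation. Written this way, the drift is [net_flow] at the ratios. *)
Definition move_rate x a : R :=
  match a with
  | (None, Some r) => nubar r
  | (Some r, Some s) => nu r * ratio x r * p r s
  | (Some r, None) => nu r * ratio x r * (1 - \sum_s p r s)
  | (None, None) => 0
  end.

Lemma ratio_ge0 x r : 0 <= ratio x r.
Proof. by apply: (pf_ratio_ge0 C_capacity PF rho_int); exact: state_vec_ge0. Qed.

Lemma ratio_gt0 x r : (0 < x r)%N -> 0 < ratio x r.
Proof.
move=> xr; apply: (pf_ratio_gt0 C_capacity PF rho_int); first exact: state_vec_ge0.
by rewrite mxE ltr0n.
Qed.

Lemma ratio_eq0 x r : x r = 0%N -> ratio x r = 0.
Proof.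
by move=> xr; apply: (pf_ratio_eq0 _ PF); [exact: state_vec_ge0|rewrite mxE xr].
Qed.

Lemma move_rate_ge0 x a : 0 <= move_rate x a.
Proof.
have nuy r : 0 <= nu r * ratio x r by apply: mulr_ge0 (nu0 r) (ratio_ge0 x r).
by case: a => -[r|] [s|] //=; exact: mulr_ge0.
Qed.

Lemma sum_move_rate x :
  \sum_a move_rate x a = \sum_r nubar r + \sum_r nu r * ratio x r.
Proof.
rewrite big_move /= add0r; congr (_ + _); rewrite -big_split /=.
by apply: eq_bigr => r _; rewrite -mulr_sumr; ring.
Qed.

Lemma move_rate_user x r o : x r = 0%N -> move_rate x (Some r, o) = 0.
Proof. by case: o => [s|] xr; rewrite /= ratio_eq0 // mulr0 mul0r. Qed.

Lemma move_rate_drift x r :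
  \sum_a move_rate x a * ((move_user x a r)%:R - (x r)%:R) =
  net_flow p nubar nu (ratio x) r.
Proof.
(* [del_user] truncates at zero, so the displacement is the expected one only if a user is present;
   otherwise the rate vanishes with the ratio. *)
have disp a : move_rate x a * ((move_user x a r)%:R - (x r)%:R) =
    move_rate x a * ((a.2 == Some r)%:R - (a.1 == Some r)%:R).
  case: a => -[i|] [j|]; rewrite /move_user /=.
  - have [xi|xi] := posnP (x i); first by have /= -> := move_rate_user (Some j) xi; rewrite !mul0r.
    congr (_ * _); rewrite !ffunE !(inj_eq Some_inj) ![r == _]eq_sym natrD.
    have [<-|_] := eqVneq i r; last by rewrite /= subn0; ring.
    by rewrite /= natrB //; ring.
  - have [xi|xi] := posnP (x i); first by have /= -> := move_rate_user None xi; rewrite !mul0r.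
    congr (_ * _); rewrite !ffunE !(inj_eq Some_inj) ![r == _]eq_sym.
    have [<-|_] := eqVneq i r; last by rewrite /= subn0; ring.
    by rewrite /= natrB //; ring.
  - by rewrite !ffunE (inj_eq Some_inj) [r == _]eq_sym natrD; ring.
  - by rewrite !mul0r.
rewrite (eq_bigr _ (fun a _ => disp a)) big_move /=.
rewrite /net_flow subrr mulr0 add0r.
have -> : \sum_i nubar i * ((Some i == Some r)%:R - (None == Some r)%:R) = nubar r.
  rewrite (bigD1 r) //= eqxx big1 ?addr0 ?subr0 ?mulr1 // => i /negbTE ir.
  by rewrite (inj_eq Some_inj) ir subrr mulr0.
have -> : \sum_i nu i * ratio x i * (1 - \sum_s p i s) *
    ((None == Some r)%:R - (Some i == Some r)%:R) =
    - (nu r * ratio x r * (1 - \sum_s p r s)).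
  rewrite (bigD1 r) //= eqxx [X in _ + X = _]big1 ?addr0 => [|i /negbTE ir].
    by rewrite sub0r mulrN1.
  by rewrite (inj_eq Some_inj) ir subrr mulr0.
have -> : \sum_i \sum_j nu i * ratio x i * p i j *
    ((Some j == Some r)%:R - (Some i == Some r)%:R) =
    \sum_s nu s * ratio x s * p s r - nu r * ratio x r * \sum_s p r s.
  under eq_bigr => i _ do under eq_bigr => j _ do rewrite mulrBr.
  under eq_bigr => i _ do rewrite sumrB.
  rewrite sumrB; congr (_ - _).
    apply: eq_bigr => i _; rewrite (bigD1 r) //= eqxx mulr1 big1 ?addr0 // => j /negbTE jr.
    by rewrite (inj_eq Some_inj) jr mulr0.
  rewrite (bigD1 r) //= [X in _ + X = _]big1 ?addr0 => [|i /negbTE ir].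
    by rewrite mulr_sumr; apply: eq_bigr => j _; rewrite eqxx mulr1.
  by rewrite big1 // => j _; rewrite (inj_eq Some_inj) ir mulr0.
ring.
Qed.

Context (B U : R).
Hypothesis B_ge1 : 1 <= B.
Hypothesis ratio_ub : forall (x : 'rV[R]_n) r, (forall r, 0 <= x ord0 r) ->
  pf_ratio lamPF rho x r <= B.
Hypothesis U_gt0 : 0 < U.
Hypothesis U_ge : forall x, \sum_a move_rate x a <= U.

Let lnB_ge0 : 0 <= ln B. Proof. exact: ln_ge0. Qed.

Definition move_prob x a : R :=
  move_rate x a / U +
  (if a == (None, None) then 1 - (\sum_b move_rate x b) / U else 0).

Lemma move_prob_ge0 x a : 0 <= move_prob x a.
Proof.
rewrite addr_ge0 //; first by rewrite divr_ge0 ?move_rate_ge0 // ltW.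
by case: ifP => // _; rewrite subr_ge0 ler_pdivrMr // mul1r.
Qed.

Lemma sum_move_prob x : \sum_a move_prob x a = 1.
Proof.
rewrite big_split /= -mulr_suml -big_mkcond /= big_pred1_eq.
by rewrite addrCA subrr addr0.
Qed.

Lemma sum_move_prob_mul x (f : move n -> R) :
  \sum_a move_prob x a * f a =
  f (None, None) + (\sum_a move_rate x a * (f a - f (None, None))) / U.
Proof.
have -> : \sum_a move_prob x a * f a =
    \sum_a move_prob x a * f (None, None) +
    \sum_a move_prob x a * (f a - f (None, None)).
  by rewrite -big_split /=; apply: eq_bigr => a _; ring.
rewrite -mulr_suml sum_move_prob mul1r mulr_suml; congr (_ + _).
apply: eq_bigr => a _; rewrite /move_prob; case: eqP => [->|_]; last by ring.
by rewrite subrr !mulr0 mul0r.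
Qed.

Lemma net_flow_le x r : `|net_flow p nubar nu (ratio x) r| <= U.
Proof.
have in0 : 0 <= nubar r + \sum_s nu s * ratio x s * p s r.
  rewrite addr_ge0 ?sumr_ge0 // => s _; apply: mulr_ge0 => //.
  exact: mulr_ge0 (ratio_ge0 _ _).
have nuy s : 0 <= nu s * ratio x s by exact: mulr_ge0 (ratio_ge0 _ _).
have out0 : 0 <= nu r * ratio x r by [].
have tot := U_ge x; rewrite sum_move_rate in tot.
have outU : nu r * ratio x r <= U.
  apply: le_trans tot; rewrite [X in _ + X](bigD1 r) //= addrCA lerDl addr_ge0 //.
    exact: sumr_ge0.
  exact: sumr_ge0.
have inU : nubar r + \sum_s nu s * ratio x s * p s r <= U.
  apply: le_trans tot; apply: lerD.
    by rewrite (bigD1 r) //= lerDl sumr_ge0.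
  apply: ler_sum => s _; rewrite -[leRHS]mulr1; apply: ler_wpM2l => //.
  apply: (@le_trans _ _ (\sum_t p s t)); last by rewrite -subr_ge0.
  by rewrite (bigD1 r) //= lerDl sumr_ge0.
by rewrite /net_flow ler_norml; apply/andP; split; lra.
Qed.

(** The increment of a coordinate minus its conditional mean: a martingale increment of the
    uniformized chain. *)
Definition displacement r x a : R :=
  (move_user x a r)%:R - (x r)%:R - net_flow p nubar nu (ratio x) r / U.

Lemma displacement_mean r x : \sum_a move_prob x a * displacement r x a = 0.
Proof.
have -> : \sum_a move_prob x a * displacement r x a =
    \sum_a move_prob x a * ((move_user x a r)%:R - (x r)%:R) -
    (\sum_a move_prob x a) * (net_flow p nubar nu (ratio x) r / U).
  by rewrite mulr_suml -sumrB; apply: eq_bigr => a _; rewrite /displacement; ring.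
rewrite sum_move_prob_mul sum_move_prob mul1r /move_user /= subrr add0r.
under eq_bigr do rewrite subr0.
by rewrite move_rate_drift subrr.
Qed.

Lemma displacement_sqr_le r x a : displacement r x a ^+ 2 <= 4.
Proof.
have h1 : `|(move_user x a r)%:R - (x r)%:R| <= 1 :> R.
  have /andP[near1 near2] := move_user_near x a r.
  have : (x r)%:R <= (move_user x a r).+1%:R :> R by rewrite ler_nat.
  have : (move_user x a r)%:R <= (x r).+1%:R :> R by rewrite ler_nat.
  by rewrite -!natr1 ler_norml => ? ?; apply/andP; split; lra.
have h2 : `|net_flow p nubar nu (ratio x) r / U| <= 1.
  by rewrite normrM normfV (gtr0_norm U_gt0) ler_pdivrMr // mul1r net_flow_le.
have h3 : `|displacement r x a| <= 2.
  by apply: le_trans (ler_normB _ _) _; lra.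
rewrite -real_normK ?num_real // (_ : 4 = 2 ^+ 2); last by ring.
by apply: lerXn2r; rewrite ?nnegrE.
Qed.

Lemma potential_add x s : potential (add_user x s) - potential x <= ln B.
Proof.
apply: le_trans (pf_potential_sub_le C_capacity PF rho_int _ _ _) _.
- exact: state_vec_ge0.
- exact: state_vec_ge0.
- move=> r; rewrite !mxE !ltr0n ffunE => h; exact: ltn_addr.
rewrite (bigD1 s) //= big1 ?addr0 => [|r /negbTE rs]; last first.
  by rewrite !mxE ffunE rs addn0 subrr mul0r.
rewrite !mxE ffunE eqxx natrD addrC addKr mul1r.
have yp : 0 < ratio (add_user x s) s by apply: ratio_gt0; rewrite ffunE eqxx addn1.
have B0 : 0 < B by exact: lt_le_trans B_ge1.
by rewrite ler_ln; [apply: ratio_ub; exact: state_vec_ge0|exact: yp|exact: B0].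
Qed.

Lemma potential_del x r : (0 < x r)%N ->
  potential (del_user x r) - potential x <= 1 - ln (ratio x r).
Proof.
move=> xr; apply: le_trans (pf_potential_remove C_capacity PF rho_int _ _) _.
- exact: state_vec_ge0.
- by move=> s; rewrite !mxE ler0n ler_nat ffunE leq_subr.
rewrite (bigD1 r) //= big1 ?addr0 => [|s /negbTE sr]; last first.
  by rewrite !mxE ffunE sr subn0 subrr mul0r.
by rewrite !mxE ffunE eqxx natrB // opprB addrCA subrr addr0 mul1r.
Qed.

Definition gain x a : R := Num.max 0 (potential (move_user x a) - potential x).

Lemma gain_ge0 x a : 0 <= gain x a.
Proof. by rewrite le_max lexx. Qed.

(* A coordinate with a tiny service ratio is costly to decrease, but this
   happens at a proportionally small rate: [y (ln y)^2] is bounded. *)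
Lemma gain_second_moment : exists2 D, 0 < D &
  forall x, \sum_a move_prob x a * gain x a ^+ 2 <= D.
Proof.
have B0 : 0 < B by exact: lt_le_trans B_ge1.
have gain_le x a b : 0 <= b -> potential (move_user x a) - potential x <= b ->
    gain x a ^+ 2 <= b ^+ 2.
  move=> b0 h; apply: lerXn2r; rewrite ?nnegrE ?gain_ge0 //.
  by rewrite ge_max b0.
have userE x r o : nu r * ratio x r * gain x (Some r, o) ^+ 2 <= nu r * (4 * B).
  rewrite -mulrA ler_wpM2l //.
  have [xr|xr] := posnP (x r).
    by rewrite ratio_eq0 // mul0r mulr_ge0 // ltW.
  have yr : 0 < ratio x r by exact: ratio_gt0.
  have yB : ratio x r <= B by apply: ratio_ub; exact: state_vec_ge0.
  apply: le_trans (@sqr_ln_bound R B (ratio x r) _); last by rewrite yr.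
  rewrite ler_pM2l //; apply: gain_le.
    have : ln (ratio x r) <= ln B by rewrite ler_ln ?posrE.
    lra.
  have := potential_del xr; case: o => [s|] /=; rewrite /move_user /=; last first.
    by move: lnB_ge0; lra.
  by have := potential_add (del_user x r) s; lra.
exists ((\sum_r nubar r * ln B ^+ 2 + \sum_r nu r * (4 * B)) / U + 1).
  rewrite ltr_wpDl // divr_ge0 ?(ltW U_gt0) // addr_ge0 ?sumr_ge0 // => r _.
    by rewrite mulr_ge0 ?sqr_ge0.
  by rewrite !mulr_ge0 // ltW.
move=> x; rewrite sum_move_prob_mul.
have -> : gain x (None, None) = 0.
  by rewrite /gain /move_user /= subrr maxxx.
rewrite expr0n /= add0r.
apply: (@le_trans _ _ ((\sum_r nubar r * ln B ^+ 2 + \sum_r nu r * (4 * B)) / U)); last first.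
  by rewrite lerDl.
rewrite ler_pM2r ?invr_gt0 //.
under eq_bigr do rewrite subr0.
rewrite big_move /= mul0r add0r; apply: lerD.
  apply: ler_sum => r _; rewrite ler_wpM2l //; apply: gain_le => //.
  exact: potential_add.
rewrite -big_split /=; apply: ler_sum => r _.
have -> : nu r * (4 * B) = nu r * (4 * B) * (1 - \sum_s p r s) +
    \sum_s nu r * (4 * B) * p r s by rewrite -mulr_sumr; ring.
apply: lerD.
  by rewrite mulrAC ler_wpM2r.
by apply: ler_sum => s _; rewrite mulrAC ler_wpM2r.
Qed.

Hypothesis traffic : forall r, nu r = nubar r + \sum_s p s r * nu s.
Context (k eps : R).
Hypothesis k_gt0 : 0 < k.
Hypothesis potential_lb : forall x : 'rV[R]_n, (forall r, 0 <= x ord0 r) ->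
  ln (1 + k) * \sum_r x ord0 r <= pf_potential lamPF rho x.
Hypothesis eps_gt0 : 0 < eps.
Hypothesis eps_coercive : forall (y : 'I_n -> R) r,
  1 + k / 2 <= y r -> eps <= dissipation p nubar nu y.

Lemma sum_net_flow (tau : nat) (y : 'I_tau -> 'I_n -> R) r : (0 < tau)%N ->
  \sum_j net_flow p nubar nu (y j) r =
  tau%:R * net_flow p nubar nu (fun q => (\sum_j y j q) / tau%:R) r.
Proof.
move=> tau0; have tau1 : tau%:R != 0 :> R by rewrite pnatr_eq0 -lt0n.
rewrite /net_flow sumrB big_split /= sumr_const card_ord -mulr_sumr exchange_big /=.
have -> : \sum_s nu s * ((\sum_j y j s) / tau%:R) * p s r =
    (\sum_s \sum_j nu s * y j s * p s r) / tau%:R.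
  rewrite mulr_suml; apply: eq_bigr => s _.
  by rewrite -mulr_suml -mulr_sumr; field.
by rewrite -mulr_natl; field.
Qed.

Lemma displacement_path x s r : (0 < size s)%N ->
  (run (@move_user n) x s r)%:R - (x r)%:R =
  (size s)%:R * U^-1 * net_flow p nubar nu (fun q =>
     (\sum_(j < size s) ratio (run (@move_user n) x (take j s)) q) / (size s)%:R) r
  + path_cost (@move_user n) (displacement r) x s :> R.
Proof.
move=> s0.
have -> : path_cost (@move_user n) (displacement r) x s =
    path_cost (@move_user n) (fun y a => 1 * ((move_user y a r)%:R - (y r)%:R) +
      (- U^-1) * net_flow p nubar nu (ratio y) r) x s.
  apply/le_anti/andP; split; apply: path_cost_le => y a; rewrite /displacement.
    by rewrite mul1r mulNr mulrC.
  by rewrite mul1r mulNr mulrC.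
rewrite path_cost_lin (path_cost_diff (@move_user n) (fun y => (y r)%:R)).
rewrite (path_cost_state (@move_user n) (fun y => net_flow p nubar nu (ratio y) r)).
rewrite (sum_net_flow (fun j => ratio (run (@move_user n) x (take j s)))) //.
ring.
Qed.

Ltac forget := clear - C_capacity PF rho_int p_sub nubar_ge0 nu_gt0 p0 p1 nu0
  B_ge1 ratio_ub U_gt0 U_ge lnB_ge0 traffic k_gt0 potential_lb eps_gt0
  eps_coercive.

Definition midsize (lo hi : R) x (r : 'I_n) : R := (lo < (x r)%:R < hi)%R%:R.

Lemma window_path (N theta theta' sg K A : R) (tau : nat) x s :
  (0 < tau)%N -> 0 < sg <= 1 / 12 -> 6 * sg * (1 + k) <= k ->
  0 < theta <= 1 -> 0 <= theta' -> 1 <= K -> 0 < A -> 0 < N ->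
  n%:R * theta' < 1 / 2 -> tau%:R <= theta * N / 2 -> tau%:R <= N / 8 ->
  theta' * N + tau%:R < theta * N ->
  n%:R * (theta' * N + tau%:R) <= sg ^+ 2 * (theta * N / 2) ->
  n%:R * N * (theta' * (ln B + ln K + (ln B - ln (sg * theta / 2))) + 2 / K)
    + 6 * sg * n%:R * tau%:R <= tau%:R * (eps / U / 2) ->
  3 / 4 * N <= (users x)%:R <= 5 / 4 * N -> size s = tau ->
  potential (run (@move_user n) x s) - potential x <=
    - (tau%:R * (eps / U / 2))
    + (ln B - ln (sg * theta / 2)) *
        \sum_r `|path_cost (@move_user n) (displacement r) x s|
    + (A + eps / U / 2) * tau%:R *
        (\sum_r (midsize (theta' * N) (theta * N) x r +
                 midsize (theta' * N) (theta * N) (run (@move_user n) x s) r))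
    + path_cost (@move_user n) (fun y a => gain y a ^+ 2 / A) x s.
Proof.
move=> tau0 sg12 sgk th01 th'0 K1 A0 N0 nth' tauth tau8 sep small err /andP[xlo xhi] ss.
set b := run _ x s; set e1 := eps / U / 2; set G := ln B - _.
have e10 : 0 < e1 by rewrite !divr_gt0.
have tau1 : 0 < tau%:R :> R by rewrite ltr0n.
have mid0 y r : 0 <= midsize (theta' * N) (theta * N) y r by [].
have G0 : 0 <= G.
  rewrite subr_ge0; apply: le_trans lnB_ge0; apply: ln_le0.
  by move: sg12 th01; forget => /andP[? ?] /andP[? ?]; nra.
have cost0 : 0 <= path_cost (@move_user n) (fun y a => gain y a ^+ 2 / A) x s.
  have := @path_cost_le R _ _ (@move_user n) (fun _ _ => 0) (fun y a => gain y a ^+ 2 / A) x s.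
  rewrite (path_cost_state (@move_user n) (fun=> 0)) big1 // => h.
  by apply: h => y a; rewrite divr_ge0 ?sqr_ge0 // ltW.
have m0 : 0 <= G * \sum_r `|path_cost (@move_user n) (displacement r) x s|.
  by rewrite mulr_ge0 // sumr_ge0.
have sum0 : 0 <= \sum_r (midsize (theta' * N) (theta * N) x r +
    midsize (theta' * N) (theta * N) b r).
  by rewrite sumr_ge0 // => r _; rewrite addr_ge0.
have [bad|good] := pselect (exists r, (theta' * N < (x r)%:R < theta * N) \/
    (theta' * N < (b r)%:R < theta * N)).
  have gap : potential b - potential x <=
      A * tau%:R + path_cost (@move_user n) (fun y a => gain y a ^+ 2 / A) x s.
    rewrite -(path_cost_diff (@move_user n) potential).
    apply: (@le_trans _ _ (path_cost (@move_user n)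
      (fun y a => A * 1 + 1 * (gain y a ^+ 2 / A)) x s)).
      apply: path_cost_le => y a; apply: (@le_trans _ _ (gain y a)).
        by rewrite le_max lexx orbT.
      rewrite mulr1 mul1r -subr_ge0.
      have -> : A + gain y a ^+ 2 / A - gain y a =
         ((A - gain y a) ^+ 2 + A * gain y a) / A by field; rewrite gt_eqF.
      by rewrite divr_ge0 ?addr_ge0 ?sqr_ge0 ?mulr_ge0 ?gain_ge0 // ltW.
    rewrite path_cost_lin mul1r lerD2r.
    by rewrite (path_cost_state (@move_user n) (fun=> 1)) sumr_const card_ord ss.
  have sum1 : 1 <= \sum_r (midsize (theta' * N) (theta * N) x r +
      midsize (theta' * N) (theta * N) b r).
    have [r hr] := bad; rewrite (bigD1 r) //= ler_wpDr //.
      by rewrite sumr_ge0 // => t _; rewrite addr_ge0.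
    by rewrite /midsize; case: hr => ->; rewrite ?lerDl ?lerDr.
  have : (A + e1) * tau%:R * 1 <= (A + e1) * tau%:R * \sum_r
      (midsize (theta' * N) (theta * N) x r + midsize (theta' * N) (theta * N) b r).
    by rewrite ler_wpM2l // mulr_ge0 ?addr_ge0 // ltW.
  move: gap m0; forget; lra.
have near r : `|(b r)%:R - (x r)%:R| <= tau%:R :> R.
  have /andP[h1 h2] := run_near x s r; rewrite ss in h1 h2.
  have : (x r)%:R <= (b r + tau)%:R :> R by rewrite ler_nat; exact: h1.
  have : (b r)%:R <= (x r + tau)%:R :> R by rewrite ler_nat; exact: h2.
  by rewrite !natrD ler_norml; forget => ? ?; apply/andP; split; lra.
pose Lam := [pred r | theta * N <= (x r)%:R].
have win : pf_potential lamPF rho (state_vec R b) - pf_potential lamPF rho (state_vec R x) <=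
    n%:R * N * (theta' * (ln B + ln K + G) + 2 / K)
    + 6 * sg * n%:R * tau%:R - tau%:R * U^-1 * eps
    + G * \sum_r `|path_cost (@move_user n) (displacement r) x s|.
  apply: (pf_window C_capacity PF rho_int p_sub nubar_ge0 nu_gt0 traffic k_gt0
    potential_lb B_ge1 ratio_ub eps_coercive (Lam := Lam) (theta := theta)
    (w := fun j => state_vec R (run (@move_user n) x (take j s))) tau0) => //.
  - by rewrite invr_ge0 ltW.
  - by move=> r; exact: state_vec_ge0.
  - by move=> r; exact: state_vec_ge0.
  - by move=> j r; exact: state_vec_ge0.
  - move=> r Lr; rewrite !mxE; split => //; rewrite leNgt; apply/negP => br.
    apply: good; exists r; right; rewrite br andbT.
    have := near r; rewrite ler_norml => /andP[nr _].
    by move: Lr => /= Lr'; move: nr Lr' sep; forget; lra.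
  - move=> r; rewrite /= -ltNge => xr; rewrite !mxE.
    have xs : (x r)%:R <= theta' * N.
      by rewrite leNgt; apply/negP => h; apply: good; exists r; left; rewrite h xr.
    split => //; rewrite leNgt; apply/negP => h; apply: good; exists r; right.
    rewrite h /=; have := near r; rewrite ler_norml => /andP[_ nr]; move: nr xs sep; forget; lra.
  - by move=> r; rewrite !mxE.
  - move=> j r; rewrite !mxE.
    have /andP[h1 h2] := run_take_near x s j r; rewrite ss in h1 h2.
    have : (run (@move_user n) x (take j s) r)%:R <= (b r + tau)%:R :> R.
      by rewrite ler_nat; exact: h1.
    have : (b r)%:R <= (run (@move_user n) x (take j s) r + tau)%:R :> R.
      by rewrite ler_nat; exact: h2.
    by rewrite !natrD ler_norml; forget => ? ?; apply/andP; split; lra.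
  - rewrite sum_state_vec; have /andP[h1 h2] := users_run x s; rewrite ss in h1 h2.
    have : (users x)%:R <= (users b + tau)%:R :> R by rewrite ler_nat; exact: h1.
    have : (users b)%:R <= (users x + tau)%:R :> R by rewrite ler_nat; exact: h2.
    by rewrite !natrD; move: xlo xhi tau8 N0; forget => ? ? ? ? ? ?; apply/andP; split; lra.
  - by rewrite sum_state_vec; move: xhi N0; forget; lra.
  - move=> r; rewrite !mxE; have := @displacement_path x s r; rewrite ss => -> //.
have : 0 <= (A + e1) * tau%:R * \sum_r (midsize (theta' * N) (theta * N) x r +
    midsize (theta' * N) (theta * N) b r).
  by rewrite !mulr_ge0 ?addr_ge0 // ltW.
have -> : tau%:R * e1 = tau%:R * U^-1 * eps - tau%:R * e1.
  by rewrite /e1; field; rewrite gt_eqF.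
move: win err cost0; rewrite -/e1 -/G /potential; forget; lra.
Qed.

Lemma window_drift : exists c A, 0 < c /\ 0 <= A /\
  forall theta d0, 0 < theta <= 1 -> 0 < d0 ->
  exists delta theta' N0, [/\ 0 < delta <= d0, 0 < theta' < theta &
    forall N, N0 <= N -> [/\ 0 < N, (0 < Num.truncn (delta * N))%N &
    forall x, 3 / 4 * N <= (users x)%:R <= 5 / 4 * N ->
      iter (Num.truncn (delta * N)) (step_op move_prob (@move_user n)) potential x
        - potential x <=
      (Num.truncn (delta * N))%:R * (- c + A * \sum_r
        (midsize (theta' * N) (theta * N) x r +
         iter (Num.truncn (delta * N)) (step_op move_prob (@move_user n))
           (fun y => midsize (theta' * N) (theta * N) y r) x))]].
Proof.
have [D D0 hD] := gain_second_moment.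
have [e1 e1E e10] : exists2 e1, e1 = eps / U / 2 & 0 < e1.
  by exists (eps / U / 2) => //; rewrite !divr_gt0.
have [A0 A0E A00] : exists2 A0, A0 = 4 * D / e1 & 0 < A0.
  by exists (4 * D / e1) => //; rewrite divr_gt0 ?mulr_gt0.
(* Of the decrease [e1], one eighth pays for [kap], one eighth for the squared displacements and one
   quarter for the squared gains, which fixes [A0]; one half is left. *)
exists (e1 / 2), (A0 + e1); split; first by rewrite divr_gt0.
split; first by rewrite addr_ge0 // ltW.
move=> theta d0 th01 d00; have /andP[th0 th1] := th01.
have n1 : 0 < n%:R + 1 :> R by rewrite ltr_wpDl.
(* The three bounds serve the comparison of logarithms, the preservation of a ratio above
   [1 + k / 2], and the error [6 * sg * n * tau <= e1 / 2 * tau]. *)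
pose sg := Num.min (1 / 12) (Num.min (k / (6 * (1 + k))) (e1 / (12 * (n%:R + 1)))).
have k1 : 0 < 1 + k by rewrite addr_gt0.
have sg0 : 0 < sg by rewrite !lt_min !divr_gt0 ?mulr_gt0.
have sg12 : sg <= 1 / 12 by rewrite ge_min lexx.
have sgk : 6 * sg * (1 + k) <= k.
  have : sg <= k / (6 * (1 + k)) by rewrite !ge_min lexx orbT.
  by rewrite ler_pdivlMr ?mulr_gt0 //; lra.
have sgn : 6 * sg * n%:R <= e1 / 2.
  have : sg <= e1 / (12 * (n%:R + 1)) by rewrite !ge_min lexx !orbT.
  by rewrite ler_pdivlMr ?mulr_gt0 // => h; nra.
clearbody sg.
(* The first bound makes a displacement of [delta * N] in each coordinate, on top of the small
   coordinates, negligible for the ratios; [1 / 8] keeps the population comparable to [N]. *)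
pose delta := Num.min (sg ^+ 2 * theta / (4 * (n%:R + 1))) (Num.min d0 (1 / 8)).
have sg2 : 0 < sg ^+ 2 by rewrite exprn_gt0.
have delta0 : 0 < delta.
  by rewrite !lt_min d00 !divr_gt0 ?mulr_gt0.
have delta_d0 : delta <= d0 by rewrite !ge_min lexx orbT.
have delta8 : delta <= 1 / 8 by rewrite !ge_min lexx !orbT.
have delta_n : delta * (4 * (n%:R + 1)) <= sg ^+ 2 * theta.
  by rewrite -ler_pdivlMr ?mulr_gt0 // ge_min lexx.
have sgsq : sg ^+ 2 <= 1 / 144 by rewrite expr2; nra.
have sgth : sg ^+ 2 * theta <= 1 / 144 * theta by rewrite ler_pM2r.
have delta_th : delta <= theta / 4.
  have : 4 * delta <= delta * (4 * (n%:R + 1)).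
    have : 0 <= delta * n%:R by rewrite mulr_ge0 // ltW.
    lra.
  lra.
clearbody delta.
(* [K] precedes [theta'], because the error contains [theta' * ln K]; each of the two resulting
   terms is at most [delta * e1 / 8] per unit of [N]. *)
pose K := 16 * (n%:R + 1) / (delta * e1) + 1.
have de : 0 < delta * e1 by rewrite mulr_gt0.
have K1 : 1 <= K by rewrite lerDr divr_ge0 ?ltW // mulr_ge0 // ltW.
have K0 : 0 < K by exact: lt_le_trans K1.
have nK : n%:R * (2 / K) <= delta * e1 / 8.
  rewrite mulrA ler_pdivrMr //.
  have : (K - 1) * (delta * e1) = 16 * (n%:R + 1) by rewrite /K; field; rewrite !gt_eqF.
  lra.
clearbody K.
pose G := ln B - ln (sg * theta / 2).
have G0 : 0 <= G.
  rewrite subr_ge0; apply: le_trans lnB_ge0; apply: ln_le0; nra.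
pose Z := ln B + ln K + G.
have Z0 : 0 <= Z.
  by apply: addr_ge0 => //; apply: addr_ge0 => //; exact: ln_ge0.
pose theta' := Num.min delta (delta * e1 / (8 * (n%:R + 1) * (Z + 1))).
have Z1 : 0 < Z + 1 by rewrite ltr_wpDl.
have th'0 : 0 < theta' by rewrite lt_min delta0 divr_gt0 ?mulr_gt0.
have th'd : theta' <= delta by rewrite ge_min lexx.
have th'Z : n%:R * (theta' * Z) <= delta * e1 / 8.
  have : theta' <= delta * e1 / (8 * (n%:R + 1) * (Z + 1)) by rewrite ge_min lexx orbT.
  rewrite ler_pdivlMr ?mulr_gt0 // => h.
  have : n%:R * (theta' * Z) <= (n%:R + 1) * (theta' * (Z + 1)).
    apply: ler_pM; rewrite ?mulr_ge0 ?lerDl // ?ltW //.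
    by rewrite ltr_pM2l // ltrDl.
  move: h; forget; lra.
clearbody theta'.
(* Each displacement [m] is bounded by [kap * tau + m ^+ 2 / (kap * tau)]. Its mean square is at
   most [4 * tau], so the quadratic part stays bounded in mean, and a window longer than [Q] pays
   for it. *)
pose kap := e1 / (8 * (G * n%:R + 1)).
have Gn0 : 0 <= G * n%:R by rewrite mulr_ge0.
have Gn1 : 0 < G * n%:R + 1 by rewrite ltr_wpDl.
have kap0 : 0 < kap by rewrite divr_gt0 ?mulr_gt0.
have kapE : G * n%:R * kap <= e1 / 8.
  have : kap * (8 * (G * n%:R + 1)) = e1.
    by rewrite /kap divfK // gt_eqF // mulr_gt0.
  move: kap0; forget; lra.
clearbody kap.
pose Q := 32 * (G * n%:R) / (kap * e1).
have Q0 : 0 <= Q by rewrite divr_ge0 ?mulr_ge0 // ltW.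
exists delta, theta', (2 / delta * (1 + Q)).
split; first by rewrite delta0.
  rewrite th'0 /=; move: th'd delta_th th0; forget; lra.
move=> N hN.
have N0 : 0 < N by apply: lt_le_trans hN; rewrite mulr_gt0 ?divr_gt0 //; move: Q0; forget; lra.
have dN : 2 * (1 + Q) <= delta * N.
  by move: hN; rewrite mulrAC ler_pdivrMr // [N * _]mulrC.
have dN0 : 0 <= delta * N by rewrite mulr_ge0 // ltW.
have : (Num.truncn (delta * N))%:R <= delta * N by rewrite truncn_le.
have : delta * N < (Num.truncn (delta * N))%:R + 1 by rewrite natr1 truncnS_gt.
move: (Num.truncn _) => tau tau_gt tau_le.
have tau_ge : delta * N / 2 <= tau%:R by move: tau_gt dN Q0; forget; lra.
have tau0 : (0 < tau)%N by rewrite -(ltr_nat R); move: tau_ge dN Q0; forget; lra.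
have tau1 : 0 < tau%:R :> R by rewrite ltr0n.
split => // x hx.
have dmN : forall z : R, 0 <= z -> theta' * z <= delta * z.
  by move=> z z0; rewrite ler_wpM2r.
have thN : theta' * N <= delta * N by rewrite ler_wpM2r // ltW.
have path := @window_path N theta theta' sg K A0 tau x _ tau0 _ sgk th01 (ltW th'0) K1 A00 N0.
have {path} path s : size s = tau -> potential (run (@move_user n) x s) <=
   (potential x - tau%:R * e1 + G * n%:R * kap * tau%:R +
    (A0 + e1) * tau%:R * \sum_r midsize (theta' * N) (theta * N) x r) +
   (G / (kap * tau%:R) * (\sum_r path_cost (@move_user n) (displacement r) x s ^+ 2) +
   ((A0 + e1) * tau%:R *
     (\sum_r midsize (theta' * N) (theta * N) (run (@move_user n) x s) r) +
   path_cost (@move_user n) (fun y a => gain y a ^+ 2 / A0) x s)).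
  move=> sz.
  have abs_sq (m : R) : `|m| <= kap * tau%:R + m ^+ 2 / (kap * tau%:R).
    have q0 : 0 < kap * tau%:R by rewrite mulr_gt0.
    rewrite -(real_normK (num_real m)); set v := `|m|.
    rewrite -subr_ge0.
    have -> : kap * tau%:R + v ^+ 2 / (kap * tau%:R) - v =
      ((kap * tau%:R - v) ^+ 2 + kap * tau%:R * v) / (kap * tau%:R).
      by field; rewrite !gt_eqF.
    apply: divr_ge0; last exact: ltW.
    apply: addr_ge0; first exact: sqr_ge0.
    by apply: mulr_ge0; [exact: ltW|exact: normr_ge0].
  have absG : G * (\sum_r `|path_cost (@move_user n) (displacement r) x s|) <=
      G * n%:R * kap * tau%:R +
      G / (kap * tau%:R) * (\sum_r path_cost (@move_user n) (displacement r) x s ^+ 2).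
    have -> : G * n%:R * kap * tau%:R + G / (kap * tau%:R) *
        (\sum_r path_cost (@move_user n) (displacement r) x s ^+ 2) =
        G * \sum_(r < n) (kap * tau%:R +
          path_cost (@move_user n) (displacement r) x s ^+ 2 / (kap * tau%:R)).
      rewrite big_split /= sumr_const card_ord -mulr_suml -mulr_natl; ring.
    by rewrite ler_wpM2l //; apply: ler_sum.
  have : potential (run (@move_user n) x s) - potential x <=
    - (tau%:R * (eps / U / 2))
    + (ln B - ln (sg * theta / 2)) *
        (\sum_r `|path_cost (@move_user n) (displacement r) x s|)
    + (A0 + eps / U / 2) * tau%:R *
        (\sum_r (midsize (theta' * N) (theta * N) x r +
                 midsize (theta' * N) (theta * N) (run (@move_user n) x s) r))
    + path_cost (@move_user n) (fun y a => gain y a ^+ 2 / A0) x s.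
    apply: path => //.
    - by rewrite sg0.
    - have : n%:R * theta' <= n%:R * delta by rewrite ler_wpM2l.
      move: delta_n sgth th1 delta0; forget; lra.
    - have : delta * N <= theta / 4 * N by rewrite ler_pM2r.
      have : 0 < theta * N by rewrite mulr_gt0.
      move: tau_le; forget; lra.
    - have : delta * N <= 1 / 8 * N by rewrite ler_pM2r.
      move: tau_le; forget; lra.
    - have : delta * N <= theta / 4 * N by rewrite ler_pM2r.
      have : 0 < theta * N by rewrite mulr_gt0.
      move: tau_le thN; forget; lra.
    - have : delta * (4 * (n%:R + 1)) * N <= sg ^+ 2 * theta * N by rewrite ler_pM2r.
      have : n%:R * (theta' * N + tau%:R) <= n%:R * (2 * (delta * N)).
        by rewrite ler_wpM2l //; move: tau_le thN; forget; lra.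
      move: dN0; forget; lra.
    - have : n%:R * (theta' * Z) * N <= delta * e1 / 8 * N by rewrite ler_pM2r.
      have : n%:R * (2 / K) * N <= delta * e1 / 8 * N by rewrite ler_pM2r.
      have : 6 * sg * n%:R * tau%:R <= e1 / 2 * tau%:R by rewrite ler_pM2r.
      have : delta * N / 2 * e1 <= tau%:R * e1 by rewrite ler_pM2r.
      rewrite -e1E -/G -/Z mulrDr; move: tau_le tau_ge; forget; lra.
  rewrite -e1E -/G big_split /= mulrDr; move: absG; forget; lra.
rewrite -path_exp_run.
have step := path_exp_le (@move_user n) move_prob_ge0 (m := tau) x
  (Phi := fun s => potential (run (@move_user n) x s)) path.
rewrite lerBlDl; apply: le_trans step _.
rewrite path_expD path_exp_cst; last exact: sum_move_prob.
rewrite path_expD path_expZ path_exp_sum path_expD path_expZ path_exp_sum.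
have sq : \sum_r path_exp move_prob (@move_user n) tau x
    (fun s => path_cost (@move_user n) (displacement r) x s ^+ 2) <= n%:R * (tau%:R * 4).
  rewrite mulr_natl -[X in _ *+ X]card_ord -sumr_const; apply: ler_sum => r _.
  apply: (path_exp_cost_sqr_le _ move_prob_ge0 sum_move_prob).
    exact: displacement_mean.
  exact: displacement_sqr_le.
have cost : path_exp move_prob (@move_user n) tau x
    (path_cost (@move_user n) (fun y a => gain y a ^+ 2 / A0) x) <= tau%:R * (e1 / 4).
  apply: (path_exp_cost_le _ move_prob_ge0 sum_move_prob) => y.
  under eq_bigr do rewrite mulrA.
  rewrite -mulr_suml ler_pdivrMr //; apply: le_trans (hD y) _.
  by rewrite A0E le_eqVlt; apply/orP; left; apply/eqP; field; rewrite gt_eqF.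
have Gsq : G / (kap * tau%:R) * (n%:R * (tau%:R * 4)) <= tau%:R * (e1 / 8).
  have -> : G / (kap * tau%:R) * (n%:R * (tau%:R * 4)) = Q * e1 / 8.
    by rewrite /Q; field; rewrite !gt_eqF.
  have : Q * e1 <= tau%:R * e1 by rewrite ler_pM2r //; move: tau_ge dN; forget; lra.
  forget; lra.
have Gs : G / (kap * tau%:R) * \sum_r path_exp move_prob (@move_user n) tau x
    (fun s => path_cost (@move_user n) (displacement r) x s ^+ 2) <=
    G / (kap * tau%:R) * (n%:R * (tau%:R * 4)).
  by rewrite ler_wpM2l // divr_ge0 // mulr_ge0 // ltW.
have kt : G * n%:R * kap * tau%:R <= e1 / 8 * tau%:R by rewrite ler_pM2r.
have -> : \sum_r path_exp move_prob (@move_user n) tau x (fun s =>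
   midsize (theta' * N) (theta * N) (run (@move_user n) x s) r) =
   \sum_r iter tau (step_op move_prob (@move_user n))
     (fun y => midsize (theta' * N) (theta * N) y r) x.
  apply: eq_bigr => r _.
  by rewrite -path_exp_run.
rewrite big_split /=; move: cost Gsq Gs kt.
move: (path_exp _ _ _ _ _) (G / _ * _) => u v.
set S1 := \sum_r midsize _ _ _ _; set S2 := \sum_r iter _ _ _ _.
have -> : tau%:R * (- (e1 / 2) + (A0 + e1) * (S1 + S2)) =
  - (tau%:R * (e1 / 2)) + (A0 + e1) * tau%:R * S1 + (A0 + e1) * tau%:R * S2 by ring.
forget; lra.
Qed.

End network.

(** * Averaging over scales *)

(** Telescoping with step [tau]: only the two boundary blocks of length [tau] survive. *)
Lemma sum_shift {V : zmodType} (a : nat -> V) (T tau : nat) :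
  \sum_(t < T) (a (t + tau)%N - a t) = \sum_(i < tau) (a (T + i)%N - a i).
Proof.
have e1 : \sum_(t < T + tau) a t = \sum_(t < T) a t + \sum_(i < tau) a (T + i)%N.
  by rewrite big_split_ord.
have e2 : \sum_(t < T + tau) a t = \sum_(i < tau) a i + \sum_(t < T) a (t + tau)%N.
  rewrite addnC big_split_ord /=; congr (_ + _).
  by apply: eq_bigr => t _; rewrite addnC.
rewrite !sumrB; apply/eqP; rewrite subr_eq addrAC eq_sym subr_eq.
by rewrite addrC -e1 e2 addrC.
Qed.

Section averaging.
Context {R : realType} {S : eqType} {A : finType} (w : S -> A -> R) (mv : S -> A -> S).
Hypothesis w0 : forall x a, 0 <= w x a.
Hypothesis w1 : forall x, \sum_a w x a = 1.
Context (f : S -> R) (J T tmax : nat) (tau : 'I_J -> nat) (mid : 'I_J -> S -> R)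
  (c k b : R) (x : S).
Hypothesis tau_gt0 : forall j, (0 < tau j)%N.
Hypothesis tau_le : forall j, (tau j <= tmax)%N.
Hypothesis mid_ge0 : forall j y, 0 <= mid j y.
Hypothesis sum_mid : forall y, \sum_j mid j y <= b.
Hypothesis k_ge0 : 0 <= k.

Local Notation E t g := (iter t (step_op w mv) g x).

Hypothesis window : forall j s, (size s < T)%N ->
  iter (tau j) (step_op w mv) f (run mv x s) - f (run mv x s) <=
  (tau j)%:R * (- c + k * (mid j (run mv x s) +
     iter (tau j) (step_op w mv) (mid j) (run mv x s))).

(* Each state is of intermediate size for few scales only; summing over the
   scales and over time, the exceptional terms are outweighed. *)
Lemma averaged_drift :
  \sum_j (\sum_(i < tau j) (E (T + i) f - E i f)) / (tau j)%:R <=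
  - (c * J%:R * T%:R) + k * b * (T + (T + tmax))%:R.
Proof.
have mE0 j t : 0 <= E t (mid j).
  by rewrite -(iter_step_cst mv w1 t x 0); apply: iter_step_le.
have sumE t : \sum_j E t (mid j) <= b.
  rewrite -iter_step_sum -(iter_step_cst mv w1 t x b).
  by apply: iter_step_le.
have wnd (j : 'I_J) (t : 'I_T) : (E (t + tau j) f - E t f) / (tau j)%:R <=
    - c + k * (E t (mid j) + E (t + tau j) (mid j)).
  rewrite ler_pdivrMr ?ltr0n // mulrC !iterD.
  have : E t (iter (tau j) (step_op w mv) f) <= E t (fun y =>
      f y + (tau j)%:R * (- c + k * (mid j y + iter (tau j) (step_op w mv) (mid j) y))).
    apply: iter_step_le => // s sz; rewrite -lerBlDl; apply: window.
    by rewrite sz.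
  by rewrite iter_stepD iter_stepZ iter_stepD iter_stepZ iter_stepD iter_step_cst // lerBlDl.
apply: (@le_trans _ _ (\sum_(j < J) \sum_(t < T)
    (- c + k * (E t (mid j) + E (t + tau j) (mid j))))).
  apply: ler_sum => j _; rewrite -(sum_shift (fun t => E t f)) mulr_suml.
  by apply: ler_sum => t _; exact: wnd.
have -> : \sum_(j < J) \sum_(t < T) (- c + k * (E t (mid j) + E (t + tau j) (mid j))) =
    - (c * J%:R * T%:R) + k * (\sum_(t < T) \sum_j E t (mid j)) +
    k * (\sum_j \sum_(t < T) E (t + tau j) (mid j)).
  rewrite [X in _ = _ + k * X]exchange_big /=.
  rewrite exchange_big /=.
  have inner (t : 'I_T) :
      \sum_(j < J) (- c + k * (E t (mid j) + E (t + tau j) (mid j))) =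
      - (c * J%:R) + k * (\sum_j E t (mid j)) + k * (\sum_j E (t + tau j) (mid j)).
    rewrite big_split /= sumr_const card_ord -mulr_sumr big_split /= -mulr_natr.
    ring.
  rewrite (eq_bigr _ (fun t _ => inner t)) !big_split /= sumr_const card_ord.
  by rewrite -!mulr_sumr -mulr_natr; ring.
rewrite -addrA lerD2l -mulrDr -mulrA ler_wpM2l // natrD mulrDr.
apply: lerD.
  apply: (@le_trans _ _ (\sum_(t < T) b)); first by apply: ler_sum => t _.
  by rewrite sumr_const card_ord mulr_natr.
(* Completing the times [t + tau j] to all times below [T + tmax] gives every scale the same range,
   so that the sum over scales can be taken first and bounded by [b]. *)
apply: (@le_trans _ _ (\sum_(j < J) \sum_(u < T + tmax) E u (mid j))).
  apply: ler_sum => j _.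
  have -> : \sum_(u < T + tmax) E u (mid j) =
      \sum_(u < tau j) E u (mid j) + \sum_(t < T + (tmax - tau j)) E (tau j + t) (mid j).
    have -> : (T + tmax = tau j + (T + (tmax - tau j)))%N.
      by rewrite addnCA subnKC.
    by rewrite big_split_ord.
  rewrite big_split_ord /= addrA ler_wpDr ?sumr_ge0 //.
  rewrite ler_wpDl ?sumr_ge0 //; apply: ler_sum => t _.
  by rewrite addnC.
rewrite exchange_big /=; apply: (@le_trans _ _ (\sum_(u < T + tmax) b)).
  by apply: ler_sum => u _.
by rewrite sumr_const card_ord mulr_natr.
Qed.

End averaging.

(** The indicator on the right, instead of 1, is what the induction needs: a value above [th J]
    cannot lie in the next interval, and one below has met none so far. *)
Lemma sum_disjoint_le1 {R : realType} (th : nat -> R) (v : R) (J : nat) :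
  (forall j, th j.+1 < th j) ->
  \sum_(j < J) ((th j.+1 < v < th j)%R%:R : R) <= (th J < v)%R%:R.
Proof.
move=> dec; elim: J => [|J IH]; first by rewrite big_ord0 ler0n.
rewrite big_ord_recr /=.
have := dec J; case: (ltP (th J) v) IH => h IH d.
  rewrite (lt_trans d h) [v < _]lt_gtF // addr0; exact: IH.
apply: le_trans (lerD IH (lexx _)) _; rewrite add0r ler_nat.
by case: (th J.+1 < v); case: (v < th J).
Qed.

Lemma sum_ord_const {R : nzRingType} (m : nat) (v : R) : \sum_(i < m) v = m%:R * v.
Proof. by rewrite sumr_const card_ord mulr_natl. Qed.

Lemma ltr_sum_ord {R : numDomainType} (m : nat) (F G : 'I_m -> R) : (0 < m)%N ->
  (forall i, F i < G i) -> \sum_i F i < \sum_i G i.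
Proof.
case: m F G => // m F G _ FG; rewrite big_ord_recl [ltRHS]big_ord_recl.
by apply: ltr_leD => //; apply: ler_sum => i _; exact: ltW.
Qed.

Section scales.
Context {R : realType} {n : nat} (w : state n -> move n -> R) (f : state n -> R)
  (c A k : R).
Hypothesis w0 : forall x a, 0 <= w x a.
Hypothesis w1 : forall x, \sum_a w x a = 1.

Local Notation K := (step_op w (@move_user n)).

Hypothesis c_gt0 : 0 < c.
Hypothesis A_ge0 : 0 <= A.
Hypothesis k_ge0 : 0 <= k.
Hypothesis step_f : forall x, K f x <= f x + k.
Hypothesis window : forall theta d0, 0 < theta <= 1 -> 0 < d0 ->
  exists delta theta' N0, [/\ 0 < delta <= d0, 0 < theta' < theta &
    forall N, N0 <= N -> [/\ 0 < N, (0 < Num.truncn (delta * N))%N &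
    forall x, 3 / 4 * N <= (users x)%:R <= 5 / 4 * N ->
      iter (Num.truncn (delta * N)) K f x - f x <=
      (Num.truncn (delta * N))%:R * (- c + A * \sum_r
        (midsize (theta' * N) (theta * N) x r +
         iter (Num.truncn (delta * N)) K
           (fun y => midsize (theta' * N) (theta * N) y r) x))]].

Ltac forget := clear - w0 w1 c_gt0 A_ge0 k_ge0 step_f window.

Lemma iter_step_growth t x : iter t K f x <= f x + t%:R * k.
Proof.
elim: t x => [|t IH] x; first by rewrite mul0r addr0.
rewrite iterSr; apply: (@le_trans _ _ (iter t K (fun y => f y + k) x)).
  by apply: iter_step_le => // s _.
rewrite iter_stepD iter_step_cst // -natr1 mulrDl mul1r addrA lerD2r.
exact: IH.
Qed.

(** If no time gave the decrease, the boundary blocks of the telescoped sums would exceed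
    [- (c / 2) * J * T] in total. But [averaged_drift] bounds them by [- c * J * T + 3 * A * n * T],
    which is at most the same quantity. *)
Lemma state_dependent_drift : exists c' N1, 0 < c' /\
  forall x, N1 <= (users x)%:R :> R -> exists2 t, (0 < t)%N &
    iter t K f x <= f x - c' * t%:R.
Proof.
(* Windows are short against the horizon [T]: [tmax <= T], and the possible growth [k * tmax] is at
   most [c * T / 4]. *)
pose d0 := Num.min (1 / 16) (c / (32 * (k + 1))).
have k1 : 0 < k + 1 by rewrite ltr_wpDl.
have d00 : 0 < d0 by rewrite lt_min !divr_gt0 ?mulr_gt0.
have d0k : k * d0 <= c / 32.
  have : d0 <= c / (32 * (k + 1)) by rewrite ge_min lexx orbT.
  rewrite ler_pdivlMr ?mulr_gt0 //; lra.
have d016 : d0 <= 1 / 16 by rewrite ge_min lexx.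
clearbody d0.
have /choice[g hg] : forall theta, exists u : R * R * R, 0 < theta <= 1 ->
    [/\ 0 < u.1.1 <= d0, 0 < u.1.2 < theta &
    forall N, u.2 <= N -> [/\ 0 < N, (0 < Num.truncn (u.1.1 * N))%N &
    forall x, 3 / 4 * N <= (users x)%:R <= 5 / 4 * N ->
      iter (Num.truncn (u.1.1 * N)) K f x - f x <=
      (Num.truncn (u.1.1 * N))%:R * (- c + A * \sum_r
        (midsize (u.1.2 * N) (theta * N) x r +
         iter (Num.truncn (u.1.1 * N)) K
           (fun y => midsize (u.1.2 * N) (theta * N) y r) x))]].
  move=> theta; have [th|nth] := pselect (0 < theta <= 1); last first.
    by exists (0, 0, 0) => /nth.
  have [de [th' [N0 h]]] := window th d00.
  by exists (de, th', N0) => _.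
(* Each gap ends where the previous one begins, which makes the gaps of the different scales
   disjoint. *)
pose th j := iter j (fun v => (g v).1.2) 1.
have th01 j : 0 < th j <= 1.
  elim: j => [|j IH]; first by rewrite /th /= ltr01 lexx.
  have [_ /andP[h1 h2] _] := hg _ IH; rewrite /th /= -/(th j) h1 /=.
  by move: IH => /andP[_]; apply: le_trans; exact: ltW.
have thS j : th j.+1 < th j.
  by have [_ /andP[_ h2] _] := hg _ (th01 j).
(* Enough scales for the exceptional terms, at most [3 * A * n * T] over the horizon, to use up only
   half of [c * J * T]. *)
pose J := (Num.truncn (6 * A * n%:R / c)).+1.
have J0 : 0 < J%:R :> R by rewrite ltr0n.
have JA : 6 * A * n%:R <= c * J%:R.
  by rewrite [leRHS]mulrC -ler_pdivrMr // ltW // truncnS_gt.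
clearbody J.
pose Nmax := 64 + \sum_(j < J) `|(g (th j)).2|.
have Nmax_ge (j : 'I_J) : (g (th j)).2 <= Nmax.
  apply: le_trans (ler_norm _) _; rewrite /Nmax (bigD1 j) //= addrCA lerDl.
  by rewrite addr_ge0 // sumr_ge0.
have Nmax64 : 64 <= Nmax by rewrite lerDl sumr_ge0.
clearbody Nmax.
exists (c / 8), Nmax; split; first by rewrite divr_gt0.
move=> x hx; set N := (users x)%:R : R.
have N64 : 64 <= N by exact: le_trans hx.
have N0 : 0 < N by exact: lt_le_trans N64.
pose tau (j : 'I_J) := Num.truncn ((g (th j)).1.1 * N).
(* Within this many steps the population stays between [3 / 4 * N] and [5 / 4 * N], the range of the
   window estimate. *)
pose T := Num.truncn (N / 4).
pose tmax := Num.truncn (d0 * N).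
have T_le : T%:R <= N / 4 by rewrite truncn_le // divr_ge0 // ltW.
have T_gt : N / 4 < T%:R + 1 by rewrite natr1 truncnS_gt.
have tmax_le : tmax%:R <= d0 * N by rewrite truncn_le // mulr_ge0 // ltW.
have T0 : (0 < T)%N by rewrite -(ltr_nat R); lra.
have d0N : d0 * N <= 1 / 16 * N by rewrite ler_pM2r.
have win (j : 'I_J) := hg _ (th01 j).
have tau0 j : (0 < tau j)%N.
  by have [_ _ /(_ N)[]] := win j; first exact: le_trans (Nmax_ge j) hx.
have tau_le j : (tau j <= tmax)%N.
  have [/andP[_ h] _ _] := win j; apply: le_truncn.
  by rewrite ler_pM2r.
pose mid (j : 'I_J) (y : state n) := \sum_r midsize (th j.+1 * N) (th j * N) y r.
have mid0 j y : 0 <= mid j y by apply: sumr_ge0 => r _; rewrite /midsize ler0n.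
have sum_mid y : \sum_j mid j y <= n%:R.
  rewrite exchange_big /= -[X in _ <= X%:R]card_ord -sum1_card natr_sum.
  apply: ler_sum => r _.
  have dec j : th j.+1 * N < th j * N by rewrite ltr_pM2r.
  apply: le_trans (sum_disjoint_le1 (th := fun j => th j * N) (y r)%:R J dec) _.
  by rewrite ler_nat; case: (_ < _).
have main := @averaged_drift R _ _ w (@move_user n) w0 w1 f J T tmax tau mid c A n%:R x
  tau0 tau_le mid0 sum_mid A_ge0.
have {main} main : \sum_j (\sum_(i < tau j) (iter (T + i) K f x - iter i K f x)) / (tau j)%:R <=
    - (c * J%:R * T%:R) + A * n%:R * (T + (T + tmax))%:R.
  apply: main => j s sT.
  have [_ _ /(_ N)[|_ _ h]] := win j; first exact: le_trans (Nmax_ge j) hx.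
  have sN : (size s)%:R <= N / 4.
    by apply: le_trans T_le; rewrite ler_nat ltnW.
  have /andP[u1 u2] := users_run x s.
  have := h (run (@move_user n) x s).
  have : (users x)%:R <= (users (run (@move_user n) x s) + size s)%:R :> R.
    by rewrite ler_nat; exact: u1.
  have : (users (run (@move_user n) x s))%:R <= (users x + size s)%:R :> R.
    by rewrite ler_nat; exact: u2.
  rewrite !natrD -/N => v1 v2 hh; apply: le_trans (hh _) _.
    by move: v1 v2 sN; forget => v1 v2 sN; apply/andP; split; lra.
  rewrite big_split /= -iter_step_sum lexx //.
apply: contrapT => noT.
have big t : (0 < t)%N -> f x - c / 8 * t%:R < iter t K f x.
  by move=> t0; rewrite ltNge; apply/negP => ?; apply: noT; exists t.
have T1 : 1 <= T%:R :> R by rewrite ler1n.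
have tmaxT : tmax%:R <= T%:R :> R by move: tmax_le d0N T_gt N64; forget; lra.
have each (j : 'I_J) : - (c / 4 * T%:R) - tmax%:R * k <
    (\sum_(i < tau j) (iter (T + i) K f x - iter i K f x)) / (tau j)%:R.
  rewrite ltr_pdivlMr ?ltr0n // mulrC -sum_ord_const.
  have term (i : 'I_(tau j)) : - (c / 4 * T%:R) - tmax%:R * k <
      iter (T + i) K f x - iter i K f x.
    have iT : i%:R <= tmax%:R :> R.
      by rewrite ler_nat ltnW // (leq_trans (ltn_ord i)).
    have := big (T + i)%N; rewrite addn_gt0 T0 => /(_ isT).
    have := iter_step_growth i x.
    have : i%:R * k <= tmax%:R * k by rewrite ler_wpM2r.
    have : c / 8 * (T + i)%:R <= c / 8 * (T%:R + T%:R).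
      by rewrite natrD ler_wpM2l ?divr_ge0 ?(ltW c_gt0) // lerD2l (le_trans iT).
    forget; lra.
  exact: ltr_sum_ord.
have : J%:R * (- (c / 4 * T%:R) - tmax%:R * k) <
    - (c * J%:R * T%:R) + A * n%:R * (T + (T + tmax))%:R.
  apply: lt_le_trans main.
  rewrite -sum_ord_const.
  by apply: ltr_sum_ord => //; rewrite -(ltr_nat R).
have : A * n%:R * (T + (T + tmax))%:R <= A * n%:R * (3 * T%:R).
  by rewrite ler_wpM2l ?mulr_ge0 // !natrD; move: tmaxT; forget; lra.
have : 6 * A * n%:R * T%:R <= c * J%:R * T%:R by rewrite ler_wpM2r.
have : J%:R * (tmax%:R * k) <= J%:R * (c / 4 * T%:R).
  rewrite ler_pM2l //; apply: (@le_trans _ _ (d0 * N * k)); first by rewrite ler_wpM2r.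
  have : k * d0 * N <= c / 32 * N by rewrite ler_pM2r.
  have : c * (N / 8) <= c * T%:R by rewrite ler_pM2l //; move: T_gt N64; forget; lra.
  forget; lra.
rewrite mulrBr mulrN; forget; lra.
Qed.

End scales.

(** * Ergodicity *)

Section routing_network.
Context {R : realType} {n : nat} (C : set 'rV[R]_n) (lamPF : 'rV[R]_n -> 'rV[R]_n)
  (nubar mu nu : 'I_n -> R) (p : 'M[R]_n).
Hypothesis n_gt0 : (0 < n)%N.
Hypothesis C_capacity : capacity_set C.
Hypothesis PF : forall x : 'rV[R]_n, (forall r, 0 <= x ord0 r) ->
  is_pf_allocation C x (lamPF x).
Hypothesis nubar_ge0 : forall r, 0 <= nubar r.
Hypothesis mu_gt0 : forall r, 0 < mu r.
Hypothesis p_sub : substochastic p.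
Hypothesis traffic : forall r, nu r = nubar r + \sum_s p s r * nu s.
Hypothesis rho_int : interior C (\row_r (nu r / mu r)).
Context (h : 'I_n -> R).
Hypothesis hE : forall r, h r = 1 + \sum_s p r s * h s.

Local Notation rho := (fun r => nu r / mu r).
Local Notation q := (routing_rate nubar mu p lamPF).
Local Notation rate := (move_rate lamPF rho p nubar nu).
Implicit Types (x y z : state n) (a : move n).

Let nu_gt0 r : 0 < nu r.
Proof.
have := rho_gt0 C_capacity rho_int r.
by rewrite pmulr_lgt0 // invr_gt0.
Qed.

Let rate_ge0 x a : 0 <= rate x a.
Proof. exact: (move_rate_ge0 C_capacity PF rho_int p_sub nubar_ge0 nu_gt0). Qed.

Let ratio_pos x r : (0 < x r)%N -> 0 < ratio lamPF rho x r.
Proof. exact: (ratio_gt0 C_capacity PF rho_int). Qed.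

Inductive reach : state n -> state n -> Prop :=
| reach_refl x : reach x x
| reach_step x a y : 0 < rate x a -> reach (move_user x a) y -> reach x y.

Lemma reach_trans x y z : reach x y -> reach y z -> reach x z.
Proof. by move=> xy yz; elim: xy yz => // ? ? ? r0 _ IH /IH; exact: reach_step. Qed.

Lemma add_userK x r : del_user (add_user x r) r = x.
Proof. by apply/ffunP => i; rewrite !ffunE addnK. Qed.

Lemma del_userK x r : (0 < x r)%N -> add_user (del_user x r) r = x.
Proof.
move=> xr; apply/ffunP => i; rewrite !ffunE; apply: subnK.
by case: eqP => // ->.
Qed.

Let add_user_gt0 x r : (0 < add_user x r r)%N.
Proof. by rewrite ffunE eqxx addn1. Qed.

(** The moving user's own type is always occupied, so each move of its route to an exit has positive
    rate, whatever the other users. *)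
Lemma reach_depart r x : reach (add_user x r) x.
Proof.
move: r x; apply: (@routing_ind _ _ _ p_sub _ hE (fun r => forall x, reach (add_user x r) x)).
  move=> r leak x; apply: (@reach_step _ (Some r, None)).
    by rewrite /= mulr_gt0 // mulr_gt0 // ratio_pos.
  by rewrite /move_user /= add_userK; exact: reach_refl.
move=> r s prs IH x; apply: (@reach_step _ (Some r, Some s)).
  by rewrite /= mulr_gt0 // mulr_gt0 // ratio_pos.
by rewrite /move_user /= add_userK.
Qed.

Lemma reach_arrive r x : reach x (add_user x r).
Proof.
move: r x; apply: (@arrival_ind _ _ _ p_sub _ hE _ _ nubar_ge0 nu_gt0 traffic
  (fun r => forall x, reach x (add_user x r))).
  move=> r nr x; apply: (@reach_step _ (None, Some r)) => //.
  exact: reach_refl.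
move=> r s psr IH x; apply: reach_trans (IH x) _.
apply: (@reach_step _ (Some s, Some r)).
  by rewrite /= mulr_gt0 // mulr_gt0 // ratio_pos.
by rewrite /move_user /= add_userK; exact: reach_refl.
Qed.

Lemma users_eq0 x : users x = 0%N -> x = [ffun=> 0%N].
Proof.
move=> /eqP; rewrite /users sum_nat_eq0 => /forallP x0.
by apply/ffunP => r; rewrite ffunE; apply/eqP; exact: (implyP (x0 r)).
Qed.

Lemma users_gt0 x m : users x = m.+1 -> exists r, (0 < x r)%N.
Proof.
move=> xm; apply: contrapT => no; have : users x = 0%N; last by rewrite xm.
rewrite /users big1 // => r _; apply/eqP; rewrite -leqn0 leqNgt; apply/negP => xr.
by apply: no; exists r.
Qed.

Lemma reach_all x y : reach x y.
Proof.
apply: (@reach_trans _ [ffun=> 0%N]).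
  have [m xm] : exists m, users x = m by exists (users x).
  elim: m x xm => [|m IH] x xm; first by rewrite (users_eq0 xm); exact: reach_refl.
  have [r xr] := users_gt0 xm; rewrite -(del_userK xr).
  apply: reach_trans (reach_depart r _) (IH _ _).
  by apply: succn_inj; rewrite -xm -[in RHS](del_userK xr) users_add.
have [m ym] : exists m, users y = m by exists (users y).
elim: m y ym => [|m IH] y ym; first by rewrite (users_eq0 ym); exact: reach_refl.
have [r yr] := users_gt0 ym; rewrite -(del_userK yr).
apply: reach_trans (IH _ _) (reach_arrive r _).
by apply: succn_inj; rewrite -ym -[in RHS](del_userK yr) users_add.
Qed.

Lemma routing_rateE x y :
  q x y = \sum_a rate x a * (y == move_user x a)%:R.
Proof.
rewrite /routing_rate big_move /= mul0r add0r -addrA; congr (_ + _).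
have rateE r : mu r * lamPF (state_vec R x) ord0 r = nu r * ratio lamPF rho x r.
  by rewrite /ratio /pf_ratio; field; rewrite !gt_eqF.
rewrite addrC; congr (_ + _); apply: eq_bigr => r _; first by rewrite rateE.
by apply: eq_bigr => s _; rewrite rateE.
Qed.

Lemma esum_indic_point (D : set (state n)) z (v : R) : 0 <= v ->
  (\esum_(y in D) (v * (y == z)%:R)%:E = (v * (z \in D)%:R)%:E)%E.
Proof.
move=> v0; rewrite (esumID [set z]); last first.
  by move=> y _; rewrite lee_fin mulr_ge0.
rewrite [X in (_ + X)%E]esum1; last first.
  by move=> y [_ /eqP/negbTE ->]; rewrite mulr0.
rewrite adde0; have [zD|zD] := boolP (z \in D).
  rewrite (_ : D `&` [set z] = [set z]); last first.
    by apply/setIidPr => _ ->; apply: set_mem.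
  by rewrite esum_set1 ?eqxx // lee_fin mulr_ge0.
rewrite (_ : D `&` [set z] = set0) ?esum_set0 ?mulr0 //.
by apply/seteqP; split=> // y [yD yz]; move: zD; rewrite -yz mem_set.
Qed.

Lemma exit_rateE x : exit_rate q x = \sum_a rate x a * (move_user x a != x)%:R.
Proof.
rewrite /exit_rate.
under eq_esum => y _ do rewrite routing_rateE -sumEFin.
rewrite esum_sum; last by move=> y a _ _; rewrite lee_fin mulr_ge0.
under eq_bigr => a _ do rewrite esum_indic_point //.
rewrite sumEFin /=; apply: eq_bigr => a _; congr (_ * (nat_of_bool _)%:R).
by apply/idP/idP => [/set_mem|h']; last exact: mem_set.
Qed.

Lemma exit_rate_ge x : \sum_r nubar r <= exit_rate q x.
Proof.
rewrite exit_rateE big_move /= mul0r add0r.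
have -> : \sum_r nubar r * (move_user x (None, Some r) != x)%:R = \sum_r nubar r.
  apply: eq_bigr => r _; rewrite (_ : _ != _ = true) ?mulr1 //.
  apply/eqP => /(congr1 (fun y : state n => y r)).
  by rewrite ffunE eqxx addn1 => /eqP; rewrite -[X in _ == X]addn0 -addn1 eqn_add2l.
have nonneg a : 0 <= rate x a * (move_user x a != x)%:R by rewrite mulr_ge0.
rewrite lerDl addr_ge0 // sumr_ge0 // => r _.
  exact: (nonneg (Some r, None)).
by rewrite sumr_ge0 // => s _; exact: (nonneg (Some r, Some s)).
Qed.

(** Without arrivals, [arrival_ind] would prove the false predicate at some type. The total arrival
    rate is the uniform lower bound on exit rates that the exponential estimates require. *)
Lemma arrivals_gt0 : 0 < \sum_r nubar r.
Proof.
rewrite lt_neqAle sumr_ge0 // andbT eq_sym; apply/negP => /eqP e0.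
have nubar0 r : nubar r = 0 by have := psumr_eq0P (fun i _ => nubar_ge0 i) e0; exact.
have : forall r : 'I_n, False.
  apply: (@arrival_ind _ _ _ p_sub _ hE _ _ nubar_ge0 nu_gt0 traffic (fun=> False)).
    by move=> r; rewrite nubar0 ltxx.
  by [].
by move=> /(_ (Ordinal n_gt0)).
Qed.

Definition successors x : seq (state n) := undup [seq move_user x a | a : move n].

Lemma jump_sumE x (f : state n -> R) :
  \sum_(y <- successors x) jump_matrix q x y * f y =
  (\sum_a rate x a * (move_user x a != x)%:R * f (move_user x a)) / exit_rate q x.
Proof.
have exit0 : exit_rate q x != 0.
  by rewrite gt_eqF // (lt_le_trans arrivals_gt0) // exit_rate_ge.
transitivity (\sum_(y <- successors x) \sum_a
   rate x a * (y == move_user x a)%:R * (y != x)%:R * f y / exit_rate q x).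
  apply: eq_bigr => y _; rewrite /jump_matrix (negbTE exit0).
  have [->|yx] := eqVneq y x.
    by rewrite mul0r big1 // => a _; rewrite !mulr0 !mul0r.
  rewrite routing_rateE !mulr_suml /=; apply: eq_bigr => a _; ring.
rewrite exchange_big /= mulr_suml; apply: eq_bigr => a _.
rewrite (bigD1_seq (move_user x a)) ?undup_uniq //=; last first.
  by rewrite mem_undup; apply/mapP; exists a; rewrite ?mem_enum.
rewrite eqxx mulr1 big1 ?addr0; first by [].
by move=> y /negbTE ->; rewrite mulr0 !mul0r.
Qed.

Lemma jump_matrix_ge0 x y : 0 <= jump_matrix q x y.
Proof.
rewrite /jump_matrix; case: ifP => // _; rewrite divr_ge0 //.
  by rewrite routing_rateE sumr_ge0 // => a _; rewrite mulr_ge0.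
by apply: le_trans (exit_rate_ge x); rewrite ltW // arrivals_gt0.
Qed.

Lemma jump_matrix_sum x : \sum_(y <- successors x) jump_matrix q x y = 1.
Proof.
have := jump_sumE x (fun=> 1); under eq_bigr do rewrite mulr1.
move=> ->; under eq_bigr do rewrite mulr1.
rewrite -exit_rateE divff // gt_eqF // (lt_le_trans arrivals_gt0) //.
exact: exit_rate_ge.
Qed.

Lemma reach_path x y : reach x y -> exists m (g : nat -> state n),
  [/\ g 0%N = x, g m = y & 0 < path_weight q g m].
Proof.
elim=> [{}x|{}x a {}y r0 _ [m [g [g0 gm gw]]]].
  by exists 0%N, (fun=> x); split => //; rewrite /path_weight big_ord0.
(* A loop, such as the routing of a user to its own type, is not a jump and is dropped from the
   path. *)
have [mvx|mvx] := eqVneq (move_user x a) x.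
  by exists m, g; split => //; rewrite g0.
exists m.+1, (fun j => if j is j'.+1 then g j' else x); split => //.
rewrite /path_weight big_ord_recl /= mulr_gt0 // g0 /jump_matrix (negbTE mvx).
rewrite divr_gt0 //; last by apply: lt_le_trans (exit_rate_ge x); exact: arrivals_gt0.
rewrite routing_rateE (bigD1 a) //= eqxx mulr1 ltr_wpDr // sumr_ge0 // => b _.
by rewrite mulr_ge0.
Qed.

Lemma hitting_potential z : exists H : state n -> R, (forall y, 0 <= H y) /\
  forall y, y != z ->
  1 + \sum_(y' <- successors y) jump_matrix q y y' * H y' <= H y.
Proof.
have [B B1 hB] := pf_ratio_bounded C_capacity PF rho_int.
have [k k0 hk] := pf_potential_ge C_capacity PF rho_int.
have k2 : 1 < 1 + k / 2 by rewrite ltrDl divr_gt0.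
have [eps eps0 heps] := dissipation_coercive p_sub nubar_ge0 nu_gt0 hE k2.
pose U := \sum_r nubar r + \sum_r nu r * B + 1.
have nuB0 : 0 <= \sum_r nu r * B.
  by apply: sumr_ge0 => r _; rewrite mulr_ge0 ?ltW // (lt_le_trans ltr01).
have U0 : 0 < U by rewrite /U; have := arrivals_gt0; lra.
have U_ge x : \sum_a rate x a <= U.
  rewrite sum_move_rate.
  have : \sum_r nu r * ratio lamPF rho x r <= \sum_r nu r * B.
    apply: ler_sum => r _; rewrite ler_pM2l //; apply: hB; exact: state_vec_ge0.
  rewrite /U; lra.
have exitU x : exit_rate q x <= U.
  apply: le_trans (U_ge x); rewrite exit_rateE; apply: ler_sum => a _.
  by rewrite -[leRHS]mulr1 ler_wpM2l // lern1 leq_b1.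
clearbody U.
pose w := move_prob lamPF rho p nubar nu U.
have w0 x a : 0 <= w x a.
  exact: (move_prob_ge0 C_capacity PF rho_int p_sub nubar_ge0 nu_gt0 U0 U_ge).
have w1 x : \sum_a w x a = 1 by exact: sum_move_prob.
have stepE (f : state n -> R) x : step_op w (@move_user n) f x =
    f x + (\sum_a rate x a * (f (move_user x a) - f x)) / U.
  by rewrite /step_op sum_move_prob_mul.
pose L := potential lamPF rho.
have L0 x : 0 <= L x.
  apply: le_trans (hk _ (state_vec_ge0 x)); rewrite mulr_ge0 ?sumr_ge0 //.
    by rewrite ln_ge0 // lerDl ltW.
  by move=> r _; exact: state_vec_ge0.
have [D D0 hD] := gain_second_moment C_capacity PF rho_int p_sub nubar_ge0 nu_gt0 B1 hB U0.
have stepL x : step_op w (@move_user n) L x <= L x + (1 + D).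
  apply: (@le_trans _ _ (\sum_a w x a * (L x + 1 + gain lamPF rho x a ^+ 2))).
    apply: ler_sum => a _; rewrite ler_wpM2l //.
    have : L (move_user x a) - L x <= gain lamPF rho x a by rewrite le_max lexx orbT.
    have : 0 <= (gain lamPF rho x a - 1) ^+ 2 by exact: sqr_ge0.
    have : 0 <= gain lamPF rho x a ^+ 2 by exact: sqr_ge0.
    rewrite sqrrB1; lra.
  under eq_bigr do rewrite mulrDr.
  rewrite big_split /= -mulr_suml w1 mul1r -addrA lerD2l lerD2l; exact: hD.
have [c [A [c0 [A0 win]]]] := window_drift C_capacity PF rho_int p_sub nubar_ge0
  nu_gt0 B1 hB U0 U_ge traffic k0 hk eps0 heps.
have D1 : 0 <= 1 + D by rewrite addr_ge0 // ltW.
have [c' [N1 [c'0 drift]]] := state_dependent_drift w0 w1 c0 A0 D1 stepL win.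
pose M := Num.truncn N1.
(* The box of states with all coordinates at most [M]; outside it a single coordinate already
   exceeds [N1]. *)
pose F : seq (state n) :=
  [seq [ffun r => val (g r)] | g : {ffun 'I_n -> 'I_M.+1}].
have FN x : x \notin F -> N1 <= (users x)%:R :> R.
  move=> xF; have [r xr] : exists r, (M < x r)%N.
    apply: contrapT => no; move: xF => /negP; apply.
    have xM r : (x r < M.+1)%N.
      by rewrite ltnS leqNgt; apply/negP => ?; apply: no; exists r.
    apply/mapP; exists [ffun r => Ordinal (xM r)]; first by rewrite mem_enum.
    by apply/ffunP => r; rewrite !ffunE.
  apply: ltW; apply: lt_le_trans (truncnS_gt N1) _; rewrite ler_nat.
  by apply: leq_trans xr _; rewrite /users (bigD1 r) //= leq_addr.
have V0 x : 0 <= c'^-1 * L x by rewrite mulr_ge0 // invr_ge0 ltW.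
have driftV x : x \notin F -> exists2 t, (0 < t)%N &
    iter t (step_op w (@move_user n)) (fun y => c'^-1 * L y) x <= c'^-1 * L x - t%:R.
  move=> /FN/drift[t t0 ht]; exists t => //.
  rewrite iter_stepZ ler_pdivrMl // mulrBr mulVKf ?gt_eqF //.
have w_gt0 x a : 0 < rate x a -> 0 < w x a.
  move=> r0; rewrite /w /move_prob ltr_pwDl ?divr_gt0 //; case: ifP => // _.
  by rewrite subr_ge0 ler_pdivrMr // mul1r.
have reachK x y : reach x y ->
    exists l, 0 < iter l (step_op w (@move_user n)) (fun y' => (y' == y)%:R) x.
  elim=> [{}x|{}x a {}y r0 _ [l hl]]; first by exists 0%N; rewrite /= eqxx.
  exists l.+1; rewrite iterS /step_op (bigD1 a) //= ltr_pwDl //.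
    by rewrite mulr_gt0 // w_gt0.
  apply: sumr_ge0 => b _; apply: mulr_ge0 => //.
  rewrite -[leLHS](iter_step_cst (@move_user n) w1 l (move_user x b) 0).
  by apply: iter_step_le => // s _; rewrite ler0n.
have [H [H0 hH]] := foster_lyapunov w0 w1 V0 driftV (fun x => reachK x z (reach_all x z)).
exists H; split => // y yz.
have := hH y yz; rewrite stepE => {}hH.
have exit0 : 0 < exit_rate q y by apply: lt_le_trans (exit_rate_ge y); exact: arrivals_gt0.
rewrite jump_sumE.
have e : \sum_a rate y a * (H (move_user y a) - H y) =
   \sum_a rate y a * (move_user y a != y)%:R * H (move_user y a) - exit_rate q y * H y.
  rewrite exit_rateE mulr_suml -sumrB; apply: eq_bigr => a _.
  by have [->|_] := eqVneq (move_user y a) y; rewrite /=; ring.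
rewrite e in hH; set G := \sum_a _ in hH *.
(* For the uniformized chain the inequality says that the generator applied to [H] is at most [- U],
   hence at most [- exit_rate q y], which is the inequality for the jump chain. *)
have : 1 + (G - exit_rate q y * H y) / U <= 0 by lra.
rewrite -lerBrDl sub0r ler_pdivrMr // mulN1r => hG.
have : (1 + G / exit_rate q y) * exit_rate q y <= H y * exit_rate q y.
  rewrite mulrDl mul1r divfK ?gt_eqF //; have := exitU y; lra.
by rewrite ler_pM2r.
Qed.

Context {d : measure_display} {Omega : measurableType d}
  (P : state n -> probability Omega R) (X : R -> Omega -> option (state n)).
Hypothesis X_markov : markov_process q P X.

Lemma routing_ergodic : ergodic P X.
Proof.
split=> [x y|z].
  have [m [g [<- <- gw]]] := reach_path (reach_all x y).
  exact: (law_reach arrivals_gt0 exit_rate_ge gw (X_markov _)).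
have [H [H0 hH]] := hitting_potential z.
apply: (mean_return_time_lty arrivals_gt0 exit_rate_ge _ jump_matrix_ge0
  jump_matrix_sum H0 hH (X_markov z)).
by move=> x; exact: undup_uniq.
Qed.

End routing_network.

Theorem theorem1 (R : realType) (n : nat) (C : set 'rV[R]_n)
    (lamPF : 'rV[R]_n -> 'rV[R]_n) (nubar mu nu : 'I_n -> R) (p : 'M[R]_n)
    (d : measure_display) (Omega : measurableType d)
    (P : state n -> probability Omega R) (X : R -> Omega -> option (state n)) :
  (0 < n)%N ->
  capacity_set C ->
  (forall x : 'rV[R]_n, (forall r, 0 <= x ord0 r) ->
     is_pf_allocation C x (lamPF x)) ->
  (forall r, 0 <= nubar r) ->
  (forall r, 0 < mu r) ->
  substochastic p ->
  spectral_radius p < 1 ->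
  (forall r, nu r = nubar r + \sum_s p s r * nu s) ->
  interior C (\row_r (nu r / mu r)) ->
  markov_process (routing_rate nubar mu p lamPF) P X ->
  ergodic P X.
Proof.
move=> n0 hC PF nubar0 mu0 p_sub p_lt1 traffic rho_int X_markov.
have [h hE] := spectral_radius_potential p_sub p_lt1.
exact: (routing_ergodic n0 hC PF nubar0 mu0 p_sub traffic rho_int hE X_markov).
Qed.
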